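(* Let $M\subset\mathbb{R}^m$ and $N\subset\mathbb{R}^n$ be semialgebraic sets and let $\gamma:\beta_s^*N\to\beta_s^*M$ be a homeomorphism. Then $\gamma$ restricts to a homeomorphism $\gamma|:N_{\mathrm{lc}}\setminus\eta(N_{\mathrm{lc}})\to M_{\mathrm{lc}}\setminus\eta(M_{\mathrm{lc}})$ (in particular $\gamma$ maps the first set onto the second).
   Context: A map on a semialgebraic set is called semialgebraic if it is continuous and has semialgebraic graph. $\mathcal{S}^*(M)$ is the ring of bounded (continuous) semialgebraic functions $M\to\mathbb{R}$. $\beta_s^*M$ is the set of maximal ideals of $\mathcal{S}^*(M)$ with the topology induced by the Zariski topology of $\operatorname{Spec}(\mathcal{S}^*(M))$, i.e. with basis of open sets $\{\mathfrak{m}^*: f\notin\mathfrak{m}^*\}$, $f\in\mathcal{S}^*(M)$. The space $M$ (Euclidean topology) is identified with a dense subspace of $\beta_s^*M$ through $p\mapsto\mathfrak{m}_p^*:=\{f\in\mathcal{S}^*(M): f(p)=0\}$. $M_{\mathrm{lc}}$ is the set of points of $M$ that have a compact neighborhood in $M$ (it is a semialgebraic set). For a semialgebraic set $M$, $\eta(M)$ is the (finite) set of points $p\in M$ that have an open neighborhood in $M$ that is semialgebraically homeomorphic to $[0,1)$ by a homeomorphism sending $p$ to $0$, where a semialgebraic homeomorphism is a semialgebraic map that is a homeomorphism. *)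

(* Defs.v *)
From HB Require Import structures.
From mathcomp Require Import all_boot all_order all_algebra.
From mathcomp Require Import all_classical all_reals all_analysis.
(* canonicals only: the notations of mpoly clash with those of all_analysis *)
From mathcomp.multinomials Require Import (canonicals) mpoly.
From mathcomp.real_closed Require ordered_qelim qe_rcf.

Set Implicit Arguments.
Unset Strict Implicit.
Unset Printing Implicit Defensive.

Import Order.TTheory GRing.Theory Num.Theory.
Import numFieldNormedType.Exports.

Local Open Scope classical_set_scope.
Local Open Scope ring_scope.

(* Finite boolean combinations of polynomial equations and inequalities. *)
Inductive semialgebraic (R : realType) (m : nat) : set 'rV[R]_m -> Prop :=
| semialgebraic_eq0 (p : mpoly.mpoly m R) :
    semialgebraic [set x | mpoly.meval (x 0) p = 0]
| semialgebraic_gt0 (p : mpoly.mpoly m R) :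
    semialgebraic [set x | 0 < mpoly.meval (x 0) p]
| semialgebraicI (A B : set 'rV[R]_m) :
    semialgebraic A -> semialgebraic B -> semialgebraic (A `&` B)
| semialgebraicU (A B : set 'rV[R]_m) :
    semialgebraic A -> semialgebraic B -> semialgebraic (A `|` B)
| semialgebraicC (A : set 'rV[R]_m) :
    semialgebraic A -> semialgebraic (~` A).

Section polynomial_functions.
Context {R : realType}.

Definition polyfun m (h : 'rV[R]_m -> R) :=
  exists p : mpoly.mpoly m R, forall x : 'rV[R]_m, mpoly.meval (x 0) p = h x.

Lemma eq_polyfun m (h k : 'rV[R]_m -> R) : h =1 k -> polyfun h -> polyfun k.
Proof. by move=> hk [p hp]; exists p => x; rewrite hp. Qed.

Lemma polyfun_coord m (i : 'I_m) : polyfun (fun x : 'rV[R]_m => x 0 i).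
Proof. by exists (mpoly.mpolyX R (mpoly.mnm1 i)) => x; rewrite mpoly.mevalXU. Qed.

Lemma polyfun_cst m c : polyfun (fun _ : 'rV[R]_m => c).
Proof. by exists (mpoly.mpolyC m c) => x; rewrite mpoly.mevalC. Qed.

Lemma polyfunD m (h k : 'rV[R]_m -> R) :
  polyfun h -> polyfun k -> polyfun (fun x => h x + k x).
Proof.
by move=> [p hp] [q kq]; exists (p + q) => x; rewrite mpoly.mevalD hp kq.
Qed.

Lemma polyfunM m (h k : 'rV[R]_m -> R) :
  polyfun h -> polyfun k -> polyfun (fun x => h x * k x).
Proof.
by move=> [p hp] [q kq]; exists (p * q) => x; rewrite mpoly.mevalM hp kq.
Qed.

Lemma polyfunN m (h : 'rV[R]_m -> R) : polyfun h -> polyfun (fun x => - h x).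
Proof. by move=> [p hp]; exists (- p) => x; rewrite mpoly.mevalN hp. Qed.

Lemma polyfunX m (h : 'rV[R]_m -> R) n :
  polyfun h -> polyfun (fun x => h x ^+ n).
Proof.
by move=> [p hp]; exists (p ^+ n) => x; rewrite rmorphXn/= hp.
Qed.

Lemma polyfunB m (h k : 'rV[R]_m -> R) :
  polyfun h -> polyfun k -> polyfun (fun x => h x - k x).
Proof. by move=> ph pk; apply: polyfunD => //; exact: polyfunN. Qed.

Lemma semialgebraic_polyfun_eq0 m (h : 'rV[R]_m -> R) :
  polyfun h -> semialgebraic [set x | h x = 0].
Proof.
move=> [p hp]; have -> : h = fun x : 'rV[R]_m => mpoly.meval (x 0) p.
  by apply/funext => x; rewrite hp.
exact: semialgebraic_eq0.
Qed.

Lemma semialgebraic_polyfun_gt0 m (h : 'rV[R]_m -> R) :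
  polyfun h -> semialgebraic [set x | 0 < h x].
Proof.
move=> [p hp]; have -> : h = fun x : 'rV[R]_m => mpoly.meval (x 0) p.
  by apply/funext => x; rewrite hp.
exact: semialgebraic_gt0.
Qed.

Lemma semialgebraic_const m (b : bool) : semialgebraic [set _ : 'rV[R]_m | b].
Proof.
have := semialgebraic_polyfun_eq0 (@polyfun_cst m (~~ b)%:R).
congr semialgebraic; apply/seteqP; split => x /=; case: b => //=.
by move=> /eqP; rewrite oner_eq0.
Qed.

Lemma semialgebraic_preimage m n (F : 'rV[R]_m -> 'rV[R]_n) (A : set 'rV[R]_n) :
  (forall i, polyfun (fun x => F x 0 i)) ->
  semialgebraic A -> semialgebraic [set x | A (F x)].
Proof.
move=> /choice[q qF] sA.
have sub (p : mpoly.mpoly n R) : polyfun (fun x : 'rV[R]_m => mpoly.meval (F x 0) p).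
  exists (mpoly.comp_mpoly [tuple q i | i < n] p) => x.
  rewrite mpoly.comp_mpoly_meval; apply: mpoly.meval_eq => i.
  by rewrite tnth_mktuple qF.
elim: sA => [p|p|B C _ IHB _ IHC|B C _ IHB _ IHC|B _ IHB].
- exact: semialgebraic_polyfun_eq0.
- exact: semialgebraic_polyfun_gt0.
- exact: semialgebraicI.
- exact: semialgebraicU.
- exact: semialgebraicC.
Qed.

End polynomial_functions.

Section tarski_seidenberg.
Import ordered_qelim.
Context {R : realType}.

Let env m (x : 'rV[R]_m) : seq R := [seq x 0 i | i <- enum 'I_m].

Let size_env m (x : 'rV[R]_m) : size (env x) = m.
Proof. by rewrite size_map size_enum_ord. Qed.

Let nth_env m (x : 'rV[R]_m) (i : 'I_m) : nth 0 (env x) i = x 0 i.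
Proof. by rewrite (nth_map i) ?size_enum_ord// nth_ord_enum. Qed.

Let term_of_mpoly m (p : mpoly.mpoly m R) :
  exists t : GRing.term R,
    forall x : 'rV[R]_m, GRing.eval (env x) t = mpoly.meval (x 0) p.
Proof.
elim/mpoly.mpolyind: p => [|c a p _ _ [t tp]].
  by exists (GRing.Const 0) => x; rewrite mpoly.meval0.
exists (GRing.Add (GRing.Mul (GRing.Const c)
  (\big[@GRing.Mul R/GRing.Const 1]_(i < m)
     GRing.Exp (GRing.Var R i) (mpoly.fun_of_multinom a i))) t) => x /=.
rewrite mpoly.mevalD mpoly.mevalZ mpoly.mevalX tp; congr (_ * _ + _).
elim/big_ind2 : _ => [//|t1 y1 t2 y2 /= -> -> //|i _ /=].
by rewrite nth_env.
Qed.

Let formula_of_semialgebraic m (A : set 'rV[R]_m) : semialgebraic A ->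
  exists f : ord.formula R, forall x, ord.holds (env x) f <-> A x.
Proof.
elim=> [p|p|B C _ [f fB] _ [g gC]|B C _ [f fB] _ [g gC]|B _ [f fB]].
- have [t tp] := term_of_mpoly p.
  by exists (ord.Equal t (GRing.Const 0)) => x /=; rewrite tp.
- have [t tp] := term_of_mpoly p.
  by exists (ord.Lt (GRing.Const 0) t) => x /=; rewrite tp.
- by exists (ord.And f g) => x /=; rewrite fB gC.
- by exists (ord.Or f g) => x /=; rewrite fB gC.
- by exists (ord.Not f) => x /=; rewrite fB.
Qed.

Let polyfun_term m (t : GRing.term R) : GRing.rterm t ->
  polyfun (fun x : 'rV[R]_m => GRing.eval (env x) t).
Proof.
elim: t => //=.
- move=> i _; have [im|mi] := ltnP i m.
    apply: eq_polyfun (polyfun_coord (Ordinal im)) => x.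
    by rewrite -nth_env.
  apply: eq_polyfun (@polyfun_cst R m 0) => x.
  by rewrite nth_default// size_env.
- by move=> c _; exact: polyfun_cst.
- by move=> c _; exact: polyfun_cst.
- by move=> t IHt u IHu /andP[/IHt ? /IHu ?]; exact: polyfunD.
- by move=> t IHt /IHt ?; exact: polyfunN.
- move=> t IHt n /IHt ht.
  apply: eq_polyfun (polyfunM (@polyfun_cst R m n%:R) ht) => x.
  by rewrite mulr_natl.
- by move=> t IHt u IHu /andP[/IHt ? /IHu ?]; exact: polyfunM.
- by move=> t IHt n /IHt ?; exact: polyfunX.
Qed.

Let semialgebraic_qf m (f : ord.formula R) :
  ord.qf_form f -> ord.rformula f ->
  semialgebraic [set x : 'rV[R]_m | ord.qf_eval (env x) f].
Proof.
elim: f => //=.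
- by move=> b _ _; exact: semialgebraic_const.
- move=> t u _ /andP[/polyfun_term-/(_ m) tP /polyfun_term-/(_ m) uP].
  have := semialgebraic_polyfun_eq0 (polyfunB tP uP); congr semialgebraic.
  apply/seteqP; split => x /=; first by move/eqP; rewrite subr_eq0.
  by move/eqP => ->; rewrite subrr.
- move=> t u _ /andP[/polyfun_term-/(_ m) tP /polyfun_term-/(_ m) uP].
  have := semialgebraic_polyfun_gt0 (polyfunB uP tP); congr semialgebraic.
  by apply/seteqP; split => x /=; rewrite subr_gt0.
- move=> t u _ /andP[/polyfun_term-/(_ m) tP /polyfun_term-/(_ m) uP].
  have := semialgebraicC (semialgebraic_polyfun_gt0 (polyfunB tP uP)).
  congr semialgebraic.
  by apply/seteqP; split => x /=; rewrite subr_gt0 leNgt => /negP.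
- move=> f IHf g IHg /andP[qf qg] /andP[rf rg].
  have := semialgebraicI (IHf qf rf) (IHg qg rg); congr semialgebraic.
  by apply/seteqP; split => x /= /andP.
- move=> f IHf g IHg /andP[qf qg] /andP[rf rg].
  have := semialgebraicU (IHf qf rf) (IHg qg rg); congr semialgebraic.
  by apply/seteqP; split => x /= /orP.
- move=> f IHf g IHg /andP[qf qg] /andP[rf rg].
  have := semialgebraicU (semialgebraicC (IHf qf rf)) (IHg qg rg).
  congr semialgebraic; apply/seteqP; split => x /=.
    by move=> [/negP/negPf ->//|->]; rewrite implybT.
  by rewrite implybE => /orP[/negP|]; [left|right].
- move=> f IHf qf rf.
  have := semialgebraicC (IHf qf rf); congr semialgebraic.
  by apply/seteqP; split => x /= /negP.
Qed.

(* quantifier elimination over real closed fields *)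
Let semialgebraic_holds m (f : ord.formula R) :
  semialgebraic [set x : 'rV[R]_m | ord.holds (env x) f].
Proof.
pose g := ord.quantifier_elim
    (fun i bc => qe_rcf.qfr_to_formula (qe_rcf.wproj i bc)) (ord.to_rform f).
have /andP[qg rg] : ord.qf_form g && ord.rformula g.
  apply: ord.quantifier_elim_wf; last exact: ord.to_rform_rformula.
  exact: qe_rcf.wf_QE_wproj.
have := semialgebraic_qf m qg rg; congr semialgebraic.
by apply/seteqP; split => x /= /qe_rcf.rcf_satP.
Qed.

Lemma semialgebraic_proj m (A : set 'rV[R]_(m + 1)) : semialgebraic A ->
  semialgebraic [set x : 'rV[R]_m | exists y : R, A (row_mx x (const_mx y))].
Proof.
move=> /formula_of_semialgebraic[f fA].
have := semialgebraic_holds m (ord.Exists m f); congr semialgebraic.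
have envE (x : 'rV[R]_m) y :
    env (row_mx x (const_mx y : 'rV_1)) = set_nth 0 (env x) m y.
  apply: (@eq_from_nth _ 0) => [|i].
    by rewrite size_set_nth !size_env addn1 maxnC (maxn_idPr _).
  rewrite size_env => im; rewrite nth_set_nth/=.
  rewrite (nth_env _ (Ordinal im)) mxE.
  case: splitP => j /= ->; last by rewrite ord1 addn0 eqxx mxE.
  by rewrite ltn_eqF// nth_env.
by apply/seteqP; split => x /= [y]; rewrite -?envE => Ay; exists y;
  [rewrite -fA|rewrite -envE fA].
Qed.

End tarski_seidenberg.

Definition homeomorphism (X Y : topologicalType) (f : X -> Y) :=
  exists g : Y -> X, [/\ continuous f, continuous g, cancel f g & cancel g f].

Section maximal_spectrum.
Context {A : comPzRingType}.

(* ring_quotient.idealr_closed requires 1 != 0, which fails in the ring of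
   bounded semialgebraic functions on the empty set. *)
Definition ideal (I : set A) :=
  [/\ I 0, forall x y, I x -> I y -> I (x + y) & forall a x, I x -> I (a * x)].

Definition maximal_ideal (I : set A) :=
  [/\ ideal I, I <> setT &
      forall J, ideal J -> I `<=` J -> J = I \/ J = setT].

Record max_spec := MaxSpec {
  max_spec_set : set A;
  max_specP : maximal_ideal max_spec_set }.

HB.instance Definition _ := gen_eqMixin max_spec.
HB.instance Definition _ := gen_choiceMixin max_spec.

Lemma ideal_one (I : set A) : ideal I -> I 1 -> I = setT.
Proof.
move=> [_ _ IM] I1; apply/seteqP; split => // x _.
by rewrite -[x]mulr1; exact: IM.
Qed.

Lemma maximal_ideal_prime (I : set A) a b :
  maximal_ideal I -> I (a * b) -> I a \/ I b.
Proof.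
move=> [[I0 ID IM] _ Imax] Iab.
pose J := [set x | exists y r, I y /\ x = y + r * a].
have J_ideal : ideal J.
  split=> [|_ _ [y [r [Iy ->]]] [z [s [Iz ->]]]|c _ [y [r [Iy ->]]]].
  - by exists 0, 0; rewrite mul0r addr0.
  - exists (y + z), (r + s); split; first exact: ID.
    by rewrite mulrDl addrACA.
  - exists (c * y), (c * r); split; first exact: IM.
    by rewrite mulrDr mulrA.
have IJ : I `<=` J by move=> x Ix; exists x, 0; rewrite mul0r addr0.
have Ja : J a by exists 0, 1; rewrite mul1r add0r.
have [JI|JT] := Imax J J_ideal IJ; first by left; rewrite -JI.
have [y [r [Iy e]]] : J 1 by rewrite JT.
right; rewrite -[b]mul1r e mulrDl; apply: ID.
  by rewrite mulrC; exact: IM.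
by rewrite -mulrA; exact: IM.
Qed.

Definition zariski_basic (a : A) : set max_spec := [set I : max_spec | ~ max_spec_set I a].

(* By maximal_ideal_prime the sets zariski_basic a are stable under binary
   intersection, so the unions of them form the topology with this basis. *)
Definition zariski_open : set_system max_spec :=
  [set U | exists F : set A, U = \bigcup_(a in F) zariski_basic a].

Let zariski_openT : zariski_open setT.
Proof.
exists [set 1]; rewrite bigcup_set1; apply/seteqP; split => // I _ I1.
by have [/ideal_one/(_ I1)] := max_specP I.
Qed.

Let zariski_openI : setI_closed zariski_open.
Proof.
move=> _ _ [F ->] [G ->]; exists [set a * b | a in F & b in G].
apply/seteqP; split => I.
  move=> [[a Fa Ia] [b Gb Ib]]; exists (a * b); first by exists a => //; exists b.
  by move=> /(maximal_ideal_prime (max_specP I))[/Ia|/Ib].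
move=> [_ [a Fa [b Gb <-]]] Iab; have [[_ _ IM] _ _] := max_specP I.
split; [exists a => // Ia|exists b => // Ib]; apply: Iab; last exact: IM.
by rewrite mulrC; exact: IM.
Qed.

Let zariski_open_bigU (K : Type) (f : K -> set max_spec) :
  (forall i, zariski_open (f i)) -> zariski_open (\bigcup_i f i).
Proof.
move=> /choice[F fE]; exists (\bigcup_i F i); rewrite bigcup_bigcup.
by apply: eq_bigcup => // i _; rewrite fE.
Qed.

HB.instance Definition _ := isOpenTopological.Build max_spec
  zariski_openT zariski_openI zariski_open_bigU.

End maximal_spectrum.
Arguments max_spec : clear implicits.

(* The graph of f is taken in R^(m + 1); A carries the topology induced by R^m,
   and need not be assumed semialgebraic: it is a projection of the graph. *)
Definition semialgebraic_fun (R : realType) m (A : set 'rV[R]_m) (f : A -> R) :=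
  continuous f /\
  semialgebraic (range (fun x : A => row_mx (set_val x) (const_mx (f x) : 'rV_1))).

Record semialgebraic_set (R : realType) (m : nat) := SemialgebraicSet {
  carrier :> set 'rV[R]_m;
  carrierP : semialgebraic carrier }.

Definition bounded_semialgebraic (R : realType) m (M : semialgebraic_set R m) :
    {pred M -> R} :=
  fun f => `[< semialgebraic_fun f /\ bounded_fun f >].

Section bounded_semialgebraic_ring.
Context {R : realType} {m : nat} (M : semialgebraic_set R m).

Lemma semialgebraic_fun_cst (c : R) : semialgebraic_fun (fun _ : M => c).
Proof.
split; first exact: cst_continuous.
have cM : semialgebraic [set t : 'rV[R]_(m + 1) | carrier M (lsubmx t)].
  apply: semialgebraic_preimage (carrierP M) => i.
  by apply: eq_polyfun (polyfun_coord (lshift 1 i)) => x; rewrite mxE.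
have cc : semialgebraic [set t : 'rV[R]_(m + 1) | t 0 (rshift m 0) - c = 0].
  apply: semialgebraic_polyfun_eq0; apply: polyfunB; last exact: polyfun_cst.
  exact: polyfun_coord.
have := semialgebraicI cM cc; congr semialgebraic.
apply/seteqP; split => [t [/= Mt /subr0_eq tc]|_ [x _ <-]] /=.
  exists (exist _ (lsubmx t) (mem_set Mt)) => //=.
  rewrite -[RHS]hsubmxK; congr row_mx.
  by apply/rowP => i; rewrite ord1 !mxE.
by rewrite row_mxKl row_mxEr mxE subrr; split => //; exact: set_mem (valP x).
Qed.

Lemma semialgebraic_fun2 (h : R -> R -> R) (f g : M -> R) :
    (forall k (u v : 'rV[R]_k -> R), polyfun u -> polyfun v ->
       polyfun (fun z => h (u z) (v z))) ->
    continuous (fun x => h (f x) (g x)) ->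
  semialgebraic_fun f -> semialgebraic_fun g ->
  semialgebraic_fun (fun x => h (f x) (g x)).
Proof.
move=> ph ch [_ sf] [_ sg]; split => //.
pose Gr (f : M -> R) :=
  range (fun x : M => row_mx (set_val x) (const_mx (f x) : 'rV_1)).
pose B := [set z : 'rV[R]_(m + 1 + 1 + 1) |
  [/\ Gr f (row_mx (lsubmx (lsubmx (lsubmx z))) (rsubmx (lsubmx z))),
      Gr g (row_mx (lsubmx (lsubmx (lsubmx z))) (rsubmx z)) &
      rsubmx (lsubmx (lsubmx z)) 0 0 -
        h (rsubmx (lsubmx z) 0 0) (rsubmx z 0 0) = 0]].
have sB : semialgebraic B.
  have -> : B =
      [set z | Gr f (row_mx (lsubmx (lsubmx (lsubmx z))) (rsubmx (lsubmx z)))]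
      `&` [set z | Gr g (row_mx (lsubmx (lsubmx (lsubmx z))) (rsubmx z))]
      `&` [set z | rsubmx (lsubmx (lsubmx z)) 0 0 -
                   h (rsubmx (lsubmx z) 0 0) (rsubmx z 0 0) = 0].
    by apply/seteqP; split => [z []//|z [[]]].
  apply: semialgebraicI; first apply: semialgebraicI.
  - apply: semialgebraic_preimage sf => i; case: (split_ordP i) => j ->.
      apply: eq_polyfun
        (polyfun_coord (lshift 1 (lshift 1 (lshift 1 j)))) => z.
      by rewrite row_mxEl !mxE.
    apply: eq_polyfun (polyfun_coord (lshift 1 (rshift _ j))) => z.
    by rewrite row_mxEr !mxE.
  - apply: semialgebraic_preimage sg => i; case: (split_ordP i) => j ->.
      apply: eq_polyfun
        (polyfun_coord (lshift 1 (lshift 1 (lshift 1 j)))) => z.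
      by rewrite row_mxEl !mxE.
    apply: eq_polyfun (polyfun_coord (rshift _ j)) => z.
    by rewrite row_mxEr !mxE.
  - apply: semialgebraic_polyfun_eq0; apply: polyfunB; last apply: ph.
    + apply: eq_polyfun
        (polyfun_coord (lshift 1 (lshift 1 (rshift _ 0)))) => z.
      by rewrite !mxE.
    + apply: eq_polyfun (polyfun_coord (lshift 1 (rshift _ 0))) => z.
      by rewrite !mxE.
    + by apply: eq_polyfun (polyfun_coord (rshift _ 0)) => z; rewrite !mxE.
have := semialgebraic_proj (semialgebraic_proj sB); congr semialgebraic.
apply/seteqP; split => [t [y [w]]|_ [x _ <-]] /=.
  rewrite /B/= !(row_mxKl, row_mxKr) => -[[x _ xy] [x' _ xw]].
  move: xy xw => /eq_row_mx[xt /rowP/(_ 0)]; rewrite !mxE => fx.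
  move=> /eq_row_mx[x't /rowP/(_ 0)]; rewrite !mxE => gx /subr0_eq tE.
  have xx' : x' = x by apply: val_inj; rewrite -!set_valE xt x't.
  exists x => //; rewrite -[RHS]hsubmxK xt fx -xx' gx; congr row_mx.
  by apply/rowP => i; rewrite !ord1 mxE -tE mxE.
exists (f x), (g x); rewrite /B/= !(row_mxKl, row_mxKr) !mxE subrr.
by split => //; exists x.
Qed.

Lemma bounded_funP (f : M -> R) :
  bounded_fun f <-> exists C, forall x, `|f x| <= C.
Proof.
split=> [/pinfty_ex_gt0[C _ fC]|[C fC]]; first by exists C => x; exact: fC.
exists C; split; first exact: num_real.
by move=> D /ltW CD x _; exact: le_trans (fC x) CD.
Qed.

Let bounded_semialgebraic_subring :
  GRing.subring_closed (@bounded_semialgebraic R m M).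
Proof.
split=> [|f g /asboolP[sf bf] /asboolP[sg bg]|
          f g /asboolP[sf bf] /asboolP[sg bg]]; apply/asboolP.
- split; first exact: semialgebraic_fun_cst.
  by apply/bounded_funP; exists 1 => x; rewrite normr1.
- split.
    apply: (@semialgebraic_fun2 (fun a b => a - b)) => //.
      by move=> k u v; exact: polyfunB.
    by move=> x; exact: cvgB (sf.1 x) (sg.1 x).
  have [a fa] := (bounded_funP _).1 bf; have [b gb] := (bounded_funP _).1 bg.
  apply/bounded_funP; exists (a + b) => x.
  by rewrite (le_trans (ler_normB _ _))// lerD ?fa ?gb.
- split.
    apply: (@semialgebraic_fun2 (fun a b => a * b)) => //.
      by move=> k u v; exact: polyfunM.
    by move=> x; exact: cvgM (sf.1 x) (sg.1 x).
  have [a fa] := (bounded_funP _).1 bf; have [b gb] := (bounded_funP _).1 bg.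
  apply/bounded_funP; exists (a * b) => x.
  by rewrite normrM ler_pM ?fa ?gb.
Qed.

Record bsa_ring := BsaRing {
  bsa_fun :> M -> R;
  bsaP : bsa_fun \in @bounded_semialgebraic R m M }.

HB.instance Definition _ := [isSub for bsa_fun].
HB.instance Definition _ := [Choice of bsa_ring by <:].
HB.instance Definition _ := 
  GRing.SubChoice_isSubComPzRing.Build (M -> R) _ bsa_ring
    bounded_semialgebraic_subring.

End bounded_semialgebraic_ring.

Section stone_cech.
Context {R : realType} {m : nat} (M : semialgebraic_set R m).

Lemma maximal_ideal_at (p : M) : maximal_ideal [set f : bsa_ring M | f p = 0].
Proof.
split.
- split=> [//|f g /= fp gp|f g /= gp].
  + by suff: f p + g p = 0 by []; rewrite fp gp addr0.
  + by suff: f p * g p = 0 by []; rewrite gp mulr0.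
- move=> /seteqP[_ /(_ 1 I)] /=; apply/eqP; exact: oner_neq0.
- move=> J [J0 JD JM] IJ.
  have [JI|] := pselect (J `<=` [set f : bsa_ring M | f p = 0]).
    by left; apply/seteqP.
  move=> /existsNP[g /not_implyP[Jg /= /eqP gp]]; right.
  have kP : (fun _ => (g p)^-1) \in @bounded_semialgebraic R m M.
    apply/asboolP; split; first exact: semialgebraic_fun_cst.
    by apply/bounded_funP; exists `|(g p)^-1| => x.
  apply: ideal_one; first by split.
  pose k := BsaRing kP; rewrite -[1](subrK (k * g)); apply: JD; last exact: JM.
  apply: IJ; suff: 1 - (g p)^-1 * g p = 0 by [].
  by rewrite mulVf// subrr.
Qed.

Definition beta_sa := max_spec (bsa_ring M).

HB.instance Definition _ := Topological.on beta_sa.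

(* the embedding p |-> m_p of M into its semialgebraic Stone-Cech compactification *)
Definition beta_pt (p : M) : beta_sa := MaxSpec (maximal_ideal_at p).

End stone_cech.

Section points.
Context {R : realType} {m : nat}.
Implicit Types A : set 'rV[R]_m.

(* The points of A having a compact neighborhood in A; nbhs and compact refer
   to the subspace topology of the type A. *)
Definition lc_points A : set 'rV[R]_m :=
  set_val @` [set p : A | exists2 K : set A, nbhs p K & compact K].

(* V `&` A ranges over the open neighborhoods of p in A. *)
Definition eta_points A : set 'rV[R]_m := [set p |
  exists (V : set 'rV[R]_m) (f : V `&` A -> `[0 : R, 1 : R[%classic) (q : V `&` A),
  [/\ open V, homeomorphism f, semialgebraic_fun (set_val \o f),
      set_val q = p & set_val (f q) = 0]].

Lemma lcD_eta_sub A : lc_points A `\` eta_points (lc_points A) `<=` A.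
Proof. by move=> _ [[q _ <-] _]; exact: set_mem (valP q). Qed.

End points.

Definition set_incl T (A B : set T) (AB : A `<=` B) (x : A) : B :=
  exist _ (set_val x) (mem_set (AB _ (set_mem (valP x)))).

(* Main.v *)
Require Import Defs.
From mathcomp Require Import all_boot all_order all_algebra.
From mathcomp Require Import all_classical all_reals all_analysis.
From mathcomp.multinomials Require Import (canonicals) mpoly.
From mathcomp.real_closed Require polyrcf.
From mathcomp Require Import ring lra.
Import Order.TTheory GRing.Theory Num.Theory.
Import numFieldNormedType.Exports.
Set Implicit Arguments.
Unset Strict Implicit.
Unset Printing Implicit Defensive.
Local Open Scope classical_set_scope.
Local Open Scope ring_scope.

(** Why a homeomorphism of the compactifications respects the two subsets.

    A maximal ideal of the ring of bounded semialgebraic functions on M consists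
    of the functions tending to 0 along some ultrafilter of subsets of M
    ([converges_ex]); all points of [beta_sa M] are handled through such
    ultrafilters, and [ev r f] is the limit of f. The image of M_lc \ eta(M_lc)
    is then described by two properties that every homeomorphism preserves.
    A point is [tame] when some neighbourhood contains no discrete family indexed
    by ]0, 1[, and [end_like] when it is not isolated and any two paths leaving
    it meet again. The points of M_lc \ eta(M_lc) are exactly the points of
    [beta_sa M] that are tame and not end-like ([tame_not_end_like_iff]).

    A point p of M_lc has a neighbourhood in [beta_sa M] that lies in M, hence in
    a Euclidean space, so it is tame ([tame_lc]). Assume that p is not isolated.
    If small spheres around p meet M in one point, the distance to p is a
    semialgebraic chart and p belongs to eta(M_lc) ([eta_of_single]); otherwise
    the points of these spheres with extreme i-th coordinate, for a suitable i,
    describe two paths that meet only at p ([lc_not_end_like]). Conversely a chart onto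
    [0, 1) forces paths to meet, by the intermediate value theorem
    ([eta_end_like]).

    Let now q be outside M. There is a continuous semialgebraic g on M that tends
    to infinity at q: the squared norm, or the inverse squared distance to a point
    of the closure. Let N be the trace on M of a neighbourhood of q. If the level
    sets of g in N are infinite for large levels, some coordinate maps the level t
    onto a set containing an interval ]a t, a t + w t[, and the curves with
    coordinate a t + s * w t have distinct limits in [beta_sa M] that form a
    discrete family indexed by s, so q is not tame ([thick_slices]). If they are
    finite, N is near infinity a finite union of continuous branches
    ([branches]), q is the limit of one of them, and 1 / (1 + g) is injective on
    a neighbourhood of q, so q is end-like ([end_point]). If finally q is a tame
    point of M, the same alternative, applied around each point of cl(N) \ M,
    shows that these points are isolated from one another. When q has no compact
    neighbourhood they accumulate at q, so that, by semialgebraicity, every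
    small sphere around q contains one of them, and ultrafilters on N converging
    to them produce a discrete family ([tame_pt_lc]).

    The semialgebraic geometry needed is elementary. The fibres of a
    semialgebraic set over its last coordinate are constant off a number of points
    bounded by degrees ([uniform_constant_off]); this gives the dichotomy at
    infinity and the uniform finiteness of finite fibres. One-variable functions
    are eventually continuous by the Baire category theorem
    ([eventually_continuous]), and points of compact families are selected
    semialgebraically by minimising the coordinates one after the other
    ([compact_selection]). *)

(** * Semialgebraic functions and relations *)

Section definable.
Context {R : realType}.

Definition polymap k l (F : 'rV[R]_k -> 'rV[R]_l) :=
  forall i, polyfun (fun x => F x 0 i).

Lemma polymap_comp_fun k l (F : 'rV[R]_k -> 'rV[R]_l) h :
  polymap F -> polyfun h -> polyfun (h \o F).
Proof.
move=> /choice[q qF] [p ph]; exists (mpoly.comp_mpoly [tuple q i | i < l] p) => x.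
rewrite mpoly.comp_mpoly_meval /= -ph; apply: mpoly.meval_eq => i.
by rewrite tnth_mktuple qF.
Qed.

Lemma polymap_lsubmx k l : polymap (@lsubmx R 1 k l).
Proof.
by move=> i; apply: eq_polyfun (polyfun_coord (lshift l i)) => x; rewrite mxE.
Qed.

Lemma polymap_rsubmx k l : polymap (@rsubmx R 1 k l).
Proof.
by move=> i; apply: eq_polyfun (polyfun_coord (rshift k i)) => x; rewrite mxE.
Qed.

Lemma polymap_comp k l j (G : 'rV[R]_l -> 'rV[R]_j) (F : 'rV[R]_k -> 'rV[R]_l) :
  polymap F -> polymap G -> polymap (fun x => G (F x)).
Proof. by move=> pF pG i; exact: (polymap_comp_fun pF (pG i)). Qed.

Lemma polymap_row k l j (F : 'rV[R]_k -> 'rV[R]_l) (G : 'rV[R]_k -> 'rV[R]_j) :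
  polymap F -> polymap G -> polymap (fun x => row_mx (F x) (G x)).
Proof.
move=> pF pG i; case: (split_ordP i) => j' ->.
  by apply: eq_polyfun (pF j') => x; rewrite row_mxEl.
by apply: eq_polyfun (pG j') => x; rewrite row_mxEr.
Qed.

Lemma polymap_id k : polymap (@id 'rV[R]_k).
Proof. by move=> i; exact: polyfun_coord. Qed.

Lemma sa_ext k (A B : set 'rV[R]_k) :
  (forall x, A x <-> B x) -> semialgebraic A -> semialgebraic B.
Proof. by move=> AB; have -> : A = B by apply/seteqP; split => x /AB. Qed.

Lemma sa_and k (P Q : 'rV[R]_k -> Prop) : semialgebraic P -> semialgebraic Q ->
  semialgebraic (fun x => P x /\ Q x).
Proof. exact: semialgebraicI. Qed.

Lemma sa_or k (P Q : 'rV[R]_k -> Prop) : semialgebraic P -> semialgebraic Q ->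
  semialgebraic (fun x => P x \/ Q x).
Proof. exact: semialgebraicU. Qed.

Lemma sa_not k (P : 'rV[R]_k -> Prop) : semialgebraic P ->
  semialgebraic (fun x => ~ P x).
Proof. exact: semialgebraicC. Qed.

Lemma sa_imp k (P Q : 'rV[R]_k -> Prop) : semialgebraic P -> semialgebraic Q ->
  semialgebraic (fun x => P x -> Q x).
Proof.
move=> sP sQ; apply: sa_ext (sa_or (sa_not sP) sQ) => x; split.
  by move=> [nP /nP|].
by move=> PQ; have [/PQ|] := pselect (P x); [right|left].
Qed.

Lemma sa_prop k (P : Prop) : semialgebraic (fun _ : 'rV[R]_k => P).
Proof.
have := @semialgebraic_const R k `[< P >]; congr semialgebraic.
by apply/seteqP; split => x /=; move=> /asboolP.
Qed.

Lemma sa_ex k (Q : 'rV[R]_k -> R -> Prop) :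
  semialgebraic (fun z : 'rV[R]_(k + 1) => Q (lsubmx z) (rsubmx z 0 0)) ->
  semialgebraic (fun x => exists y, Q x y).
Proof.
move=> /semialgebraic_proj; apply: sa_ext => x; split => -[y Qy]; exists y.
  by move: Qy; rewrite /= row_mxKl row_mxKr mxE.
by rewrite /= row_mxKl row_mxKr mxE.
Qed.

Lemma sa_all k (Q : 'rV[R]_k -> R -> Prop) :
  semialgebraic (fun z : 'rV[R]_(k + 1) => Q (lsubmx z) (rsubmx z 0 0)) ->
  semialgebraic (fun x => forall y, Q x y).
Proof.
move=> sQ; have := sa_not (sa_ex (Q := fun x y => ~ Q x y) (sa_not sQ)).
apply: sa_ext => x; split=> [nQ y|Qx [y]]; last by apply.
by apply: contrapT => nQy; apply: nQ; exists y.
Qed.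

Lemma sa_exv l k (Q : 'rV[R]_k -> 'rV[R]_l -> Prop) :
  semialgebraic (fun z : 'rV[R]_(k + l) => Q (lsubmx z) (rsubmx z)) ->
  semialgebraic (fun x => exists y, Q x y).
Proof.
elim: l k Q => [k Q sQ|l IHl k Q sQ].
  have pF : polymap (fun x : 'rV[R]_k => row_mx x (0 : 'rV[R]_0)).
    by apply: polymap_row; [exact: polymap_id|case].
  apply: sa_ext (semialgebraic_preimage pF sQ) => x; rewrite /= row_mxKl row_mxKr.
  by split=> [|[y]]; [exists 0|have -> : y = 0 by apply/rowP; case].
have pF : polymap (fun z : 'rV[R]_(k + 1 + l) =>
    row_mx (lsubmx (lsubmx z)) (row_mx (rsubmx (lsubmx z)) (rsubmx z) : 'rV_l.+1)).
  apply: (@polymap_row _ k l.+1).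
    by apply: polymap_comp; exact: polymap_lsubmx.
  apply: (@polymap_row _ 1 l); last exact: polymap_rsubmx.
  by apply: polymap_comp; [exact: polymap_lsubmx|exact: polymap_rsubmx].
have /(IHl _ (fun (z : 'rV_(k + 1)) y => Q (lsubmx z) (row_mx (rsubmx z) y : 'rV_l.+1))) sQ' :
    semialgebraic (fun z : 'rV[R]_(k + 1 + l) => Q (lsubmx (lsubmx z)) (row_mx (rsubmx (lsubmx z)) (rsubmx z) : 'rV_l.+1)).
  by apply: sa_ext (semialgebraic_preimage pF sQ) => z; rewrite /= row_mxKl row_mxKr.
apply: (@sa_ext _ (fun x => exists y0 y, Q x (row_mx (const_mx y0 : 'rV_1) y))) => [x|].
  split => [[y0 [y Qy]]|[y Qy]]; first by exists (row_mx (const_mx y0 : 'rV_1) y).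
  exists (lsubmx (y : 'rV_(1 + l)) 0 0), (rsubmx (y : 'rV_(1 + l))).
  suff -> : row_mx (const_mx (lsubmx (y : 'rV_(1 + l)) 0 0) : 'rV_1) (rsubmx (y : 'rV_(1 + l))) = y by [].
  by rewrite -[RHS](@hsubmxK R 1 1 l); congr row_mx; apply/rowP => i; rewrite ord1 !mxE.
apply: sa_ex; apply: sa_ext sQ' => z.
have -> : const_mx (rsubmx z 0 0) = rsubmx z by apply/rowP => i; rewrite ord1 !mxE.
by [].
Qed.

Lemma sa_allv l k (Q : 'rV[R]_k -> 'rV[R]_l -> Prop) :
  semialgebraic (fun z : 'rV[R]_(k + l) => Q (lsubmx z) (rsubmx z)) ->
  semialgebraic (fun x => forall y, Q x y).
Proof.
move=> sQ; have := sa_not (sa_exv (Q := fun x y => ~ Q x y) (sa_not sQ)).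
apply: sa_ext => x; split=> [nQ y|Qx [y]]; last by apply.
by apply: contrapT => nQy; apply: nQ; exists y.
Qed.

Lemma sa_all_ord k l (P : 'I_l -> 'rV[R]_k -> Prop) :
  (forall i, semialgebraic (P i)) -> semialgebraic (fun x => forall i, P i x).
Proof.
elim: l P => [|l IHl] P sP.
  by apply: sa_ext (sa_prop k True) => x; split => // _; case.
apply: sa_ext (sa_and (sP ord0) (IHl (fun i => P (lift ord0 i)) _)) => [x|i //].
split=> [[P0 PS] i|Px]; last by split.
by case: (unliftP ord0 i) => [j|] ->.
Qed.

(** Functions are total and their graph is taken over all of R^k, so that they
    compose without conditions on domains; partial functions are extended by an
    arbitrary constant. *)
Definition dfun k (h : 'rV[R]_k -> R) :=
  semialgebraic (fun z : 'rV[R]_(k + 1) => rsubmx z 0 0 = h (lsubmx z)).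

Definition dmap k l (F : 'rV[R]_k -> 'rV[R]_l) := forall i, dfun (fun x => F x 0 i).

Lemma dfun_ext k (h h' : 'rV[R]_k -> R) : h =1 h' -> dfun h -> dfun h'.
Proof. by move=> /funext ->. Qed.

Lemma polyfun_dfun k (h : 'rV[R]_k -> R) : polyfun h -> dfun h.
Proof.
move=> ph; have pz : polyfun (fun z : 'rV[R]_(k + 1) => rsubmx z 0 0 - h (lsubmx z)).
  apply: polyfunB; first exact: polymap_rsubmx.
  exact: (polymap_comp_fun (@polymap_lsubmx k 1) ph).
apply: sa_ext (semialgebraic_polyfun_eq0 pz) => z /=.
by split=> [/subr0_eq//|->]; rewrite subrr.
Qed.

Lemma polymap_dmap k l (F : 'rV[R]_k -> 'rV[R]_l) : polymap F -> dmap F.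
Proof. by move=> pF i; exact: polyfun_dfun. Qed.

(** The values of F become new variables that are then projected away. *)
Lemma sa_comp k l (F : 'rV[R]_k -> 'rV[R]_l) (A : set 'rV[R]_l) :
  dmap F -> semialgebraic A -> semialgebraic (fun x => A (F x)).
Proof.
move=> dF sA.
pose Q (x : 'rV[R]_k) (y : 'rV[R]_l) := A y /\ forall i, y 0 i = F x 0 i.
apply: sa_ext (sa_exv (Q := Q) _) => [x|].
  split=> [[y [Ay yF]]|AF]; last by exists (F x).
  by have <- : y = F x by apply/rowP.
apply: sa_and; first exact: (semialgebraic_preimage (@polymap_rsubmx k l) sA).
apply: sa_all_ord => i.
have pG : polymap (fun z : 'rV[R]_(k + l) => row_mx (lsubmx z) (const_mx (rsubmx z 0 i) : 'rV_1)).
  apply: polymap_row; first exact: polymap_lsubmx.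
  by move=> j; apply: eq_polyfun (@polymap_rsubmx k l i) => z; rewrite !mxE.
apply: sa_ext (semialgebraic_preimage pG (dF i)) => z.
by rewrite /= row_mxKl row_mxKr !mxE.
Qed.

Lemma dfun_comp k l (F : 'rV[R]_k -> 'rV[R]_l) (h : 'rV[R]_l -> R) :
  dmap F -> dfun h -> dfun (fun x => h (F x)).
Proof.
move=> dF dh; rewrite /dfun.
pose Q (z : 'rV[R]_(k + 1)) (y : 'rV[R]_l) :=
  (forall i, y 0 i = F (lsubmx z) 0 i) /\ rsubmx z 0 0 = h y.
apply: sa_ext (sa_exv (Q := Q) _) => [z|].
  split=> [[y [yF ->]]|zh]; last by exists (F (lsubmx z)).
  by have -> : y = F (lsubmx z) by apply/rowP.
apply: sa_and.
  apply: sa_all_ord => i.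
  have pG : polymap (fun z : 'rV[R]_(k + 1 + l) => row_mx (lsubmx (lsubmx z)) (const_mx (rsubmx z 0 i) : 'rV_1)).
    apply: polymap_row; first by apply: polymap_comp; exact: polymap_lsubmx.
    by move=> j; apply: eq_polyfun (@polymap_rsubmx (k + 1) l i) => z; rewrite !mxE.
  apply: sa_ext (semialgebraic_preimage pG (dF i)) => z.
  by rewrite /= row_mxKl row_mxKr !mxE.
have pG : polymap (fun z : 'rV[R]_(k + 1 + l) => row_mx (rsubmx z) (rsubmx (lsubmx z))).
  apply: polymap_row; first exact: polymap_rsubmx.
  by apply: polymap_comp; [exact: polymap_lsubmx|exact: polymap_rsubmx].
apply: sa_ext (semialgebraic_preimage pG dh) => z.
by rewrite /= row_mxKl row_mxKr !mxE.
Qed.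

Lemma dmap_comp k l j (F : 'rV[R]_k -> 'rV[R]_l) (G : 'rV[R]_l -> 'rV[R]_j) :
  dmap F -> dmap G -> dmap (fun x => G (F x)).
Proof. by move=> dF dG i; exact: (dfun_comp dF (dG i)). Qed.

Lemma dmap_id k : dmap (@id 'rV[R]_k).
Proof. by apply: polymap_dmap; exact: polymap_id. Qed.

Lemma dmap_lsubmx k l j (F : 'rV[R]_j -> 'rV[R]_(k + l)) :
  dmap F -> dmap (fun x => lsubmx (F x)).
Proof. by move=> dF; apply: (dmap_comp dF); apply: polymap_dmap; exact: polymap_lsubmx. Qed.

Lemma dmap_rsubmx k l j (F : 'rV[R]_j -> 'rV[R]_(k + l)) :
  dmap F -> dmap (fun x => rsubmx (F x)).
Proof. by move=> dF; apply: (dmap_comp dF); apply: polymap_dmap; exact: polymap_rsubmx. Qed.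

Lemma dmap_row k l j (F : 'rV[R]_k -> 'rV[R]_l) (G : 'rV[R]_k -> 'rV[R]_j) :
  dmap F -> dmap G -> dmap (fun x => row_mx (F x) (G x)).
Proof.
move=> pF pG i; case: (split_ordP i) => j' ->.
  by apply: dfun_ext (pF j') => x; rewrite row_mxEl.
by apply: dfun_ext (pG j') => x; rewrite row_mxEr.
Qed.

Lemma dmap_const k l (h : 'rV[R]_k -> R) : dfun h ->
  dmap (fun x => const_mx (h x) : 'rV[R]_l).
Proof. by move=> dh i; apply: dfun_ext dh => x; rewrite mxE. Qed.

Lemma dfun_coord k l (F : 'rV[R]_k -> 'rV[R]_l) i : dmap F -> dfun (fun x => F x 0 i).
Proof. by []. Qed.

Lemma dfun_cst k c : dfun (fun _ : 'rV[R]_k => c).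
Proof. by apply: polyfun_dfun; exact: polyfun_cst. Qed.

Lemma dmap_cst k l c : dmap (fun _ : 'rV[R]_k => c : 'rV[R]_l).
Proof. by move=> i; exact: dfun_cst. Qed.

(** Reduces the closure under a binary operation to the graph of the operation. *)
Lemma dfun2 k (op : R -> R -> R) (h1 h2 : 'rV[R]_k -> R) :
  dfun (fun x : 'rV[R]_(1 + 1) => op (lsubmx x 0 0) (rsubmx x 0 0)) ->
  dfun h1 -> dfun h2 -> dfun (fun x => op (h1 x) (h2 x)).
Proof.
move=> dop d1 d2.
have dF : dmap (fun x : 'rV[R]_k => row_mx (const_mx (h1 x) : 'rV_1) (const_mx (h2 x) : 'rV_1)).
  by apply: dmap_row; exact: dmap_const.
by apply: dfun_ext (dfun_comp dF dop) => x; rewrite /= row_mxKl row_mxKr !mxE.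
Qed.

Lemma sa_rel2 k (rel : R -> R -> Prop) (h1 h2 : 'rV[R]_k -> R) :
  semialgebraic (fun x : 'rV[R]_(1 + 1) => rel (lsubmx x 0 0) (rsubmx x 0 0)) ->
  dfun h1 -> dfun h2 -> semialgebraic (fun x => rel (h1 x) (h2 x)).
Proof.
move=> dop d1 d2.
have dF : dmap (fun x : 'rV[R]_k => row_mx (const_mx (h1 x) : 'rV_1) (const_mx (h2 x) : 'rV_1)).
  by apply: dmap_row; exact: dmap_const.
by apply: sa_ext (sa_comp dF dop) => x; rewrite /= row_mxKl row_mxKr !mxE.
Qed.

Lemma dfunD k (h1 h2 : 'rV[R]_k -> R) : dfun h1 -> dfun h2 -> dfun (fun x => h1 x + h2 x).
Proof.
by apply: (dfun2 (op := fun a b => a + b)); apply: polyfun_dfun; apply: polyfunD; [exact: polymap_lsubmx|exact: polymap_rsubmx].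
Qed.

Lemma dfunM k (h1 h2 : 'rV[R]_k -> R) : dfun h1 -> dfun h2 -> dfun (fun x => h1 x * h2 x).
Proof.
by apply: (dfun2 (op := fun a b => a * b)); apply: polyfun_dfun; apply: polyfunM; [exact: polymap_lsubmx|exact: polymap_rsubmx].
Qed.

Lemma dfunB k (h1 h2 : 'rV[R]_k -> R) : dfun h1 -> dfun h2 -> dfun (fun x => h1 x - h2 x).
Proof.
by apply: (dfun2 (op := fun a b => a - b)); apply: polyfun_dfun; apply: polyfunB; [exact: polymap_lsubmx|exact: polymap_rsubmx].
Qed.

Lemma dfunN k (h : 'rV[R]_k -> R) : dfun h -> dfun (fun x => - h x).
Proof. by move=> dh; apply: dfun_ext (dfunB (dfun_cst k 0) dh) => x; rewrite sub0r. Qed.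

Lemma dfunX k (h : 'rV[R]_k -> R) n : dfun h -> dfun (fun x => h x ^+ n).
Proof.
move=> dh; elim: n => [|n IHn]; first exact: dfun_cst.
by apply: dfun_ext (dfunM dh IHn) => x; rewrite exprS.
Qed.

Lemma dfun_sum k l (h : 'I_l -> 'rV[R]_k -> R) :
  (forall i, dfun (h i)) -> dfun (fun x => \sum_i h i x).
Proof.
elim: l h => [|l IHl] h dh.
  by apply: dfun_ext (dfun_cst k 0) => x; rewrite big_ord0.
apply: dfun_ext (dfunD (dh ord0) (IHl _ (fun i => dh (lift ord0 i)))) => x.
by rewrite big_ord_recl.
Qed.

Lemma sa_lt k (h1 h2 : 'rV[R]_k -> R) : dfun h1 -> dfun h2 ->
  semialgebraic (fun x => h1 x < h2 x).
Proof.
apply: (sa_rel2 (rel := fun a b => a < b)).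
have := @semialgebraic_polyfun_gt0 R _ (fun x : 'rV[R]_(1 + 1) => rsubmx x 0 0 - lsubmx x 0 0).
move=> H; apply: sa_ext (H _) => [x|]; first by rewrite /= subr_gt0.
by apply: polyfunB; [exact: polymap_rsubmx|exact: polymap_lsubmx].
Qed.

Lemma sa_le k (h1 h2 : 'rV[R]_k -> R) : dfun h1 -> dfun h2 ->
  semialgebraic (fun x => h1 x <= h2 x).
Proof.
move=> d1 d2; apply: sa_ext (sa_not (sa_lt d2 d1)) => x.
by rewrite leNgt; split=> /negP.
Qed.

Lemma sa_eq k (h1 h2 : 'rV[R]_k -> R) : dfun h1 -> dfun h2 ->
  semialgebraic (fun x => h1 x = h2 x).
Proof.
move=> d1 d2; apply: sa_ext (sa_and (sa_le d1 d2) (sa_le d2 d1)) => x.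
split=> [[h12 h21]|->]; last by rewrite lexx.
by apply/eqP; rewrite eq_le h12 h21.
Qed.

Lemma sa_eqv k l (F G : 'rV[R]_k -> 'rV[R]_l) : dmap F -> dmap G ->
  semialgebraic (fun x => F x = G x).
Proof.
move=> dF dG; apply: sa_ext (sa_all_ord (fun i => sa_eq (dF i) (dG i))) => x.
by split=> [FG|->//]; apply/rowP.
Qed.

Lemma dfun_if k (P : 'rV[R]_k -> Prop) (h1 h2 : 'rV[R]_k -> R) :
  semialgebraic P -> dfun h1 -> dfun h2 ->
  dfun (fun x => if `[< P x >] then h1 x else h2 x).
Proof.
move=> sP d1 d2.
have sP' : semialgebraic (fun z : 'rV[R]_(k + 1) => P (lsubmx z)).
  by apply: (sa_comp (F := lsubmx)) sP; apply: dmap_lsubmx; exact: dmap_id.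
apply: sa_ext (sa_or (sa_and sP' d1) (sa_and (sa_not sP') d2)) => z.
by case: asboolP => Pz; split=> H; tauto.
Qed.

Lemma dfun_max k (h1 h2 : 'rV[R]_k -> R) : dfun h1 -> dfun h2 ->
  dfun (fun x => Num.max (h1 x) (h2 x)).
Proof.
move=> d1 d2; apply: dfun_ext (dfun_if (sa_lt d1 d2) d2 d1) => x.
rewrite asboolb maxElt; by case: ltP.
Qed.

Lemma dfun_min k (h1 h2 : 'rV[R]_k -> R) : dfun h1 -> dfun h2 ->
  dfun (fun x => Num.min (h1 x) (h2 x)).
Proof.
move=> d1 d2; apply: dfun_ext (dfun_if (sa_lt d1 d2) d1 d2) => x.
rewrite asboolb minElt; by case: ltP.
Qed.

Lemma dfun_norm k (h : 'rV[R]_k -> R) : dfun h -> dfun (fun x => `|h x|).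
Proof.
move=> dh; apply: dfun_ext (dfun_max dh (dfunN dh)) => x.
by case: (leP 0 (h x)) => h0; rewrite maxEle; case: leP => //; rewrite ?(ger0_norm h0) ?(ltr0_norm h0); lra.
Qed.

Lemma dfunV k (h : 'rV[R]_k -> R) : dfun h -> dfun (fun x => (h x)^-1).
Proof.
move=> dh.
pose dl := dfun_comp (dmap_lsubmx (@dmap_id (k + 1))) dh.
have dr : dfun (fun z : 'rV[R]_(k + 1) => rsubmx z 0 0).
  by apply: dfun_coord; apply: dmap_rsubmx; exact: dmap_id.
have s0 := sa_eq dl (dfun_cst _ 0).
have s1 := sa_eq (dfunM dl dr) (dfun_cst _ 1).
have s2 := sa_eq dr (dfun_cst _ 0).
apply: sa_ext (sa_or (sa_and s0 s2) s1) => z; split.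
  (* the inverse of 0 is 0, which gives the graph its second component *)
  move=> [[-> ->]|h1]; first by rewrite invr0.
  have h0 : h (lsubmx z) != 0 by apply: contra_eq_neq h1 => ->; rewrite mul0r eq_sym oner_neq0.
  by apply: (mulfI h0); rewrite h1 divff.
move=> ->; have [->|h0] := eqVneq (h (lsubmx z)) 0; first by left; rewrite invr0.
by right; rewrite divff.
Qed.

End definable.

(** * One-dimensional fibres and o-minimality *)

Section one_variable.
Context {R : realType}.

Definition constant_off (s : seq R) (P : R -> Prop) := forall a b, a <= b ->
  (forall c, c \in s -> ~~ (a <= c <= b)) -> (P a <-> P b).

Let pt k (x : 'rV[R]_k) (y : R) : 'rV[R]_(k + 1) := row_mx x (const_mx y : 'rV_1).

(** The degree in the last variable bounds the degrees of all specialisations,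
    so K does not depend on x. *)
Lemma poly_fiber k (p : mpoly.mpoly (k + 1) R) : exists K : nat,
  forall x : 'rV[R]_k, exists P : {poly R}, (size P <= K)%N /\
    forall y, P.[y] = mpoly.meval (pt x y 0) p.
Proof.
elim/mpoly.mpolyind: p => [|c a p _ _ [K HK]].
  by exists 0%N => x; exists 0; split=> [|y]; rewrite ?size_poly0// mpoly.meval0 horner0.
exists (maxn (mpoly.fun_of_multinom a (rshift k ord0)).+1 K) => x.
have [P [sP hP]] := HK x.
exists ((c * \prod_(i < k) x 0 i ^+ mpoly.fun_of_multinom a (lshift 1 i)) *:
        'X^(mpoly.fun_of_multinom a (rshift k ord0)) + P); split.
  apply: leq_trans (size_polyD _ _) _; rewrite geq_max; apply/andP; split.
    by apply: leq_trans (size_scale_leq _ _) _; rewrite size_polyXn leq_maxl.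
  by apply: leq_trans sP _; rewrite leq_maxr.
move=> y; rewrite hornerD hP hornerZ hornerXn mpoly.mevalD mpoly.mevalZ mpoly.mevalX.
rewrite big_split_ord /= big_ord1 mulrA /pt row_mxEr mxE; congr (_ * _ * _ + _).
by apply: eq_bigr => i _; rewrite row_mxEl.
Qed.

(** Signs change only at roots; the zero polynomial, which has no list of roots,
    has constant sign. *)
Lemma constant_off_sgr (P : {poly R}) : exists s : seq R, (size s <= size P)%N /\
  forall a b, a <= b -> (forall c, c \in s -> ~~ (a <= c <= b)) -> Num.sg P.[a] = Num.sg P.[b].
Proof.
have [->|P0] := eqVneq P 0; first by exists [::]; split => // a b; rewrite !horner0.
exists (polyrcf.rootsR P); split.
  apply/ltnW/max_poly_roots => //; last exact: polyrcf.uniq_roots.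
  by apply/allP => c; rewrite -polyrcf.roots_on_rootsR// => /andP[].
move=> a b ab hs; apply: (@polyrcf.polyrN0_itv _ `[a, b]) => [c|//|//].
- rewrite in_itv/= => abc; apply/negP => rc; have := hs c.
  by rewrite abc -polyrcf.roots_on_rootsR// in_itv/= rc => /(_ isT).
- by rewrite in_itv/= ab lexx.
- by rewrite in_itv/= ab lexx.
Qed.

(** Boolean combinations accumulate the exceptional points of their members, so
    that the bound depends on the description of A only. This plays the part of
    a cell decomposition. *)
Lemma uniform_constant_off k (A : set 'rV[R]_(k + 1)) : semialgebraic A ->
  exists K : nat, forall x : 'rV[R]_k, exists s : seq R,
    (size s <= K)%N /\ constant_off s (fun y => A (pt x y)).
Proof.
elim=> {A} [p|p|A B _ [K HK] _ [L HL]|A B _ [K HK] _ [L HL]|A _ [K HK]].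
- have [K HK] := poly_fiber p; exists K => x; have [P [sP hP]] := HK x.
  have [s [ss hs]] := constant_off_sgr P; exists s; split; first exact: leq_trans ss sP.
  move=> a b ab /(hs _ _ ab) sab /=; rewrite -!hP.
  have E : (P.[a] == 0) = (P.[b] == 0) by rewrite -sgr_eq0 sab sgr_eq0.
  by split=> /eqP; [rewrite E|rewrite -E] => /eqP.
- have [K HK] := poly_fiber p; exists K => x; have [P [sP hP]] := HK x.
  have [s [ss hs]] := constant_off_sgr P; exists s; split; first exact: leq_trans ss sP.
  move=> a b ab /(hs _ _ ab) sab /=; rewrite -!hP.
  by rewrite -[_ < P.[a]]sgr_gt0 -[_ < P.[b]]sgr_gt0 sab.
- exists (K + L)%N => x; have [s [ss hs]] := HK x; have [t [st ht]] := HL x.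
  exists (s ++ t); split; first by rewrite size_cat leq_add.
  move=> a b ab hst; have {}hs := hs a b ab _; have {}ht := ht a b ab _.
  rewrite /setI/=; suff [-> ->] : (A (pt x a) <-> A (pt x b)) /\ (B (pt x a) <-> B (pt x b)) by [].
  by split; [apply: hs|apply: ht] => c cs; apply: hst; rewrite mem_cat cs ?orbT.
- exists (K + L)%N => x; have [s [ss hs]] := HK x; have [t [st ht]] := HL x.
  exists (s ++ t); split; first by rewrite size_cat leq_add.
  move=> a b ab hst; have {}hs := hs a b ab _; have {}ht := ht a b ab _.
  rewrite /setU/=; suff [-> ->] : (A (pt x a) <-> A (pt x b)) /\ (B (pt x a) <-> B (pt x b)) by [].
  by split; [apply: hs|apply: ht] => c cs; apply: hst; rewrite mem_cat cs ?orbT.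
- exists K => x; have [s [ss hs]] := HK x; exists s; split => // a b ab hab.
  by rewrite /setC/= (hs a b ab hab).
Qed.

Definition rsa (P : R -> Prop) := semialgebraic (fun x : 'rV[R]_1 => P (x 0 0)).
Definition rdfun (u : R -> R) := dfun (fun x : 'rV[R]_1 => u (x 0 0)).

Lemma rsa_comp k (P : R -> Prop) (h : 'rV[R]_k -> R) :
  rsa P -> dfun h -> semialgebraic (fun x => P (h x)).
Proof.
move=> sP dh; apply: sa_ext (sa_comp (dmap_const (l := 1) dh) sP) => x.
by rewrite mxE.
Qed.

Lemma rdfun_comp k (u : R -> R) (h : 'rV[R]_k -> R) :
  rdfun u -> dfun h -> dfun (fun x => u (h x)).
Proof.
move=> sP dh; apply: dfun_ext (dfun_comp (dmap_const (l := 1) dh) sP) => x.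
by rewrite mxE.
Qed.

Lemma rsa_constant_off (P : R -> Prop) : rsa P -> exists s, constant_off s P.
Proof.
move=> sP; have sP' : semialgebraic (fun x : 'rV[R]_(0 + 1) => P (rsubmx x 0 0)).
  by apply: (rsa_comp sP); apply: dfun_coord; apply: dmap_rsubmx; exact: dmap_id.
have [K /(_ 0)[s [_ hs]]] := uniform_constant_off sP'; exists s => a b ab /(hs a b ab) /=.
by rewrite /pt !row_mxKr !mxE.
Qed.

(** Beyond the last exceptional point the truth value does not change. *)
Lemma eventually_dichotomy (P : R -> Prop) : rsa P ->
  exists T, (forall t, T < t -> P t) \/ (forall t, T < t -> ~ P t).
Proof.
move=> /rsa_constant_off[s hs].
have [T hT] : exists T, forall c, c \in s -> c <= T.
  elim: s {hs} => [|c s [T hT]]; first by exists 0.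
  exists (Num.max c T) => d; rewrite inE => /orP[/eqP ->|/hT dT].
    by rewrite le_max lexx.
  by rewrite le_max dT orbT.
exists T; have eqP a b : T < a -> a <= b -> (P a <-> P b).
  move=> Ta ab; apply: hs => // c /hT cT; apply/negP => /andP[ac _].
  by have := lt_le_trans Ta (le_trans ac cT); rewrite ltxx.
have [PT|PT] := pselect (P (T + 1)); [left|right] => t Tt; have [tT|tT] := leP t (T + 1).
- by apply/(eqP _ _ Tt tT).
- by apply/(eqP (T + 1)) => //; [lra|exact: ltW].
- by move=> /(eqP _ _ Tt tT)/PT.
- by move=> Pt; apply/PT/(eqP (T + 1) t) => //; [lra|exact: ltW].
Qed.

Lemma eventually_always (P : R -> Prop) : rsa P ->
  (forall T, exists2 t, T < t & P t) -> exists T, forall t, T < t -> P t.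
Proof.
move=> /eventually_dichotomy[T [PT|nPT]] hP; first by exists T.
by have [t /nPT nPt Pt] := hP T.
Qed.

Lemma gap_right (s : seq R) (a : R) : exists2 d, 0 < d &
  forall c, c \in s -> ~~ (a < c < a + d).
Proof.
elim: s => [|c s [d d0 hd]]; first by exists 1.
have [ac|ca] := ltP a c.
  exists (Num.min d (c - a)); first by rewrite lt_min d0 subr_gt0.
  move=> e; rewrite inE => /orP[/eqP ->|/hd].
    by rewrite -ltrBlDl lt_min ltxx andbF andbF.
  by apply: contra => /andP[-> h]; apply: (lt_le_trans h); rewrite lerD2l ge_min lexx.
exists d => // e; rewrite inE => /orP[/eqP ->|/hd//]; by rewrite ltNge ca.
Qed.

Lemma interval_right (P : R -> Prop) (a : R) : rsa P ->
  (forall d, 0 < d -> exists2 x, a < x < a + d & P x) ->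
  exists2 d, 0 < d & forall x, a < x < a + d -> P x.
Proof.
move=> /rsa_constant_off[s hs] hP; have [d d0 hd] := gap_right s a.
have [x /andP[ax xd] Px] := hP d d0; exists d => // y /andP[ay yd].
have [xy|yx] := leP x y.
  apply: (hs x y xy _).1 Px => c /hd; apply: contra => /andP[xc cy].
  by rewrite (lt_le_trans ax xc) (le_lt_trans cy yd).
apply: (hs y x (ltW yx) _).2 Px => c /hd; apply: contra => /andP[xc cy].
by rewrite (lt_le_trans ay xc) (le_lt_trans cy xd).
Qed.

(** For semialgebraic P this amounts to finiteness, by [constant_off_thin]. *)
Definition thin (P : R -> Prop) := forall a b, a < b -> exists2 y, a < y < b & ~ P y.

Lemma gap (s : seq R) (a : R) : a \notin s -> exists2 d, 0 < d &
  forall c, c \in s -> ~~ (a - d < c < a + d).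
Proof.
elim: s => [|c s IHs]; first by exists 1.
rewrite inE negb_or => /andP[ac /IHs[d d0 hd]].
have ac0 : 0 < `|a - c| by rewrite normr_gt0 subr_eq0.
exists (Num.min d `|a - c|); first by rewrite lt_min d0.
move=> e; rewrite inE => /orP[/eqP ->|/hd]; rewrite -!ltr_distl.
  by rewrite lt_min distrC ltxx andbF.
by apply: contra; rewrite lt_min => /andP[].
Qed.

(** Off the list s the predicate is locally constant, so a point of P outside s
    would bring an interval with it. *)
Lemma constant_off_thin (s : seq R) (P : R -> Prop) : constant_off s P -> thin P ->
  forall y, P y -> y \in s.
Proof.
move=> hs tP y Py; apply/negPn/negP => /gap[d d0 hd].
have [|z /andP[yz zd] nPz] := tP y (y + d); first by lra.
apply: nPz; apply: (hs y z (ltW yz) _).1 Py => c /hd; apply: contra => /andP[yc cz].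
by apply/andP; split; lra.
Qed.

Lemma uniform_finiteness k (A : set 'rV[R]_(k + 1)) : semialgebraic A ->
  exists K : nat, forall x : 'rV[R]_k, thin (fun y => A (pt x y)) ->
    exists s : seq R, (size s <= K)%N /\ forall y, A (pt x y) -> y \in s.
Proof.
move=> /uniform_constant_off[K HK]; exists K => x tx; have [s [ss hs]] := HK x.
by exists s; split => //; exact: constant_off_thin tx.
Qed.

Lemma rsa_thin_finite (P : R -> Prop) : rsa P -> thin P ->
  exists s : seq R, forall y, P y -> y \in s.
Proof. by move=> /rsa_constant_off[s /constant_off_thin hs] /hs; exists s. Qed.

End one_variable.

(** * Continuity and limits of functions of one variable *)

Section filters.
Context {R : realType}.

Lemma ultra_bounded_cvg T (F : set_system T) (f : T -> R) (B : R) :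
  UltraFilter F -> F [set x | `|f x| <= B] -> exists L : R, f @ F --> L.
Proof.
move=> UF FB.
have [|L [_ clL]] := @segment_compact R (- B) B (f @ F) _.
  by apply: filterS FB => x xB; rewrite /= in_itv/= -ler_norml; exact: xB.
exists L => A AL; have [//|FA] := in_ultra_setVsetC (f @^-1` A) UF.
by have [x [nAx Ax]] := clL (~` A) A FA AL; case: (nAx Ax).
Qed.

Lemma uncountable_itv (a b : R) : a < b -> ~ countable [set x : R | a < x < b].
Proof.
move=> ab /countable_lebesgue_measure0.
rewrite (_ : [set x | _] = `]a, b[%classic); last first.
  by apply/seteqP; split => x /=; rewrite in_itv.
rewrite lebesgue_measure_itv/= lte_fin ab -EFinD => -[] /eqP.
by rewrite subr_eq0 gt_eqF.
Qed.

Lemma itv_not_bigcup_seq (a b : R) (I : countType) (s : I -> seq R) : a < b ->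
  exists2 x, a < x < b & forall i, x \notin s i.
Proof.
move=> ab; apply: contrapT => h; apply: (@uncountable_itv a b ab).
apply: (@sub_countable _ _ _ (\bigcup_i [set` s i])).
  apply: subset_card_le => x axb; apply: contrapT => nx; apply: h; exists x => // i.
  by apply/negP => xi; apply: nx; exists i.
by apply: bigcup_countable => // i _; exact/finite_set_countable/finite_seq.
Qed.

Definition cont_at (u : R -> R) (t : R) := forall e, 0 < e -> exists d, 0 < d /\
  forall t', `|t' - t| < d -> `|u t' - u t| < e.

Lemma cont_atP (u : R -> R) (t : R) : cont_at u t -> u x @[x --> t] --> u t.
Proof.
move=> ut; apply/cvgrPdist_lt => e e0; have [d [d0 hd]] := ut e e0.
near=> x; rewrite distrC; apply: hd; rewrite distrC.
near: x; exact: cvgr_dist_lt.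
Unshelve. all: by end_near. Qed.

Lemma rsa_cont_at (u : R -> R) : rdfun u -> rsa (cont_at u).
Proof.
move=> du; rewrite /rsa /cont_at.
apply: sa_all; apply: sa_imp.
  apply: sa_lt; first exact: dfun_cst.
  by apply: dfun_coord; apply: dmap_rsubmx; exact: dmap_id.
apply: sa_ex; apply: sa_and.
  apply: sa_lt; first exact: dfun_cst.
  by apply: dfun_coord; apply: dmap_rsubmx; exact: dmap_id.
have dl k : dmap (fun x : 'rV[R]_(k + 1) => lsubmx x) by apply: dmap_lsubmx; exact: dmap_id.
have dr k : dfun (fun x : 'rV[R]_(k + 1) => rsubmx x 0 0).
  by apply: dfun_coord; apply: dmap_rsubmx; exact: dmap_id.
have dt : dfun (fun x : 'rV[R]_(1 + 1 + 1 + 1) => lsubmx (lsubmx (lsubmx x)) 0 0).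
  by apply: dfun_coord; do 3!apply: dmap_lsubmx; exact: dmap_id.
apply: sa_all; apply: sa_imp; apply: sa_lt.
- by apply: dfun_norm; apply: dfunB.
- exact: (dfun_comp (dl _) (dr _)).
- apply: dfun_norm; apply: dfunB; exact: rdfun_comp.
- apply: (dfun_coord 0 (F := fun x => rsubmx (lsubmx (lsubmx x)))).
  by apply: dmap_rsubmx; do 2!apply: dmap_lsubmx; exact: dmap_id.
Qed.

(** For each n the points near which u oscillates by at most 1/(n+1) form a dense
    open set: an interval is cut into the sets where n+1 times u has a given
    integral part, these are semialgebraic and cannot all be finite, so one of them
    contains an interval. The Baire category theorem concludes. *)
Lemma dense_cont_at (u : R -> R) (a b : R) : rdfun u -> a < b ->
  exists2 t, a < t < b & cont_at u t.
Proof.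
move=> du ab.
pose F n := [set t : R | exists2 d, 0 < d & forall t1 t2,
  `|t1 - t| < d -> `|t2 - t| < d -> `|u t1 - u t2| <= n.+1%:R^-1].
have oF n : open (F n).
  rewrite openE => t [d d0 hd]; near=> t'; exists (d / 2); first lra.
  have tt' : `|t - t'| < d / 2.
    near: t'; apply: (@cvgr_dist_lt _ _ R^o); [exact: cvg_id|lra].
  move=> t1 t2 h1 h2; apply: hd.
    by rewrite (le_lt_trans (ler_distD t' _ _))// [`|t' - t|]distrC; lra.
  by rewrite (le_lt_trans (ler_distD t' _ _))// [`|t' - t|]distrC; lra.
have dF n : dense (F n).
  move=> O [x Ox] oO.
  have [e /= e0 he] : nbhs_ball x O by apply/nbhs_ballP; exact: open_nbhs_nbhs.
  pose N : R := n.+1%:R.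
  have N0 : 0 < N by rewrite ltr0Sn.
  pose P (k : int) (t : R) := k%:~R <= N * u t /\ N * u t < k%:~R + 1.
  have sP k : rsa (P k).
    have dk : dfun (fun x : 'rV[R]_1 => N * u (x 0 0)) by apply: dfunM => //; exact: dfun_cst.
    by apply: sa_and; [apply: sa_le|apply: sa_lt] => //; exact: dfun_cst.
  have [[k /= npk]|allthin] := pselect (exists k, ~ thin (fun t => x - e < t < x + e /\ P k t)).
    have [c [d [cd hcd]]] : exists c d, c < d /\ forall t, c < t < d -> x - e < t < x + e /\ P k t.
      apply: contrapT => h; apply: npk => c d cd; apply: contrapT => h'.
      apply: h; exists c, d; split => // t tcd; apply: contrapT => h2; apply: h'.
      by exists t.
    have cmd : c < (c + d) / 2 < d by apply/andP; split; lra.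
    exists ((c + d) / 2); split.
      have [/andP[h1 h2] _] := hcd _ cmd; apply: he; rewrite /ball /= distrC ltr_distl.
      by rewrite h1 h2.
    exists ((d - c) / 2); first by rewrite divr_gt0// subr_gt0.
    move=> t1 t2; rewrite !ltr_distl => /andP[h1 h2] /andP[h3 h4].
    have [|_ [p1 p2]] := hcd t1; first by apply/andP; split; lra.
    have [|_ [p3 p4]] := hcd t2; first by apply/andP; split; lra.
    rewrite -[_^-1]mul1r -/N ler_pdivlMr// mulrC -{1}(ger0_norm (ltW N0)) -normrM mulrBr.
    by rewrite ler_norml; apply/andP; split; lra.
  exfalso; have fin k : exists s : seq R, forall t, x - e < t < x + e /\ P k t -> t \in s.
    apply: rsa_thin_finite; last by apply: contrapT => nt; apply: allthin; exists k.
    apply: sa_and; last exact: (sP k).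
    apply: sa_ext (sa_and (sa_lt (dfun_cst 1 (x - e)) (dfun_coord 0 (@dmap_id _ 1))) (sa_lt (dfun_coord 0 (@dmap_id _ 1)) (dfun_cst 1 (x + e)))) => z.
    by split=> [[-> ->]|/andP[]].
  have [s hs] := choice fin.
  have [|t te nt] := @itv_not_bigcup_seq (x - e) (x + e) int s; first by lra.
  have := nt (Num.floor (N * u t)); rewrite (hs _ t)//; split => //.
  by split; [exact: floor_le|rewrite -[1]/(1%:~R) -intrD; exact: lt_succ_floor].
have := Baire (fun n => conj (oF n) (dF n)).
move=> /(_ [set t | a < t < b])[||t [tab Ft]].
- by exists ((a + b) / 2) => /=; apply/andP; split; lra.
- rewrite (_ : [set t | _] = `]a, b[%classic) ; first exact: interval_open.
  by apply/seteqP; split => x /=; rewrite in_itv.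
exists t => // e e0.
have [n hn] : exists n : nat, n.+1%:R^-1 < e.
  have [n _ hn] := near_infty_natSinv_lt (PosNum e0); exists n; exact: hn n (leqnn n).
have [d d0 hd] := Ft n I; exists d; split => // t' tt'.
by apply: le_lt_trans hn; apply: hd; rewrite ?subrr ?normr0.
Unshelve. all: by end_near. Qed.

(** The set of continuity points is semialgebraic and dense, hence contains a
    half-line. *)
Lemma eventually_continuous (u : R -> R) : rdfun u ->
  exists T : R, forall t : R, T < t -> u x @[x --> t] --> u t.
Proof.
move=> du; have [|T hT] := eventually_always (rsa_cont_at du).
  move=> T; have [|t /andP[Tt _] ct] := dense_cont_at (a := T) (b := T + 1) du; first by lra.
  by exists t.
by exists T => t /hT/cont_atP.
Qed.

(** Some ultrafilter at infinity provides a candidate L; each condition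
    `|L - u t| < e holds eventually or fails eventually, and it cannot fail. *)
Lemma bounded_eventually_cvg (u : R -> R) (B : R) : rdfun u -> (forall t, `|u t| <= B) ->
  exists L : R, u x @[x --> +oo] --> L.
Proof.
move=> du uB; have [U [UU oU]] := @ultraFilterLemma _ (pinfty_nbhs R) _.
have [|L uL] := ultra_bounded_cvg (f := u) (B := B) UU; first exact: filterE.
exists L; apply/cvgrPdist_lt => e e0.
have sP : rsa (fun t => `|L - u t| < e).
  apply: sa_lt; last exact: dfun_cst.
  by apply: dfun_norm; apply: dfunB => //; exact: dfun_cst.
have [T [hT|hT]] := eventually_dichotomy sP; first by exists T; split; [exact: num_real|].
have UL : U [set t | `|L - u t| < e] by move/cvgrPdist_lt : uL => /(_ _ e0).
have UT : U [set t | T < t] by apply: oU; exists T; split; [exact: num_real|].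
have [t [/= h1 /hT]] := filter_ex (filterI UL UT); by [].
Qed.

End filters.

(** * Semialgebraic selection *)

Section selection.
Context {R : realType}.

Definition sarel m (Q : R -> 'rV[R]_m -> Prop) :=
  semialgebraic (fun z : 'rV[R]_(1 + m) => Q (lsubmx z 0 0) (rsubmx z)).

Lemma sarel_comp m k (Q : R -> 'rV[R]_m -> Prop) (h : 'rV[R]_k -> R) F :
  sarel Q -> dfun h -> dmap F -> semialgebraic (fun x => Q (h x) (F x)).
Proof.
move=> sQ dh dF; have := sa_comp (dmap_row (dmap_const (l := 1) dh) dF) sQ.
by apply: sa_ext => x; rewrite /= row_mxKl row_mxKr mxE.
Qed.

Definition rdmap m (c : R -> 'rV[R]_m) := forall i, rdfun (fun t => c t 0 i).

Lemma rdmap_comp m k (c : R -> 'rV[R]_m) (h : 'rV[R]_k -> R) :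
  rdmap c -> dfun h -> dmap (fun x => c (h x)).
Proof. by move=> dc dh i; exact: (rdfun_comp (dc i) dh). Qed.

Lemma dmap_l k l : dmap (@lsubmx R 1 k l).
Proof. by apply: dmap_lsubmx; exact: dmap_id. Qed.

Lemma dmap_r k l : dmap (@rsubmx R 1 k l).
Proof. by apply: dmap_rsubmx; exact: dmap_id. Qed.

Lemma definable_graph m (G : R -> 'rV[R]_m -> Prop) : sarel G ->
  (forall t, exists2 x, G t x & forall y, G t y -> y = x) ->
  exists2 c, rdmap c & forall t, G t (c t).
Proof.
move=> sG uG; have [c hc] := choice (fun t => let: ex_intro2 x Gx Ux := uG t in ex_intro _ x (conj Gx Ux)).
exists c => [i|t]; last by have [] := hc t.
rewrite /rdfun /dfun.
apply: sa_ext (sa_exv (Q := fun (z : 'rV[R]_(1 + 1)) x => G (lsubmx z 0 0) x /\ rsubmx z 0 0 = x 0 i) _) => [z|].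
  split=> [[x [Gx ->]]|zc]; first by rewrite ((hc _).2 _ Gx).
  by exists (c (lsubmx z 0 0)); split => //; have [] := hc (lsubmx z 0 0).
apply: sa_and.
  apply: sarel_comp => //; last exact: dmap_r.
  by apply: (dfun_coord 0); apply: dmap_lsubmx; exact: dmap_l.
apply: sa_eq; last exact/dfun_coord/dmap_r.
by apply: (dfun_coord 0 (F := fun x => rsubmx (lsubmx x))); apply: dmap_rsubmx; exact: dmap_l.
Qed.

(** The value 0 where existence or uniqueness fails makes c total while keeping
    its graph semialgebraic. *)
Lemma definable_unique_choice m (S : R -> 'rV[R]_m -> Prop) : sarel S ->
  exists2 c, rdmap c &
    forall t, (exists2 x, S t x & forall y, S t y -> y = x) -> S t (c t).
Proof.
move=> sS; pose U t x := S t x /\ forall y, S t y -> y = x.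
pose G t x := U t x \/ (~ (exists x, U t x) /\ x = 0).
have sU : sarel U.
  apply: sa_and => //; apply: sa_allv; apply: sa_imp.
    apply: sarel_comp => //; last exact: dmap_r.
    by apply: (dfun_coord 0); apply: dmap_lsubmx; exact: dmap_l.
  apply: sa_eqv; first exact: dmap_r.
  by apply: dmap_rsubmx; exact: dmap_l.
have [||c dc cG] := @definable_graph _ G.
- apply: sa_or; first exact: sU.
  apply: sa_and; last by apply: sa_eqv; [exact: dmap_r|exact: dmap_cst].
  apply/sa_not/sa_exv; apply: sarel_comp => //; last exact: dmap_r.
  by apply: (dfun_coord 0); apply: dmap_lsubmx; exact: dmap_l.
- move=> t; have [[x Ux]|nU] := pselect (exists x, U t x).
    exists x; first by left.
    by move=> y [[Sy _]|[nU _]]; [exact: Ux.2|case: nU; exists x].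
  by exists 0; [right|move=> y [Uy|[]//]; case: nU; exists y].
exists c => // t [x Sx ux]; have [[]//|[nU _]] := cG t.
by case: nU; exists x; split.
Qed.

(** Successive minimisation of the coordinates in s, the last one of the list
    first: a lexicographic minimum that exists in every nonempty compact set. *)
Fixpoint mincoords m (Q : R -> 'rV[R]_m -> Prop) (s : seq 'I_m) : R -> 'rV[R]_m -> Prop :=
  if s is i :: s' then fun t x => mincoords Q s' t x /\
    forall y, mincoords Q s' t y -> x 0 i <= y 0 i
  else Q.

Lemma mincoords_sub m Q (s : seq 'I_m) t x : mincoords Q s t x -> Q t x.
Proof. by elim: s => [//|i s IHs] /= [/IHs]. Qed.

Lemma sarel_mincoords m Q (s : seq 'I_m) : sarel Q -> sarel (mincoords Q s).
Proof.
move=> sQ; elim: s => [//|i s IHs] /=; apply: sa_and => //; apply: sa_allv; apply: sa_imp.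
  apply: sarel_comp => //; last exact: dmap_r.
  by apply: (dfun_coord 0); apply: dmap_lsubmx; exact: dmap_l.
apply: sa_le; last exact/dfun_coord/dmap_r.
by apply: (dfun_coord i (F := fun x => rsubmx (lsubmx x))); apply: dmap_rsubmx; exact: dmap_l.
Qed.

Lemma mincoords_uniq m Q (s : seq 'I_m) t x y :
  mincoords Q s t x -> mincoords Q s t y -> forall i, i \in s -> x 0 i = y 0 i.
Proof.
elim: s => [//|j s IHs] /= [xs jx] [ys jy] i; rewrite inE => /orP[/eqP ->|]; last exact: IHs.
by apply/eqP; rewrite eq_le jx// jy.
Qed.

Lemma mincoords_compact m Q (s : seq 'I_m) t : compact (Q t) -> (exists x, Q t x) ->
  compact (mincoords Q s t) /\ exists x, mincoords Q s t x.
Proof.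
move=> cQ neQ; elim: s => [//|i s [cs [x0 sx0]]] /=.
have [|||x xs xmin] := @EVT_min_rV R m (fun x => x 0 i) (mincoords Q s t).
- by exists x0.
- exact: cs.
- by apply: continuous_subspaceT => z; exact: coord_continuous.
have xE : [set y | mincoords Q s t y /\ forall z, mincoords Q s t z -> y 0 i <= z 0 i] =
    mincoords Q s t `&` [set y | y 0 i <= x 0 i].
  apply/seteqP; split=> y [ys hy]; split => //; first exact: hy (set_mem xs).
  by move=> z zs; apply: (le_trans hy); apply: xmin; exact: mem_set.
split; last first.
  by exists x; split; [exact: set_mem|move=> y ys; apply: xmin; exact: mem_set].
rewrite -/([set y | mincoords Q s t y /\ forall z, mincoords Q s t z -> y 0 i <= z 0 i]) xE.
apply: compact_closedI => //.
by apply: (@closed_comp _ _ (fun y : 'rV[R]_m => y 0 i) [set y | y <= x 0 i]) => [z _|]; [exact: coord_continuous|exact: closed_le].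
Qed.

Lemma compact_selection m (Q : R -> 'rV[R]_m -> Prop) (s : seq 'I_m) : sarel Q ->
  (forall i, i \in s) ->
  exists2 c, rdmap c & forall t, compact (Q t) -> (exists x, Q t x) ->
    mincoords Q s t (c t).
Proof.
move=> sQ hs; have [c dc hc] := definable_unique_choice (sarel_mincoords s sQ).
exists c => // t cQ neQ; apply: hc.
have [_ [x xQ]] := mincoords_compact s cQ neQ; exists x => // y yQ.
by apply/rowP => i; exact: (mincoords_uniq yQ xQ (hs i)).
Qed.

End selection.

(** * The squared norm and the ring of bounded semialgebraic functions *)

Section sqnorm.
Context {R : realType} {m : nat}.
Implicit Types x y : 'rV[R]_m.

(** The norm of R^m used by the topology is a maximum of absolute values; the sum
    of squares is polynomial and has the same neighbourhoods ([nbhs_sqn]). *)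
Definition sqn x : R := \sum_i x 0 i ^+ 2.

Lemma sqn_ge0 x : 0 <= sqn x.
Proof. by apply: sumr_ge0 => i _; exact: sqr_ge0. Qed.

Lemma coord_sqn x i : x 0 i ^+ 2 <= sqn x.
Proof. by rewrite /sqn (bigD1 i)//= lerDl sumr_ge0// => j _; exact: sqr_ge0. Qed.

Lemma sqn_eq0 x y : sqn (x - y) = 0 -> x = y.
Proof.
move=> h; apply/rowP => i; apply/eqP; rewrite -subr_eq0 -sqrf_eq0 eq_le sqr_ge0 andbT.
by have := coord_sqn (x - y) i; rewrite h !mxE.
Qed.

Lemma sqn0 : sqn 0 = 0.
Proof. by rewrite /sqn big1// => i _; rewrite mxE expr0n. Qed.

Lemma sqn_gt0 x y : x <> y -> 0 < sqn (x - y).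
Proof. by move=> xy; rewrite lt_neqAle sqn_ge0 andbT eq_sym; apply/eqP => /sqn_eq0. Qed.

Lemma cvg_sqn T (F : set_system T) (f : T -> 'rV[R]_m) (l : 'rV[R]_m) : Filter F ->
  (forall i, f x 0 i @[x --> F] --> l 0 i) -> sqn (f x) @[x --> F] --> sqn l.
Proof.
move=> FF fl; apply: (cvg_big (op := +%R)) => [|i _].
  exact: add_continuous.
exact: (cvg_comp _ _ (fl i) (@exprn_continuous R 2 (l 0 i))).
Qed.

Lemma continuous_sqn y : continuous (fun x => sqn (x - y)).
Proof.
move=> x; apply: (@cvg_sqn _ (nbhs x) _ _ (@nbhs_filter _ x)) => i; under eq_fun do rewrite !mxE; rewrite !mxE.
by apply: cvgB; [exact: coord_continuous|exact: cvg_cst].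
Qed.

Lemma norm_sqn x (e : R) : 0 < e -> sqn x < e ^+ 2 -> `|x| < e.
Proof.
move=> e0 xe; rewrite [ltLHS]/Num.norm/= mx_normrE; apply/bigmax_ltP; split => // -[i j] _.
rewrite /= ord1 -ltr_sqr ?nnegrE ?normr_ge0 ?(ltW e0)// real_normK ?num_real//.
exact: le_lt_trans (coord_sqn x j) xe.
Qed.

Lemma nbhs_sqn x (A : set 'rV[R]_m) :
  nbhs x A <-> exists2 e, 0 < e & forall y, sqn (y - x) < e -> A y.
Proof.
split=> [/nbhs_ballP[e /= e0 he]|[e e0 he]].
  exists (e ^+ 2); first by rewrite exprn_gt0.
  move=> y /(norm_sqn e0) yx; apply: he.
  by rewrite -ball_normE /ball_/= -normrN opprB.
have oO : open [set y | sqn (y - x) < e].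
  apply: (@open_comp _ _ (fun y => sqn (y - x)) [set z | z < e]) => [y _|].
    exact: continuous_sqn.
  exact: open_lt.
by apply: filterS he _; apply: open_nbhs_nbhs; split => //=; rewrite subrr sqn0.
Qed.

Lemma dfun_sqn k (F : 'rV[R]_k -> 'rV[R]_m) : dmap F -> dfun (fun z => sqn (F z)).
Proof. by move=> dF; apply: dfun_sum => i; apply: dfunX; exact: dF. Qed.

Lemma dmapB k (F G : 'rV[R]_k -> 'rV[R]_m) : dmap F -> dmap G -> dmap (fun z => F z - G z).
Proof.
by move=> dF dG i; apply: dfun_ext (dfunB (dF i) (dG i)) => x; rewrite !mxE.
Qed.

Lemma dmap_cstv k (c : 'rV[R]_m) : dmap (fun _ : 'rV[R]_k => c).
Proof. by move=> i; exact: dfun_cst. Qed.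

End sqnorm.

Section subtype.
Context {T : topologicalType}.

Lemma nbhs_subtype (A : set T) (p : A) (U : set A) : nbhs p U <->
  exists2 V, nbhs (set_val p) V & forall q : A, V (set_val q) -> U q.
Proof.
split=> [|[V pV VU]].
  rewrite nbhsE => -[W [[V oV <-] Wp] WU]; exists V; last exact: WU.
  by exists V.
by apply: filterS VU _; exact: (@initial_continuous A T set_val p V pV).
Qed.

Lemma within_withinP (A : set T) (x : T) (B : set T) :
  within A (nbhs x) B <-> exists2 V, nbhs x V & forall y, A y -> V y -> B y.
Proof.
split=> [xB|[V xV VB]]; last by apply: filterS xV => y Vy Ay; exact: VB.
by exists [set y | A y -> B y] => // y Ay; apply.
Qed.

End subtype.

Section bsa.
Context {R : realType} {m : nat} (M : semialgebraic_set R m).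
Implicit Types (f g : bsa_ring M) (H : 'rV[R]_m -> R).

(** Extension by 0 turns functions on the type M into total functions on R^m,
    to which the semialgebraic calculus applies. *)
Definition ext (f : M -> R) (x : 'rV[R]_m) : R :=
  if pselect (carrier M x) is left Mx then f (exist _ x (mem_set Mx)) else 0.

Lemma ext_val (f : M -> R) (p : M) : ext f (set_val p) = f p.
Proof.
rewrite /ext; case: pselect => [Mp|[]]; last exact: set_mem (valP p).
by congr f; apply: val_inj.
Qed.

Lemma extE (f : M -> R) x (Mx : carrier M x) : ext f x = f (exist _ x (mem_set Mx)).
Proof. exact: (ext_val f (exist _ x (mem_set Mx))). Qed.

Lemma in_carrier (p : M) : carrier M (set_val p).
Proof. exact: set_mem (valP p). Qed.

(** The total functions on R^m that restrict to an element of the ring. *)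
Definition bsaf H := [/\ dfun H,
  forall x, carrier M x -> H @ within (carrier M) (nbhs x) --> H x &
  exists B, forall x, carrier M x -> `|H x| <= B].

Lemma cont_ext (f : M -> R) : continuous f <->
  forall x, carrier M x -> ext f @ within (carrier M) (nbhs x) --> ext f x.
Proof.
split=> [cf x Mx A|cf p A].
  rewrite (extE f Mx) => /cf /nbhs_subtype[V xV VA].
  by apply/within_withinP; exists V => // y My Vy; rewrite /= (extE f My); exact: VA.
rewrite -(ext_val f p) => /(cf _ (in_carrier p)) /within_withinP[V pV VA].
apply/nbhs_subtype; exists V => // q Vq.
by rewrite /= -(ext_val f q); apply: VA => //; exact: in_carrier.
Qed.

Lemma bsaf_ext f : bsaf (ext f).
Proof.
have /asboolP[[cf sf] /Defs.bounded_funP[B fB]] := bsaP f.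
split; last 1 first.
- by exists B => x Mx; rewrite (extE f Mx).
- have sM : semialgebraic (fun z : 'rV[R]_(m + 1) => carrier M (lsubmx z)).
    by apply: sa_comp (carrierP M); exact: dmap_l.
  have s0 : semialgebraic (fun z : 'rV[R]_(m + 1) => rsubmx z 0 0 = 0).
    by apply: sa_eq; [exact/dfun_coord/dmap_r|exact: dfun_cst].
  apply: sa_ext (sa_or sf (sa_and (sa_not sM) s0)) => z; split.
    move=> [[p _ <-]|[nM ->]]; first by rewrite row_mxKl row_mxKr mxE ext_val.
    by rewrite /ext; case: pselect.
  have [Mz|nMz] := pselect (carrier M (lsubmx z)) => ze; [left|right; split => //].
    exists (exist _ (lsubmx z) (mem_set Mz)) => //; rewrite -[RHS]hsubmxK; congr row_mx.
    by apply/rowP => i; rewrite ord1 mxE ze (extE f Mz).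
  by rewrite ze /ext; case: pselect.
- exact/cont_ext.
Qed.

(** The graph over M is cut out of the total graph by the semialgebraic set M. *)
Lemma bsaf_in H : bsaf H ->
  (fun p : M => H (set_val p)) \in @bounded_semialgebraic R m M.
Proof.
move=> [dH cH [B HB]]; set h := fun p : M => _.
have hE x : carrier M x -> ext h x = H x by move=> Mx; rewrite (extE h Mx).
apply/asboolP; split; last first.
  by apply/Defs.bounded_funP; exists B => p; apply: HB; exact: in_carrier.
split.
  apply/cont_ext => x Mx; rewrite (hE x Mx); move: (cH x Mx).
  apply: cvg_trans; apply: near_eq_cvg; apply/within_withinP.
  by exists setT => [|y My _]; [exact: filterT|rewrite hE].
have sM : semialgebraic (fun z : 'rV[R]_(m + 1) => carrier M (lsubmx z)).
  by apply: sa_comp (carrierP M); exact: dmap_l.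
apply: sa_ext (sa_and sM dH) => z; split.
  move=> [Mz ze]; exists (exist _ (lsubmx z) (mem_set Mz)) => //.
  by rewrite -[RHS]hsubmxK; congr row_mx; apply/rowP => i; rewrite ord1 mxE ze.
by move=> [p _ <-]; rewrite row_mxKl row_mxKr mxE; split => //; exact: in_carrier.
Qed.

Definition mkbsa H (HH : bsaf H) : bsa_ring M := BsaRing (bsaf_in HH).

Lemma mkbsaE H (HH : bsaf H) x : carrier M x -> ext (mkbsa HH) x = H x.
Proof. by move=> Mx; rewrite (extE _ Mx). Qed.

Lemma bsaf_cst c : bsaf (fun _ => c).
Proof. by split; [exact: dfun_cst|move=> x _; exact: cvg_cst|exists `|c|]. Qed.

Lemma extD f g x : ext (f + g) x = ext f x + ext g x.
Proof. by rewrite /ext; case: pselect => //; rewrite addr0. Qed.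

Lemma extM f g x : ext (f * g) x = ext f x * ext g x.
Proof. by rewrite /ext; case: pselect => //; rewrite mulr0. Qed.

Lemma extB f g x : ext (f - g) x = ext f x - ext g x.
Proof. by rewrite /ext; case: pselect => //; rewrite subr0. Qed.

Lemma bsaf_comp H (u : R -> R) : bsaf H -> rdfun u -> continuous u ->
  (exists B, forall y, `|u y| <= B) -> bsaf (fun x => u (H x)).
Proof.
move=> [dH cH _] du cu [B uB]; split; first exact: rdfun_comp.
  by move=> x Mx; exact: cvg_comp (cH x Mx) (cu _).
by exists B.
Qed.

End bsa.

(** * Maximal ideals as limits of ultrafilters *)

Section beta.
Context {R : realType} {m : nat} (M : semialgebraic_set R m).
Implicit Types (f g : bsa_ring M) (q r : beta_sa M) (U : set_system 'rV[R]_m).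

(** The ideal of functions tending to 0 along U; ultrafilters of subsets of M play
    the part of points, and distinct ones may define the same ideal. *)
Definition converges U q := [/\ UltraFilter U, U (carrier M) &
  forall f, max_spec_set q f <-> ext f @ U --> (0 : R)].

Lemma ext_cvg U f : UltraFilter U -> U (carrier M) -> exists L : R, ext f @ U --> L.
Proof.
move=> UU UM; have [_ _ [B fB]] := bsaf_ext f.
by apply: (@ultra_bounded_cvg _ _ _ _ B UU); apply: filterS UM.
Qed.

Definition bsa_cst (c : R) : bsa_ring M := mkbsa (bsaf_cst M c).

Lemma ext_bsa_cst c x : carrier M x -> ext (bsa_cst c) x = c.
Proof. exact: (mkbsaE (bsaf_cst M c)). Qed.

Lemma cvg_on U (FF : Filter U) (H K : 'rV[R]_m -> R) (L : R) : U (carrier M) ->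
  (forall x, carrier M x -> H x = K x) -> H @ U --> L -> K @ U --> L.
Proof.
move=> UM HK; apply: cvg_trans; apply: near_eq_cvg.
by apply: filterS UM => x /HK.
Qed.

Lemma cvg_to_eq U (H : 'rV[R]_m -> R) (a b : R) : a = b -> H @ U --> a -> H @ U --> b.
Proof. by move=> ->. Qed.

Lemma lim_unique U (H : 'rV[R]_m -> R) (a b : R) : ProperFilter U ->
  H @ U --> a -> H @ U --> b -> a = b.
Proof. by move=> PU; exact: (cvg_unique (@Rhausdorff R)). Qed.

Lemma ultra_ideal U : UltraFilter U -> U (carrier M) ->
  ideal [set f : bsa_ring M | ext f @ U --> (0 : R)].
Proof.
move=> UU UM; split.
- by rewrite /=; apply: (cvg_on _ (H := fun _ => 0) UM) => [x Mx|]; [rewrite (extE (0 : bsa_ring M) Mx)|exact: cvg_cst].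
- move=> f g /= f0 g0; apply: (cvg_on _ (H := fun x => ext f x + ext g x) UM) => [x _|].
    by rewrite extD.
  by apply: (cvg_to_eq (addr0 0)); exact: cvgD.
- move=> g f /= f0; apply: (cvg_on _ (H := fun x => ext g x * ext f x) UM) => [x _|].
    by rewrite extM.
  by have [L gL] := ext_cvg g UU UM; apply: (cvg_to_eq (mulr0 L)); exact: cvgM.
Qed.

Lemma ultra_not1 U : UltraFilter U -> U (carrier M) -> ~ ext (1 : bsa_ring M) @ U --> (0 : R).
Proof.
move=> UU UM h.
have h1 : ext (1 : bsa_ring M) @ U --> (1 : R).
  by apply: (cvg_on _ (H := fun _ => 1) UM) => [x Mx|]; [rewrite (extE (1 : bsa_ring M) Mx)|exact: cvg_cst].
have /eqP : 0 = 1 :> R by exact: (lim_unique _ h h1).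
by rewrite eq_sym oner_eq0.
Qed.

(** A function that does not tend to 0 has a nonzero limit, because bounded
    functions converge along ultrafilters; subtracting the limit shows that it
    generates a unit together with the ideal. *)
Lemma ultra_converges U : UltraFilter U -> U (carrier M) -> exists q, converges U q.
Proof.
move=> UU UM; have iU := ultra_ideal UU UM.
have mU : maximal_ideal [set f : bsa_ring M | ext f @ U --> (0 : R)].
  split=> //.
    by move=> h; apply: (ultra_not1 UU UM); have : [set f : bsa_ring M | ext f @ U --> (0 : R)] 1 by rewrite h.
  move=> J [J0 JD JM] IJ; have [JI|] := pselect (J `<=` [set f : bsa_ring M | ext f @ U --> (0 : R)]).
    by left; apply/seteqP.
  move=> /existsNP[g /not_implyP[Jg g0]]; right; have [L gL] := ext_cvg g UU UM.
  have L0 : L != 0 by apply/eqP => L0; apply: g0; rewrite /= -L0.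
  have Jc : J (bsa_cst L).
    have -> : bsa_cst L = g + (-1) * (g - bsa_cst L) by ring.
    apply: JD => //; apply: JM; apply: IJ; rewrite /mkset.
    apply: (cvg_on _ (H := fun x => ext g x - L) UM) => [x Mx|].
      by rewrite extB ext_bsa_cst.
    by apply: (cvg_to_eq (subrr L)); apply: cvgB => //; exact: cvg_cst.
  apply: ideal_one; first by split.
  have -> : 1 = bsa_cst L^-1 * bsa_cst L.
    by apply: val_inj; apply/funext => p; rewrite /= -[RHS]/(L^-1 * L) mulVf.
  exact: JM.
by exists (MaxSpec mU); split.
Qed.

Lemma bsaf_inv f (e : R) : 0 < e -> (forall x, carrier M x -> e <= `|ext f x|) ->
  bsaf M (fun x => (ext f x)^-1).
Proof.
move=> e0 fe; have [df cf _] := bsaf_ext f; split; first exact: dfunV.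
  move=> x Mx; apply: cvgV; last exact: cf.
  by rewrite -normr_gt0 (lt_le_trans e0)// fe.
exists e^-1 => x Mx; rewrite normfV lef_pV2 ?fe// posrE //.
by rewrite (lt_le_trans e0)// fe.
Qed.

(** The sets where a member of q is smaller than a given constant generate a
    proper filter: two members f and g are combined as f^2 + g^2, and a member
    bounded away from 0 would be invertible. The ideal of an ultrafilter
    refining it contains q, hence is q. *)
Lemma converges_ex q : exists U, converges U q.
Proof.
have mq := max_specP q; have [[I0 ID IM] IT _] := mq.
pose B (fe : bsa_ring M * R) := [set x | carrier M x /\ `|ext fe.1 x| < fe.2].
pose D := [set fe : bsa_ring M * R | max_spec_set q fe.1 /\ 0 < fe.2].
have PF : ProperFilter (filter_from D B).
  apply: filter_from_proper; first apply: filter_from_filter.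
  - by exists (0, 1); split => //=.
  - move=> [f e] [g d] [/= qf e0] [/= qg d0].
    exists (f * f + g * g, Num.min e d ^+ 2).
      split => /=; first by apply: ID; exact: IM.
      by rewrite exprn_gt0// lt_min e0.
    move=> x [Mx h]; have {h} : `|ext (f * f + g * g) x| < Num.min e d ^+ 2 by exact: h.
    rewrite extD !extM -!expr2 ger0_norm ?addr_ge0 ?sqr_ge0// => h.
    have hm : 0 <= Num.min e d by rewrite le_min !ltW.
    split; split => //=; rewrite (@lt_le_trans _ _ (Num.min e d))// ?ge_min ?lexx ?orbT//.
      rewrite -ltr_sqr ?nnegrE// real_normK ?num_real//; apply: le_lt_trans h.
      by rewrite lerDl sqr_ge0.
    rewrite -ltr_sqr ?nnegrE// real_normK ?num_real//; apply: le_lt_trans h.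
    by rewrite lerDr sqr_ge0.
  move=> [f e] [/= qf e0]; apply: contrapT => nB; apply: IT.
  have fe x : carrier M x -> e <= `|ext f x|.
    by move=> Mx; rewrite leNgt; apply/negP => h; apply: nB; exists x.
  apply: ideal_one => //.
  have -> : 1 = mkbsa (bsaf_inv e0 fe) * f; last exact: IM.
  apply: val_inj; apply/funext => p; rewrite /= -[RHS]/((ext f (set_val p))^-1 * f p).
  rewrite -(ext_val f p) mulVf// -normr_gt0 (lt_le_trans e0)// fe//; exact: in_carrier.
have [U [UU DU]] := ultraFilterLemma PF; exists U.
have UM : U (carrier M) by apply: DU; exists (0, 1) => [|x []//]; split.
have qU : max_spec_set q `<=` [set f : bsa_ring M | ext f @ U --> (0 : R)].
  move=> f qf; apply/cvgrPdist_lt => e e0; apply: DU; exists (f, e) => // x [_ /=].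
  by rewrite sub0r normrN.
split => // f; split; first exact: qU.
have [_ _ mI] := mq; have [<-//|h] := mI _ (ultra_ideal UU UM) qU.
by case: (ultra_not1 UU UM); rewrite -[_ --> _]/([set f : bsa_ring M | ext f @ U --> (0 : R)] 1) h.
Qed.

Lemma ev_ex q f : exists c, max_spec_set q (f - bsa_cst c).
Proof.
have [U [UU UM qU]] := converges_ex q; have [L fL] := ext_cvg f UU UM.
exists L; apply/qU; apply: (cvg_on _ (H := fun x => ext f x - L) UM) => [x Mx|].
  by rewrite extB ext_bsa_cst.
by apply: (cvg_to_eq (subrr L)); apply: cvgB => //; exact: cvg_cst.
Qed.

Definition ev q f : R := projT1 (cid (ev_ex q f)).

Lemma ev_cvg U q f : converges U q -> ext f @ U --> ev q f.
Proof.
move=> [UU UM qU]; rewrite /ev; case: cid => c /= /qU h.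
apply: (cvg_on _ (H := fun x => ext (f - bsa_cst c) x + c) UM) => [x Mx|].
  by rewrite extB ext_bsa_cst// subrK.
by apply: (cvg_to_eq (add0r c)); apply: cvgD => //; exact: cvg_cst.
Qed.

Arguments ev_cvg [U q] f cU : rename.

Lemma ev_unique U q f (L : R) : converges U q -> ext f @ U --> L -> ev q f = L.
Proof.
move=> cU fL; have [UU _ _] := cU.
exact: (lim_unique _ (ev_cvg f cU) fL).
Qed.

Lemma ev_eq0 q f : max_spec_set q f <-> ev q f = 0.
Proof.
have [U cU] := converges_ex q; have [UU UM qU] := cU.
rewrite qU; split=> [|<-]; first exact: ev_unique.
exact: ev_cvg.
Qed.

Lemma beta_eq q r : (forall f, ev q f = ev r f) -> q = r.
Proof.
move=> qr; have E : max_spec_set q = max_spec_set r.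
  by apply/seteqP; split => f /ev_eq0; [rewrite qr|rewrite -qr] => /ev_eq0.
case: q r E {qr} => [I mI] [J mJ] /= IJ; rewrite -IJ in mJ *.
by rewrite (Prop_irrelevance mI mJ).
Qed.

Lemma converges_unique U q r : converges U q -> converges U r -> q = r.
Proof.
by move=> cq cr; apply: beta_eq => f; apply: (ev_unique cq); exact: ev_cvg.
Qed.

Lemma open_beta f : open [set q | ev q f <> 0].
Proof.
rewrite (_ : [set q | _] = zariski_basic f); last first.
  by apply/seteqP; split => q /= nq; move=> /ev_eq0/nq.
exists [set f]; by rewrite bigcup_set1.
Qed.

Lemma nbhs_beta q (A : set (beta_sa M)) : nbhs q A <->
  exists2 f, ev q f <> 0 & forall r, ev r f <> 0 -> A r.
Proof.
split=> [|[f qf fA]].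
  rewrite nbhsE => -[W [[F ->] [f Ff qf]] WA]; exists f; first by move=> /ev_eq0.
  by move=> r rf; apply: WA; exists f => // /ev_eq0.
by rewrite nbhsE; exists [set r | ev r f <> 0] => //; split => //; exact: open_beta.
Qed.

Lemma ev_mk U q H (HH : bsaf M H) (L : R) : converges U q -> H @ U --> L -> ev q (mkbsa HH) = L.
Proof.
move=> cU HL; have [UU UM _] := cU; apply: (ev_unique cU).
by apply: (cvg_on _ UM) HL => x Mx; rewrite mkbsaE.
Qed.

Lemma rdfun_bump (c e : R) : rdfun (fun y => Num.max 0 (e - `|y - c|)).
Proof.
apply: dfun_max; first exact: dfun_cst.
apply: dfunB; first exact: dfun_cst.
apply: dfun_norm; apply: dfunB; last exact: dfun_cst.
exact: (dfun_coord 0 (@dmap_id _ 1)).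
Qed.

Lemma continuous_bump (c e : R) : continuous (fun y => Num.max 0 (e - `|y - c|)).
Proof.
move=> y; apply: (@continuous_max _ _ (fun _ => 0) (fun y => e - `|y - c|)).
  exact: cst_continuous.
apply: cvgB; first exact: cvg_cst.
by apply: cvg_norm; apply: cvgB; [exact: cvg_id|exact: cvg_cst].
Qed.

Lemma bump_bounded (c e y : R) : 0 <= e -> `|Num.max 0 (e - `|y - c|)| <= e.
Proof.
move=> e0; rewrite ger0_norm ?le_max ?lexx// ge_max e0/=.
by rewrite gerBl.
Qed.

Lemma bump_gt0 (c e y : R) : (0 < Num.max 0 (e - `|y - c|)) = (`|y - c| < e).
Proof. by rewrite lt_max ltxx/= subr_gt0. Qed.

(** The evaluations inside an interval around c are those at which a bump
    function composed with f does not vanish. *)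
Lemma open_ev f (c e : R) : 0 <= e -> open [set q | `|ev q f - c| < e].
Proof.
move=> e0.
have HH : bsaf M (fun x => Num.max 0 (e - `|ext f x - c|)).
  apply: (bsaf_comp (bsaf_ext f) (@rdfun_bump c e) (@continuous_bump c e)).
  by exists e => y; exact: bump_bounded.
rewrite (_ : [set q | _] = [set q | ev q (mkbsa HH) <> 0]); first exact: open_beta.
suff E q : ev q (mkbsa HH) = Num.max 0 (e - `|ev q f - c|).
  apply/seteqP; split => q /=; rewrite E -bump_gt0.
    by move=> h h0; rewrite h0 ltxx in h.
  by move=> /eqP h; rewrite lt_neqAle eq_sym h/= le_max lexx.
have [U cU] := converges_ex q; have [UU _ _] := cU.
apply: (ev_mk HH cU).
exact: (cvg_comp _ _ (ev_cvg f cU) (@continuous_bump c e _)).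
Qed.

Lemma continuous_ev f : continuous (fun q => ev q f).
Proof.
move=> q; have FF : Filter (nbhs q) := @nbhs_filter (beta_sa M) q.
apply/cvgrPdist_lt => e e0.
have oq : open_nbhs q [set r | `|ev q f - ev r f| < e].
  split; last by rewrite /= subrr normr0.
  rewrite (_ : [set r | _] = [set r | `|ev r f - ev q f| < e]); first exact: open_ev (ltW e0).
  by apply/seteqP; split => r /=; rewrite distrC.
exact: (open_nbhs_nbhs oq).
Qed.

Lemma converges_pt (U : set_system 'rV[R]_m) (p : M) : UltraFilter U -> U (carrier M) ->
  U --> set_val p -> converges U (beta_pt p).
Proof.
move=> UU UM Up; split => // f.
have fp : ext f @ U --> f p.
  have [_ cf _] := bsaf_ext f.
  rewrite -(ext_val f p); apply: cvg_trans (cf _ (in_carrier p)).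
  apply: cvg_app => A /within_withinP[V pV VA].
  by apply: filterS (filterI UM (Up V pV)) => x [Mx Vx]; exact: VA.
rewrite /=; split=> [<-//|f0].
exact: (lim_unique _ fp f0).
Qed.

Lemma ev_pt (p : M) f : ev (beta_pt p) f = f p.
Proof.
have PF : ProperFilter (within (carrier M) (nbhs (set_val p))).
  apply: Build_ProperFilter_ex => P /within_withinP[V pV VP]; exists (set_val p).
  by apply: VP; [exact: in_carrier|exact: nbhs_singleton].
have [U [UU pU]] := ultraFilterLemma PF.
have UM : U (carrier M) by apply: pU; apply/within_withinP; exists setT => //; exact: filterT.
have Up : U --> set_val p.
  by move=> A pA; apply: pU; apply/within_withinP; exists A.
have cU := converges_pt UU UM Up; apply: (ev_unique cU).
have [_ cf _] := bsaf_ext f.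
rewrite -(ext_val f p); apply: cvg_trans (cf _ (in_carrier p)).
exact: cvg_app pU.
Qed.

End beta.
Arguments ev_cvg {R m M} [U q] f cU : rename.

(** * Topological invariants *)

Section invariants.
Context {R : realType}.

(** A relatively discrete subset of U of the size of the continuum, with the open
    sets isolating its points. *)
Definition discrete_family (X : topologicalType) (U : set X) :=
  exists (q : R -> X) (W : R -> set X), forall s, 0 < s < 1 ->
    [/\ U (q s), open (W s), W s (q s) &
        forall s', 0 < s' < 1 -> W s (q s') -> s' = s].

Definition tame (X : topologicalType) (x : X) :=
  exists2 U, nbhs x U & ~ discrete_family U.

Definition path_from (X : topologicalType) (x : X) (c : R -> X) :=
  [/\ continuous c, c 0 = x & forall t, 0 < t -> c t <> x].

Definition end_like (X : topologicalType) (x : X) := ~ open [set x] /\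
  forall c1 c2, path_from x c1 -> path_from x c2 ->
    exists s t, [/\ 0 < s, 0 < t & c1 s = c2 t].

Section transport.
Context {X Y : topologicalType} {f : X -> Y} {g : Y -> X}.
Hypotheses (cf : continuous f) (cg : continuous g) (fK : cancel f g) (gK : cancel g f).

Lemma tame_homeo x : tame x -> tame (f x).
Proof.
move=> [U xU nU]; exists (g @^-1` U); first by apply: cg; rewrite fK.
move=> [q [W qW]]; apply: nU; exists (g \o q), (fun s => f @^-1` W s) => s s01.
have [Uq oW Wq hW] := qW s s01; split => //=.
- by apply: open_comp => // y _; exact: cf.
- by rewrite gK.
- by move=> s' s'01; rewrite gK; exact: hW.
Qed.

Lemma path_homeo x c : path_from (f x) c -> path_from x (g \o c).
Proof.
move=> [cc c0 cn]; split=> [t||t t0 /= h].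
- by apply: continuous_comp; [exact: cc|exact: cg].
- by rewrite /= c0 fK.
- by apply: (cn t t0); rewrite -h gK.
Qed.

Lemma end_like_homeo x : end_like x -> end_like (f x).
Proof.
move=> [nx xc]; split.
  move=> ox; apply: nx; rewrite (_ : [set x] = f @^-1` [set f x]).
    by apply: open_comp => // y _; exact: cf.
  by apply/seteqP; split => y /= => [->//|/(congr1 g)]; rewrite !fK.
move=> c1 c2 /path_homeo p1 /path_homeo p2; have [s [t [s0 t0 e]]] := xc _ _ p1 p2.
by exists s, t; split => //; rewrite -(gK (c1 s)) -(gK (c2 t)); congr f.
Qed.

End transport.

Lemma tame_not_end_like_homeo (X Y : topologicalType) (f : X -> Y) x : homeomorphism f ->
  (tame x /\ ~ end_like x) <-> (tame (f x) /\ ~ end_like (f x)).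
Proof.
move=> [g [cf cg fK gK]]; have tg := tame_homeo cf cg fK gK.
have eg := end_like_homeo cf cg fK gK.
split=> -[tx nx]; split; first exact: tg.
- by move=> /(end_like_homeo cg cf gK fK); rewrite fK.
- by have := tame_homeo cg cf gK fK tx; rewrite fK.
- by move=> /eg.
Qed.

(** Along each path h takes all small positive values by the intermediate value
    theorem, and h tells the points of U apart. *)
Lemma spike_paths_meet (X : topologicalType) (x : X) (U : set X) (h : X -> R) :
  open U -> U x -> (forall y, U y -> h z @[z --> y] --> h y) ->
  (forall y z, U y -> U z -> h y = h z -> y = z) -> h x = 0 -> (forall y, U y -> 0 <= h y) ->
  forall c1 c2, path_from x c1 -> path_from x c2 ->
    exists s t, [/\ 0 < s, 0 < t & c1 s = c2 t].
Proof.
move=> oU Ux ch ih hx0 h0.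
have seg c : path_from x c -> exists d, [/\ 0 < d, forall t, 0 <= t <= d -> U (c t) & 0 < h (c d)].
  move=> [cc c0 cn].
  have : nbhs 0 (c @^-1` U) by apply: cc; rewrite c0; exact: open_nbhs_nbhs.
  move=> /nbhs_ballP[e /= e0 he].
  have hU t : 0 <= t <= e / 2 -> U (c t).
    move=> /andP[t0 te]; apply: he; rewrite /ball/= sub0r normrN ger0_norm//; lra.
  have e20 : 0 < e / 2 by lra.
  exists (e / 2); split => //.
  have Ue : U (c (e / 2)) by apply: hU; rewrite (ltW e20) lexx.
  rewrite lt_neqAle h0// andbT; apply/eqP; rewrite -hx0 => /ih.
  by move=> /(_ Ux Ue)/esym; exact: cn.
have hit c d v : path_from x c -> 0 < d -> (forall t, 0 <= t <= d -> U (c t)) ->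
    0 < v <= h (c d) -> exists2 s, 0 < s & U (c s) /\ h (c s) = v.
  move=> [cc c0 cn] d0 dU /andP[v0 vd].
  have chc : {within `[0, d], continuous (h \o c)}.
    apply: continuous_in_subspaceT => t; rewrite inE/= in_itv/= => td.
    by apply: (cvg_comp _ _ (cc t)); exact: ch (dU _ td).
  have [|t td tv] := IVT (ltW d0) chc (v := v).
    by rewrite /= c0 hx0 ge_min (ltW v0) le_max vd orbT.
  rewrite in_itv/= in td; exists t; last by split => //; exact: dU.
  rewrite lt_neqAle (andP td).1 andbT; apply/eqP => t0.
  by move: v0; rewrite -tv -t0 /= c0 hx0 ltxx.
move=> c1 c2 p1 p2; have [d1 [d10 dU1 hd1]] := seg _ p1; have [d2 [d20 dU2 hd2]] := seg _ p2.
pose v := Num.min (h (c1 d1)) (h (c2 d2)).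
have v0 : 0 < v by rewrite lt_min hd1.
have [|s s0 [Us hs]] := hit c1 d1 v p1 d10 dU1; first by rewrite v0 ge_min lexx.
have [|t t0 [Ut ht]] := hit c2 d2 v p2 d20 dU2; first by rewrite v0 ge_min lexx orbT.
by exists s, t; split => //; apply: ih => //; rewrite hs ht.
Qed.

(** If the isolating neighbourhood of x s has radius 1/(n+1), the number n and the
    integral parts of the coordinates of (n+1) x s determine s; but ]0, 1[ is
    uncountable. *)
Lemma euclidean_no_discrete_family m (x : R -> 'rV[R]_m) (V : R -> set 'rV[R]_m) :
  ~ forall s, 0 < s < 1 -> nbhs (x s) (V s) /\ forall s', 0 < s' < 1 -> V s (x s') -> s' = s.
Proof.
move=> h.
have hn s : exists n : nat, 0 < s < 1 -> forall y, `|y - x s| < n.+1%:R^-1 -> V s y.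
  have [s01|] := pselect (0 < s < 1); last by exists 0%N.
  have [/nbhs_ballP[e /= e0 he] _] := h s s01.
  have [n _ hn] := near_infty_natSinv_lt (PosNum e0); exists n => _ y yx.
  apply: he; rewrite -ball_normE /ball_/= -normrN opprB.
  exact: lt_trans yx (hn n (leqnn n)).
have {hn}[n hn] := choice hn.
pose code s : nat * 'rV[int]_m := (n s, \row_i Num.floor ((n s).+1%:R * x s 0 i)).
apply: (@uncountable_itv R 0 1 ltr01); apply/countable_injP.
exists (fun s => pickle (code s)) => s s'; rewrite !inE/= => s01 s'01.
move=> /(pcan_inj pickleK)[nn /rowP e]; have [_ us] := h s s01; apply/esym/us => //.
apply: hn => //; rewrite -nn in e; set N : R := (n s).+1%:R in e *.
have N0 : 0 < N by rewrite ltr0Sn.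
rewrite [ltLHS]/Num.norm/= mx_normrE; apply/bigmax_ltP; split; first by rewrite invr_gt0.
move=> [i j] _; rewrite /= ord1 !mxE -[_^-1]mul1r ltr_pdivlMr// mulrC.
rewrite -{1}(ger0_norm (ltW N0)) -normrM mulrBr ltr_norml.
have := e j; rewrite !mxE => ej.
have h1 := floor_le (N * x s 0 j); have h2 := lt_succ_floor (N * x s 0 j).
have h3 := floor_le (N * x s' 0 j); have h4 := lt_succ_floor (N * x s' 0 j).
rewrite -ej in h3 h4; rewrite !intrD in h2 h4; apply/andP; split; lra.
Qed.

End invariants.
Arguments discrete_family R {X} U.
Arguments tame R {X} x.
Arguments end_like R {X} x.

(** * Points of the set in its compactification *)

Section points.
Context {R : realType} {m : nat} (M : semialgebraic_set R m).
Implicit Types (f g : bsa_ring M) (q r : beta_sa M) (U : set_system 'rV[R]_m).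

Lemma ev_ge U q f (e : R) : converges U q -> U [set x | e <= `|ext f x|] -> e <= `|ev q f|.
Proof.
move=> cU Ue; have [UU UM _] := cU; rewrite leNgt; apply/negP => h.
have fU : `|ext f x| @[x --> U] --> `|ev q f| by apply: cvg_norm; exact: ev_cvg.
have Ul : U [set x | `|ext f x| < e].
  by apply: (fU [set t | t < e]); apply: open_nbhs_nbhs; split => //; exact: open_lt.
have [x [/= h1 h2]] := filter_ex (filterI Ue Ul).
by have := le_lt_trans h1 h2; rewrite ltxx.
Qed.

Lemma ev_gt U q f (e : R) : converges U q -> e < `|ev q f| -> U [set x | e < `|ext f x|].
Proof.
move=> cU h; have [UU UM _] := cU.
have fU : `|ext f x| @[x --> U] --> `|ev q f| by apply: cvg_norm; exact: ev_cvg.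
by apply: (fU [set t | e < t]); apply: open_nbhs_nbhs; split => //; exact: open_gt.
Qed.

Lemma ev_neq0 U q f : converges U q -> ev q f <> 0 -> U [set x | ext f x <> 0].
Proof.
move=> cU /eqP; rewrite -normr_gt0 => /(ev_gt cU); have [UU _ _] := cU.
by apply: filterS => x /=; rewrite normr_gt0 => /eqP.
Qed.

Lemma bsaf_ball (x0 : 'rV[R]_m) (e : R) : 0 < e ->
  bsaf M (fun x => Num.max 0 (e - sqn (x - x0))).
Proof.
move=> e0; split.
- apply: dfun_max; first exact: dfun_cst.
  apply: dfunB; first exact: dfun_cst.
  by apply/dfun_sqn/dmapB; [exact: dmap_id|exact: dmap_cstv].
- move=> x Mx; apply: cvg_within_filter.
  have cm : continuous (fun y : R => Num.max 0 (e - y)).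
    move=> y; apply: (@continuous_max _ _ (fun _ => 0) (fun y => e - y)).
      exact: cst_continuous.
    by apply: cvgB; [exact: cvg_cst|exact: cvg_id].
  exact: (cvg_comp _ _ (@continuous_sqn R m x0 x) (cm _)).
- exists e => x Mx; rewrite ger0_norm ?le_max ?lexx// ge_max (ltW e0)/=.
  by rewrite gerBl sqn_ge0.
Qed.

Lemma ball_neq0 (x0 x : 'rV[R]_m) (e : R) :
  (Num.max 0 (e - sqn (x - x0)) <> 0) <-> sqn (x - x0) < e.
Proof.
split=> [/eqP h|h].
  by rewrite -subr_gt0; move: h; rewrite /Num.max; case: ifP => //; rewrite eqxx.
by rewrite /Num.max subr_gt0 h => /eqP; rewrite subr_eq0 => /eqP h'; rewrite h' ltxx in h.
Qed.

(** M carries the subspace topology of [beta_sa M], and the closures of Euclidean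
    neighbourhoods of p form a basis at p. *)
Lemma nbhs_pt (p : M) (A : set (beta_sa M)) : nbhs (beta_pt p) A <->
  exists2 V, nbhs (set_val p) V & forall U r, converges U r -> U V -> A r.
Proof.
split=> [/nbhs_beta[f pf fA]|[V /nbhs_sqn[e e0 eV] VA]].
  rewrite ev_pt in pf; pose e := `|f p| / 2.
  have e0 : 0 < e by rewrite divr_gt0// normr_gt0; exact/eqP.
  have [_ cf _] := bsaf_ext f.
  have h : `|ext f x| @[x --> within (carrier M) (nbhs (set_val p))] --> `|f p|.
    by rewrite -(ext_val f p); apply: cvg_norm; exact: cf (in_carrier p).
  have /h/within_withinP[V pV VE] : nbhs `|f p| [set t | e < t].
    apply: open_nbhs_nbhs; split; first exact: open_gt.
    by rewrite /= /e; move: e0; rewrite /e; lra.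
  exists V => // U r cU UV; apply: fA => /eqP; apply/negP.
  have [UU UM _] := cU.
  rewrite -normr_gt0 (lt_le_trans e0)//; apply: (ev_ge cU).
  by apply: filterS (filterI UM UV) => x [Mx Vx]; exact/ltW/VE.
pose g := mkbsa (bsaf_ball (set_val p) e0); apply/nbhs_beta; exists g.
  by rewrite ev_pt; apply/ball_neq0; rewrite subrr sqn0.
move=> r rg; have [U cU] := converges_ex r; apply: (VA U r cU).
have [UU UM _] := cU.
apply: filterS (filterI UM (ev_neq0 cU rg)) => x [Mx].
by rewrite /mkset /g mkbsaE// => /ball_neq0/eV.
Qed.

Lemma beta_pt_inj : injective (@beta_pt R m M).
Proof.
move=> p p' pp; apply: contrapT => np.
have /sqn_gt0 e0 : set_val p' <> set_val p by move=> h; apply: np; apply: val_inj.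
have : ev (beta_pt p) (mkbsa (bsaf_ball (set_val p) e0)) <> 0.
  by rewrite ev_pt; apply/ball_neq0; rewrite subrr sqn0.
by rewrite pp ev_pt => /ball_neq0; rewrite ltxx.
Qed.

Lemma principal_converges (p : M) : converges (principal_filter (set_val p)) (beta_pt p).
Proof.
have UU := principal_filter_ultra (set_val p).
apply: converges_pt => //; first by apply/principal_filterP; exact: in_carrier.
by move=> A /nbhs_singleton pA; apply/principal_filterP.
Qed.

Lemma continuous_beta_pt : continuous (@beta_pt R m M).
Proof.
move=> p A /nbhs_pt[V pV VA]; apply/nbhs_subtype; exists V => // p' Vp'.
by apply: (VA _ _ (principal_converges p')); exact/principal_filterP.
Qed.

Definition lc_at (x : 'rV[R]_m) := carrier M x /\
  exists2 e, 0 < e & compact (carrier M `&` [set y | sqn (y - x) <= e]).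

Lemma closed_sqn_ball (x : 'rV[R]_m) (e : R) : closed [set y : 'rV[R]_m | sqn (y - x) <= e].
Proof.
apply: (@closed_comp _ _ (fun y : 'rV[R]_m => sqn (y - x)) [set t | t <= e]) => [y _|].
  exact: continuous_sqn.
exact: closed_le.
Qed.

Lemma compact_sqn_shrink (x : 'rV[R]_m) (e d : R) : d <= e ->
  compact (carrier M `&` [set y | sqn (y - x) <= e]) ->
  compact (carrier M `&` [set y | sqn (y - x) <= d]).
Proof.
move=> de cC; rewrite (_ : _ `&` _ = (carrier M `&` [set y | sqn (y - x) <= e]) `&`
    [set y | sqn (y - x) <= d]); first by apply: compact_closedI => //; exact: closed_sqn_ball.
apply/seteqP; split => y; last by move=> [[My _] yd].
by move=> [My yd]; split => //; split => //=; exact: le_trans yd de.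
Qed.

Lemma lc_pointsP x : lc_points (carrier M) x <-> lc_at x.
Proof.
split=> [[p [K /nbhs_subtype[V /nbhs_sqn[e e0 eV] VK] cK] <-]|[Mx [e e0 cC]]].
  split; first exact: in_carrier.
  exists (e / 2); first lra.
  have -> : carrier M `&` [set y | sqn (y - set_val p) <= e / 2] =
      (set_val @` K) `&` [set y | sqn (y - set_val p) <= e / 2].
    apply/seteqP; split=> y [].
      move=> My /= ye; split => //; exists (exist _ y (mem_set My)) => //.
      by apply/VK/eV; rewrite /=; lra.
    by move=> [p' _ <-] h; split => //; exact: in_carrier.
  apply: compact_closedI; last exact: closed_sqn_ball.
  apply: continuous_compact => //; apply: continuous_subspaceT.
  exact: initial_continuous.
exists (exist _ x (mem_set Mx)) => //.
exists (set_val @^-1` [set y | sqn (y - x) <= e]).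
  apply/nbhs_subtype; exists [set y | sqn (y - x) <= e] => //.
  by apply/nbhs_sqn; exists e => // y /ltW.
move=> F PF FK.
have PF' : ProperFilter (set_val @ F) by exact: fmap_proper_filter.
have FC : F (set_val @^-1` (carrier M `&` [set y | sqn (y - x) <= e])).
  by apply: filterS FK => p' h; split; [exact: in_carrier|exact: h].
have [y [[My ye] cy]] := cC (set_val @ F) PF' FC.
exists (exist _ y (mem_set My)); split => // A B FA /nbhs_subtype[V yV VB].
have FA' : F (set_val @^-1` (set_val @` A)).
  by apply: filterS FA => p' Ap'; exists p'.
by have [z [[p' Ap' <-] Vz]] := cy _ V FA' yV; exists p'; split => //; exact: VB.
Qed.

(** Ultrafilters on compact sets converge in R^m, and ideals are determined by
    ultrafilters. *)
Lemma compact_converges U r K : converges U r -> K `<=` carrier M -> compact K -> U K ->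
  exists2 p : M, K (set_val p) & r = beta_pt p.
Proof.
move=> cU KM; have [UU UM _] := cU.
rewrite compact_ultra => /(_ _ UU) h /h[x [Kx Ux]].
exists (exist _ x (mem_set (KM x Kx))) => //.
by apply: (converges_unique cU); apply: converges_pt.
Qed.

Lemma tame_lc (p : M) : lc_at (set_val p) -> tame R (beta_pt p : beta_sa M).
Proof.
move=> [Mp [e e0 cC]].
exists [set r | exists2 p', r = beta_pt p' & sqn (set_val p' - set_val p) <= e].
  apply/nbhs_pt; exists [set y | sqn (y - set_val p) <= e].
    by apply/nbhs_sqn; exists e => // y /ltW.
  move=> U r cU Ue; have [UU UM _] := cU.
  by have [] := @compact_converges U r _ cU _ cC (filterI UM Ue) => // p' [_ h] ->; exists p'.
move=> [q [W qW]].
have hp s : exists p' : M, 0 < s < 1 -> q s = beta_pt p'.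
  have [s01|] := pselect (0 < s < 1); last by exists p.
  by have [[p' -> _] _ _ _] := qW s s01; exists p'.
have [p' hp'] := choice hp.
apply: (@euclidean_no_discrete_family R m (fun s => set_val (p' s))
  (fun s => [set y | forall My : carrier M y, W s (beta_pt (exist _ y (mem_set My)))])) => s s01.
have [_ oW Wq uW] := qW s s01; split.
  have : nbhs (beta_pt (p' s)) (W s) by rewrite -hp'//; exact: open_nbhs_nbhs.
  move=> /nbhs_pt[V pV VW]; apply: filterS pV => y Vy My.
  by apply: (VW _ _ (principal_converges _)); exact/principal_filterP.
move=> s' s'01 h; apply: uW => //; rewrite hp'//.
have := h (in_carrier (p' s')); congr (W s (beta_pt _)); exact: val_inj.
Qed.

Definition above f (e : R) x := carrier M x /\ e < `|ext f x|.

Lemma sa_above f e : semialgebraic (above f e).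
Proof.
have [df _ _] := bsaf_ext f.
by apply: sa_and; [exact: carrierP|apply: sa_lt; [exact: dfun_cst|exact: dfun_norm]].
Qed.

(** A basic neighbourhood of q is given by one function f; every limit of an
    ultrafilter on the trace [above f e] stays in the neighbourhood A, with a
    margin that survives passage to the limit. *)
Lemma tame_above q : tame R q -> exists f (e : R) (A : set (beta_sa M)),
  [/\ 0 < e, `|ev q f| = 2 * e, forall U r, converges U r -> U (above f e) -> A r &
      ~ discrete_family R A].
Proof.
move=> [A /nbhs_beta[f qf fA] nA]; pose e : R := `|ev q f| / 2.
have e0 : 0 < e by rewrite divr_gt0// normr_gt0; exact/eqP.
exists f, e, A; split => //; first by rewrite /e; lra.
move=> U r cU Ue; apply: fA; have [UU _ _] := cU; apply/eqP; rewrite -normr_gt0.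
by apply: (lt_le_trans e0); apply: (ev_ge cU); apply: filterS Ue => x [_ /ltW].
Qed.

End points.

(** * Level sets of a function tending to infinity *)

Lemma continuous_pos_sub (R : realType) (e : R) : continuous (fun y : R => Num.max 0 (e - y)).
Proof.
move=> y; apply: (@continuous_max _ _ (fun _ => 0) (fun y => e - y)).
  exact: cst_continuous.
by apply: cvgB; [exact: cvg_cst|exact: cvg_id].
Qed.

Section cutoff.
Context {R : realType} {m : nat} (M : semialgebraic_set R m).

Definition cont_on (H : 'rV[R]_m -> R) (x : 'rV[R]_m) := H @ within (carrier M) (nbhs x) --> H x.

(** Continuity of v is only required where the cutoff u does not vanish: at a zero
    of u the bound on v makes the product small. *)
Lemma bsaf_cutoff (u v : 'rV[R]_m -> R) : dfun u -> dfun v ->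
  (forall x, carrier M x -> cont_on u x) ->
  (forall x, carrier M x -> u x <> 0 -> cont_on v x) ->
  (forall x, carrier M x -> `|u x| <= 1) ->
  (forall x, carrier M x -> u x <> 0 -> `|v x| <= 1) ->
  bsaf M (fun x => u x * v x).
Proof.
move=> du dv cu cv u1 v1; split; first exact: dfunM; last first.
  exists 1 => x Mx; have [->|/eqP ux] := eqVneq (u x) 0; first by rewrite mul0r normr0.
  by rewrite normrM -(mulr1 1) ler_pM ?u1 ?v1.
move=> x Mx; have [ux0|/eqP ux] := eqVneq (u x) 0; last first.
  by apply: cvgM; [exact: cu|exact: cv].
have FF : Filter (within (carrier M) (nbhs x)) by exact: within_filter.
rewrite ux0 mul0r; apply/cvgrPdist_lt => e e0.
have /cvgrPdist_lt/(_ e e0)/within_withinP[V xV VE] := cu x Mx.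
apply/within_withinP; exists V => // y My Vy; rewrite /= sub0r normrN.
have := VE y My Vy; rewrite /= ux0 sub0r normrN; apply: le_lt_trans.
have [->|/eqP uy] := eqVneq (u y) 0; first by rewrite mul0r normr0.
by rewrite normrM ler_piMr// v1.
Qed.

Variable g : 'rV[R]_m -> R.
Hypothesis dg : dfun g.
Hypothesis cg : forall x, carrier M x -> cont_on g x.

Definition ramp (T : R) x := Num.max 0 (Num.min 1 (g x - T)).

Lemma dfun_ramp T : dfun (ramp T).
Proof.
apply: dfun_max; first exact: dfun_cst.
apply: dfun_min; first exact: dfun_cst.
by apply: dfunB => //; exact: dfun_cst.
Qed.

Lemma cont_ramp T x : carrier M x -> cont_on (ramp T) x.
Proof.
move=> Mx.
have cm : continuous (fun y : R => Num.max 0 (Num.min 1 (y - T))).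
  move=> y; apply: (@continuous_max _ _ (fun _ => 0) (fun y => Num.min 1 (y - T))).
    exact: cst_continuous.
  apply: (@continuous_min _ _ (fun _ => 1) (fun y => y - T)).
    exact: cst_continuous.
  by apply: cvgB; [exact: cvg_id|exact: cvg_cst].
exact: (cvg_comp _ _ (cg Mx) (cm _)).
Qed.

Lemma ramp_bounded T x : `|ramp T x| <= 1.
Proof.
by rewrite ger0_norm ?le_max ?lexx// ge_max ler01/= ge_min lexx.
Qed.

Lemma ramp_neq0 T x : ramp T x <> 0 <-> T < g x.
Proof.
rewrite /ramp -[T < g x]subr_gt0 /Num.max; case: ifPn => h; split=> //.
- by move=> _; move: h; rewrite lt_min => /andP[].
- by move=> _ h'; rewrite h' ltxx in h.
- by move=> gT; move: h; rewrite lt_min ltr01 gT.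
Qed.

Lemma ramp_eq1 T x : T + 1 <= g x -> ramp T x = 1.
Proof.
move=> h; rewrite /ramp (min_idPl _); first by rewrite (max_idPr _) ?ler01.
by rewrite lerBrDl.
Qed.

Lemma cont_on_comp (u : R -> R) x : carrier M x -> u @ g x --> u (g x) ->
  cont_on (fun y => u (g y)) x.
Proof. by move=> Mx cu; exact: (cvg_comp _ _ (cg Mx) cu). Qed.

End cutoff.

Section fibers.
Context {R : realType} {m : nat} (M : semialgebraic_set R m).
Variables (N : 'rV[R]_m -> Prop) (g : 'rV[R]_m -> R).
Hypotheses (sN : semialgebraic N) (NM : forall x, N x -> carrier M x).
Hypotheses (dg : dfun g) (cg : forall x, carrier M x -> cont_on M g x).

Definition fiber t x := N x /\ g x = t.

Lemma sarel_fiber : sarel fiber.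
Proof.
apply: sa_and; first by apply: sa_comp sN; exact: dmap_r.
apply: sa_eq; first by apply: dfun_comp dg; exact: dmap_r.
by apply: dfun_coord; exact: dmap_l.
Qed.

Variable B : R.
Hypothesis gB : forall x, carrier M x -> 1 < g x -> forall i, `|x 0 i| <= B + g x.

Definition slice i t y := exists x, fiber t x /\ x 0 i = y.

Lemma slice_sa k i (h1 h2 : 'rV[R]_k -> R) : dfun h1 -> dfun h2 ->
  semialgebraic (fun z => slice i (h1 z) (h2 z)).
Proof.
move=> d1 d2; apply: sa_exv; apply: sa_and.
  by apply: (sarel_comp sarel_fiber); [apply: dfun_comp d1; exact: dmap_l|exact: dmap_r].
by apply: sa_eq; [exact/dfun_coord/dmap_r|apply: dfun_comp d2; exact: dmap_l].
Qed.

(** Intervals contained in a slice, coded as (- length, left end), so that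
    minimising the first coordinate yields a longest interval. *)
Let isub i t (z : 'rV[R]_2) := [/\ z 0 0 <= 0, - (B + t) <= z 0 1, z 0 1 - z 0 0 <= B + t &
  forall y, z 0 1 < y -> y < z 0 1 - z 0 0 -> slice i t y].

Let sarel_isub i : sarel (isub i).
Proof.
have d0 (j : 'I_2) : dfun (fun z : 'rV[R]_(1 + 2) => rsubmx z 0 j) by exact/dfun_coord/dmap_r.
have dt : dfun (fun z : 'rV[R]_(1 + 2) => lsubmx z 0 0) by exact/dfun_coord/dmap_l.
have dBt : dfun (fun z : 'rV[R]_(1 + 2) => B + lsubmx z 0 0) by apply: dfunD => //; exact: dfun_cst.
apply: (@sa_ext _ _ (fun z : 'rV[R]_(1 + 2) => (rsubmx z 0 0 <= 0 /\ - (B + lsubmx z 0 0) <= rsubmx z 0 1) /\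
  (rsubmx z 0 1 - rsubmx z 0 0 <= B + lsubmx z 0 0 /\
  forall y, rsubmx z 0 1 < y -> y < rsubmx z 0 1 - rsubmx z 0 0 -> slice i (lsubmx z 0 0) y))).
  by move=> z; split=> [[[? ?] [? ?]]|[? ? ? ?]].
apply: sa_and; apply: sa_and.
- by apply: sa_le => //; exact: dfun_cst.
- by apply: sa_le => //; exact: dfunN.
- by apply: sa_le => //; exact: dfunB.
have dl (h : 'rV[R]_(1 + 2) -> R) : dfun h -> dfun (fun z : 'rV[R]_(1 + 2 + 1) => h (lsubmx z)).
  by move=> dh; apply: dfun_comp dh; exact: dmap_l.
have dr : dfun (fun z : 'rV[R]_(1 + 2 + 1) => rsubmx z 0 0) by exact/dfun_coord/dmap_r.
apply: sa_all; apply: sa_imp; first exact: (sa_lt (dl _ (d0 1)) dr).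
apply: sa_imp; first exact: (sa_lt dr (dl _ (dfunB (d0 1) (d0 0)))).
exact: (slice_sa i (dl _ dt) dr).
Qed.

Let compact_isub i t : compact (isub i t).
Proof.
have c0 : continuous (fun z : 'rV[R]_2 => z 0 0) by exact: coord_continuous.
have c1 : continuous (fun z : 'rV[R]_2 => z 0 1) by exact: coord_continuous.
have cb : continuous (fun z : 'rV[R]_2 => z 0 1 - z 0 0).
  by move=> z; exact: (cvgB (c1 z) (c0 z)).
have cle (h : 'rV[R]_2 -> R) c : continuous h -> closed [set z | h z <= c].
  by move=> ch; apply: (@closed_comp _ _ h [set s | s <= c]) => [y _|]; [exact: ch|exact: closed_le].
have cge (h : 'rV[R]_2 -> R) c : continuous h -> closed [set z | c <= h z].
  by move=> ch; apply: (@closed_comp _ _ h [set s | c <= s]) => [y _|]; [exact: ch|exact: closed_ge].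
apply: bounded_closed_compact; last first.
  have -> : isub i t = [set z | z 0 0 <= 0] `&` [set z | - (B + t) <= z 0 1] `&`
      ([set z | z 0 1 - z 0 0 <= B + t] `&`
      \bigcap_(y in [set y | ~ slice i t y]) ([set z | y <= z 0 1] `|` [set z | z 0 1 - z 0 0 <= y])).
    apply/seteqP; split => z.
      move=> [h1 h2 h3 h4]; split; split => // y /= ny.
      have [yz|zy] := leP y (z 0 1); first by left.
      by right; rewrite /= leNgt; apply/negP => h; exact: ny (h4 y zy h).
    move=> [[h1 h2] [h3 h4]]; split => // y zy yz; apply: contrapT => ny.
    by have [/= |/=] := h4 y ny; [rewrite leNgt zy|rewrite leNgt yz].
  apply: closedI; apply: closedI; [exact: cle|exact: cge|exact: cle|].
  by apply: closed_bigI => y _; apply: closedU; [exact: cge|exact: cle].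
exists (2 * `|B + t|); split; first exact: num_real.
move=> e he z [h1 h2 h3 _]; rewrite /= [leLHS]/Num.norm/= mx_normrE.
have b0 := ler_norm (B + t); have b1 : - `|B + t| <= B + t by rewrite lerNl -normrN ler_norm.
apply/bigmax_leP; split; first by have := normr_ge0 (B + t); lra.
move=> [i' j] _; rewrite /= ord1 ler_norml.
have [->|->] : j = 0 \/ j = 1.
  by case: j => -[|[|//]] ?; [left|right]; apply: val_inj.
  by apply/andP; split; lra.
by apply/andP; split; lra.
Qed.

(** Let ]a t, a t + w t[ be a longest interval in the slice at level t. For each s
    in ]0, 1[ the points of N whose i-th coordinate is a + s w at their level have
    a limit q s at infinity. The function 1 - g |x_i - a - s w| / w, cut off below
    0 and near finite levels, is continuous, tends to 1 at q s, and vanishes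
    near q s' for s' <> s since its second term becomes g |s' - s|. *)
Lemma thick_slices (A : set (beta_sa M)) i T :
  (forall U r, converges U r -> U N -> A r) ->
  (forall t, T < t -> ~ thin (slice i t)) -> discrete_family R A.
Proof.
move=> NA thick.
have [|c dc hc] := compact_selection (s := [:: 1; 0]) (sarel_isub i).
  by case=> -[|[|//]] ?; rewrite !inE.
pose a t : R := c t 0 1; pose w t : R := - c t 0 0.
have da : rdfun a by exact: dc.
have dw : rdfun w by apply: dfunN; exact: dc.
have slB t y : 1 < t -> slice i t y -> - (B + t) <= y <= B + t.
  move=> t1 [x [[Nx gx] <-]]; rewrite -ler_norml -gx; apply: gB; first exact: NM.
  by rewrite gx.
have aw t : Num.max T 1 < t -> 0 < w t /\ forall y, a t < y -> y < a t + w t -> slice i t y.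
  rewrite gt_max => /andP[Tt t1].
  have [c' [d [cd hcd]]] : exists c' d, c' < d /\ forall y, c' < y < d -> slice i t y.
    apply: contrapT => h; apply: (thick t Tt) => c' d cd; apply: contrapT => h'.
    apply: h; exists c', d; split => // y ycd; apply: contrapT => ny.
    by apply: h'; exists y.
  have c'B : - (B + t) <= c'.
    rewrite leNgt; apply/negP => h.
    have [y /andP[cy yd] yB] : exists2 y, c' < y < d & y < - (B + t).
      exists ((c' + Num.min d (- (B + t))) / 2); rewrite /Num.min; case: (ltP d (- (B + t))) => h';
        by [lra|apply/andP; split; lra].
    have ycd : c' < y < d by rewrite cy.
    have /andP[h1 _] := slB t y t1 (hcd y ycd).
    by lra.
  have dB : d <= B + t.
    rewrite leNgt; apply/negP => h.
    have [y /andP[cy yd] yB] : exists2 y, c' < y < d & B + t < y.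
      exists ((d + Num.max c' (B + t)) / 2); rewrite /Num.max; case: (ltP c' (B + t)) => h';
        by [lra|apply/andP; split; lra].
    have ycd : c' < y < d by rewrite cy.
    have /andP[_ h1] := slB t y t1 (hcd y ycd).
    by lra.
  pose z : 'rV[R]_2 := \row_j if j == 0 then c' - d else c'.
  have zI : isub i t z.
    by rewrite /isub !mxE /=; split=> [|//||y y1 y2]; [lra|lra|apply: hcd; apply/andP; split; lra].
  have := hc t (@compact_isub i t) (ex_intro _ z zI).
  rewrite /= => -[[[h1 h2 h3 h4] h5] _]; have := h5 z zI; rewrite !mxE /= => h6.
  rewrite /w /a; split; first by lra.
  by move=> y; exact: h4.
have [Ta cta] := eventually_continuous da; have [Tw ctw] := eventually_continuous dw.
pose T1 := Num.max (Num.max T 1) (Num.max Ta Tw).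
have T1E t : T1 < t -> [/\ Num.max T 1 < t, Ta < t & Tw < t].
  by rewrite /T1 gt_max [_ && _]andbC => /andP[]; rewrite gt_max => /andP[].
have g1 t : T1 < t -> 1 < t by move=> /T1E[]; rewrite gt_max => /andP[].
pose dev (s : R) (x : 'rV[R]_m) : R := x 0 i - a (g x) - s * w (g x).
pose v (s : R) (x : 'rV[R]_m) : R := Num.max 0 (1 - g x * `|dev s x| / w (g x)).
have dv s : dfun (v s).
  apply: dfun_max; first exact: dfun_cst.
  apply: dfunB; first exact: dfun_cst.
  apply: dfunM; last by apply: dfunV; exact: rdfun_comp.
  apply: dfunM => //; apply: dfun_norm; apply: dfunB.
    by apply: dfunB; [exact/dfun_coord/dmap_id|exact: rdfun_comp].
  by apply: dfunM; [exact: dfun_cst|exact: rdfun_comp].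
have cv s x : carrier M x -> T1 < g x -> cont_on M (v s) x.
  move=> Mx gx; have [gT gTa gTw] := T1E _ gx; have [w0 _] := aw _ gT.
  have cm := @continuous_pos_sub R 1.
  have ca' := cont_on_comp cg Mx (cta _ gTa); have cw' := cont_on_comp cg Mx (ctw _ gTw).
  suff h : cont_on M (fun x => g x * `|dev s x| / w (g x)) x by exact: (cvg_comp _ _ h (cm _)).
  apply: cvgM; last by apply: cvgV => //; rewrite gt_eqF.
  apply: cvgM; first exact: cg.
  apply: cvg_norm; apply: cvgB; last by apply: cvgM => //; exact: cvg_cst.
  by apply: cvgB => //; apply: cvg_within_filter; exact: coord_continuous.
have vb s : bsaf M (fun x => ramp g T1 x * v s x).
  apply: bsaf_cutoff.
  - exact: dfun_ramp.
  - exact: dv.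
  - by move=> x Mx; exact: cont_ramp.
  - by move=> x Mx /ramp_neq0; exact: cv.
  - by move=> x _; exact: ramp_bounded.
  - move=> x _ /ramp_neq0 gx; have [gT _ _] := T1E _ gx; have [w0 _] := aw _ gT.
    rewrite ger0_norm ?le_max ?lexx// ge_max ler01/= gerBl.
    by rewrite divr_ge0 ?mulr_ge0 ?normr_ge0// ltW// (lt_trans ltr01)// g1.
pose S (s t : R) := [set x : 'rV[R]_m | [/\ N x, t < g x & dev s x = 0]].
have PF s : 0 < s < 1 -> ProperFilter (filter_from [set t | T1 < t] (S s)).
  move=> /andP[s0 s1]; apply: filter_from_proper; first apply: filter_from_filter.
  - by exists (T1 + 1) => /=; lra.
  - move=> t t' /= tT t'T; exists (Num.max t t'); first by rewrite /= lt_max tT.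
    by move=> x [Nx]; rewrite gt_max => /andP[gt gt'] h.
  move=> t /= tT; have tT1 : T1 < t + 1 by lra.
  have [gT _ _] := T1E _ tT1; have [w0 hw] := aw _ gT.
  have [||x [[Nx gx] xi]] := hw (a (t + 1) + s * w (t + 1)).
  - by rewrite ltrDl mulr_gt0.
  - by rewrite ltrD2l gtr_pMl.
  by exists x; split => //; rewrite ?gx; [lra|rewrite /dev gx xi; ring].
have hq s : exists q : beta_sa M, 0 < s < 1 ->
    exists2 U, converges U q & forall t, T1 < t -> U (S s t).
  have [s01|nx] := pselect (0 < s < 1).
    have PFs := PF s s01; have [U [UU SU]] := ultraFilterLemma PFs.
    have US t : T1 < t -> U (S s t) by move=> tT; apply: SU; exists t.
    have UM : U (carrier M).
      have T11 : T1 < T1 + 1 by lra.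
      by apply: filterS (US _ T11) => x [/NM].
    by have [q cU] := ultra_converges UU UM; exists q => _; exists U.
  (* an arbitrary point, for s outside ]0, 1[ *)
  have PFh : ProperFilter (filter_from [set t | T1 < t] (S (2^-1))).
    by apply: PF; apply/andP; split; lra.
  have [U [UU SU]] := ultraFilterLemma PFh.
  have UM : U (carrier M).
    apply: filterS (SU (S 2^-1 (T1 + 1)) _) => [x [/NM]//|].
    by exists (T1 + 1) => //=; lra.
  by have [q cU] := ultra_converges UU UM; exists q.
have [q hqU] := choice hq.
exists q, (fun s => [set r | ev r (mkbsa (vb s)) <> 0]) => s s01.
have [U cU US] := hqU s s01; have [UU UM _] := cU.
have T12 : T1 < T1 + 1 by lra.
split.
- by apply: (NA U) => //; apply: filterS (US _ T12) => x [].
- exact: open_beta.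
- rewrite /= (@ev_mk _ _ _ U _ _ _ 1 cU); first by apply/eqP; exact: oner_neq0.
  apply: (@cvg_trans _ ((fun _ : 'rV[R]_m => 1 : R) @ U)); last exact: cvg_cst.
  apply: near_eq_cvg; apply: filterS (US _ T12) => x [Nx gx h].
  by rewrite ramp_eq1 ?ltW// /v h normr0 mulr0 mul0r subr0 (max_idPr _) ?ler01// mulr1.
- move=> s' s'01; apply: contraPP => /eqP ss'; rewrite /=; apply.
  have [U' cU' US'] := hqU s' s'01; have [UU' UM' _] := cU'.
  apply: (@ev_mk _ _ _ U' _ _ _ 0 cU').
  apply: (@cvg_trans _ ((fun _ : 'rV[R]_m => 0 : R) @ U')); last exact: cvg_cst.
  have d0 : 0 < `|s' - s| by rewrite normr_gt0 subr_eq0.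
  have tT : T1 < Num.max (T1 + 1) `|s' - s|^-1 by rewrite lt_max T12.
  apply: near_eq_cvg; apply: filterS (US' _ tT) => x [Nx]; rewrite gt_max => /andP[gx gs] h.
  have gx1 : T1 < g x by lra.
  have [gT _ _] := T1E _ gx1; have [w0 _] := aw _ gT.
  have E : dev s x = (s' - s) * w (g x).
    by move: h; rewrite /dev => h; rewrite mulrBl; lra.
  rewrite /v E normrM (gtr0_norm w0) mulrA mulfK ?gt_eqF// (max_idPl _) ?mulr0//.
  by rewrite subr_le0 -ler_pdivrMr// mul1r ltW.
Qed.

End fibers.

Lemma ord_bound (R : realType) m (T : 'I_m -> R) : exists B, forall i, T i <= B.
Proof.
exists (\sum_i `|T i|) => i; rewrite (bigD1 i)//= ler_wpDr ?ler_norm//.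
by apply: sumr_ge0 => j _; exact: normr_ge0.
Qed.

(** The box of vectors with i-th coordinate in s i is enumerated with repetitions
    by the functions from indices to positions, to obtain a bound independent of
    the lists. *)
Lemma box_seq (R : realType) m (K : nat) (s : 'I_m -> seq R) :
  (forall i, (size (s i) <= K)%N) ->
  exists t : seq 'rV[R]_m, (size t <= K.+1 ^ m)%N /\
    forall x : 'rV[R]_m, (forall i, x 0 i \in s i) -> x \in t.
Proof.
move=> sK; exists [seq \row_i nth 0 (s i) (f i) | f : {ffun 'I_m -> 'I_K.+1}]; split.
  by rewrite size_image card_ffun !card_ord.
move=> x xs; apply/fintype.imageP; exists [ffun i => inord (index (x 0 i) (s i))] => //.
apply/rowP => i; rewrite mxE ffunE inordK ?nth_index//.
by rewrite ltnS (leq_trans _ (sK i))// ltnW// index_mem.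
Qed.

Section finiteness.
Context {R : realType} {m : nat} (M : semialgebraic_set R m).
Variables (N : 'rV[R]_m -> Prop) (g : 'rV[R]_m -> R).
Hypotheses (sN : semialgebraic N) (NM : forall x, N x -> carrier M x).
Hypotheses (dg : dfun g) (cg : forall x, carrier M x -> cont_on M g x).
Variable B : R.
Hypothesis gB : forall x, carrier M x -> 1 < g x -> forall i, `|x 0 i| <= B + g x.

(** Thick slices being excluded in every direction, all coordinates of the points
    of a high level set lie in short lists. *)
Lemma finite_fibers (A : set (beta_sa M)) :
  (forall U r, converges U r -> U N -> A r) -> ~ discrete_family R A ->
  exists K T, forall t, T < t -> exists s : seq 'rV[R]_m,
    (size s <= K)%N /\ forall x, fiber N g t x -> x \in s.
Proof.
move=> NA nA.
have thin_ev i : exists T, forall t, T < t -> thin (slice N g i t).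
  have sthin : rsa (fun t => thin (slice N g i t)).
    have d1 : dfun (fun z : 'rV[R]_(1 + 1 + 1 + 1) => rsubmx z 0 0) by exact/dfun_coord/dmap_r.
    have d2 : dfun (fun z : 'rV[R]_(1 + 1 + 1 + 1) => rsubmx (lsubmx z) 0 0).
      by apply: (dfun_coord 0 (F := fun z => rsubmx (lsubmx z))); apply: dmap_rsubmx; exact: dmap_l.
    have d3 : dfun (fun z : 'rV[R]_(1 + 1 + 1 + 1) => rsubmx (lsubmx (lsubmx z)) 0 0).
      apply: (dfun_coord 0 (F := fun z => rsubmx (lsubmx (lsubmx z)))); apply: dmap_rsubmx.
      by apply: dmap_lsubmx; exact: dmap_l.
    have d4 : dfun (fun z : 'rV[R]_(1 + 1 + 1 + 1) => lsubmx (lsubmx (lsubmx z)) 0 0).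
      by apply: (dfun_coord 0 (F := fun z => lsubmx (lsubmx (lsubmx z)))); do 2!apply: dmap_lsubmx; exact: dmap_l.
    apply: (@sa_ext _ _ (fun z : 'rV[R]_1 => forall a b, a < b -> exists y, (a < y /\ y < b) /\ ~ slice N g i (z 0 0) y)).
      move=> z; split=> h a b ab; have := h a b ab.
        by move=> [y [[ay yb] ny]]; exists y => //; rewrite ay.
      by move=> [y /andP[ay yb] ny]; exists y.
    apply: sa_all; apply: sa_all; apply: sa_imp.
      apply: sa_lt; last exact/dfun_coord/dmap_r.
      by apply: (dfun_coord 0 (F := fun z => rsubmx (lsubmx z))); apply: dmap_rsubmx; exact: dmap_l.
    apply: sa_ex; apply: sa_and; first by apply: sa_and; exact: sa_lt.
    by apply: sa_not; exact: slice_sa.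
  have [T [|hT]] := eventually_dichotomy sthin; first by exists T.
  by case: nA; exact: (thick_slices sN NM dg cg gB NA hT).
have [T hT] := choice thin_ev; have [T0 hT0] := ord_bound T.
have finK i : exists K : nat, forall t, thin (slice N g i t) ->
    exists s : seq R, (size s <= K)%N /\ forall y, slice N g i t y -> y \in s.
  have sS : semialgebraic (fun z : 'rV[R]_(1 + 1) => slice N g i (lsubmx z 0 0) (rsubmx z 0 0)).
    by apply: slice_sa => //; [exact/dfun_coord/dmap_l|exact/dfun_coord/dmap_r].
  have [K hK] := uniform_finiteness sS; exists K => t tt.
  have [|s [ss hs]] := hK (const_mx t).
    by move=> a b /tt[y yab ny]; exists y => //; rewrite row_mxKl row_mxKr !mxE.
  exists s; split => // y ty; apply: hs; by rewrite row_mxKl row_mxKr !mxE.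
have [K hK] := choice finK.
pose L := \max_i K i.
exists (L.+1 ^ m)%N, T0 => t tT.
have hs i : exists s : seq R, (size s <= L)%N /\ forall y, slice N g i t y -> y \in s.
  have [|s [ss hs]] := hK i t; first exact: hT (le_lt_trans (hT0 i) tT).
  by exists s; split => //; apply: (leq_trans ss); exact: leq_bigmax.
have [s hs'] := choice hs.
have [u [su hu]] := box_seq (fun i => (hs' i).1); exists u; split => // x fx.
by apply: hu => i; apply: (hs' i).2; exists x.
Qed.

End finiteness.

(** * Branches at infinity and end points *)

Section branches.
Context {R : realType} {m : nat} (g : 'rV[R]_m -> R).
Hypothesis dg : dfun g.

Definition rcont (c : R -> 'rV[R]_m) (t : R) := forall i, c x 0 i @[x --> t] --> c t 0 i.

Lemma eventually_rcont (c : R -> 'rV[R]_m) : rdmap c ->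
  exists T, forall t, T < t -> rcont c t.
Proof.
move=> dc; have [T hT] := choice (fun i => eventually_continuous (dc i)).
have [B hB] := ord_bound T; exists B => t Bt i; apply: hT; exact: le_lt_trans (hB i) Bt.
Qed.

Lemma compact_in_seq (A : set 'rV[R]_m) (s : seq 'rV[R]_m) :
  (forall x, A x -> x \in s) -> compact A.
Proof.
by move=> As; apply: finite_compact; apply: (@sub_finite_set _ _ [set` s]).
Qed.

(** Selecting a point in each level set and removing the resulting branch lowers
    the bound on the cardinals; the dichotomy at infinity ensures that a level set
    is nonempty for all large levels or for none. *)
Lemma branches (K : nat) (N : 'rV[R]_m -> Prop) : semialgebraic N ->
  (exists T, forall t, T < t -> exists s : seq 'rV[R]_m,
    (size s <= K)%N /\ forall x, fiber N g t x -> x \in s) ->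
  exists (T : R) (k : nat) (c : nat -> R -> 'rV[R]_m),
    (forall j, rdmap (c j) /\ forall t, T < t -> rcont (c j) t) /\
    forall t x, T < t -> fiber N g t x <-> exists2 j, (j < k)%N & x = c j t.
Proof.
elim: K N => [|K IHK] N sN [T hT].
  exists T, 0%N, (fun _ _ => 0); split.
    by move=> j; split=> [i|t _ i]; [exact: dfun_cst|exact: cvg_cst].
  move=> t x tT; split=> [fx|[]//]; have [s [+ /(_ x fx)]] := hT t tT.
  by rewrite leqn0 => /nilP ->.
have sne : rsa (fun t => exists x, fiber N g t x).
  apply: sa_exv; apply: (sarel_comp (sarel_fiber sN dg)); last exact: dmap_r.
  by apply: (dfun_coord 0); exact: dmap_l.
have [T1 [ne|none]] := eventually_dichotomy sne; last first.
  exists T1, 0%N, (fun _ _ => 0); split.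
    by move=> j; split=> [i|t _ i]; [exact: dfun_cst|exact: cvg_cst].
  by move=> t x tT; split=> [fx|[]//]; case: (none t tT); exists x.
have [|c dc hc] := compact_selection (s := enum 'I_m) (sarel_fiber sN dg).
  by move=> i; rewrite mem_enum.
have cf t : Num.max T T1 < t -> fiber N g t (c t).
  rewrite gt_max => /andP[tT tT1]; have [s [_ hs]] := hT t tT.
  by apply: mincoords_sub (hc t (compact_in_seq hs) (ne t tT1)).
pose N' x := N x /\ x <> c (g x).
have sN' : semialgebraic N'.
  by apply: sa_and => //; apply/sa_not/sa_eqv; [exact: dmap_id|exact: rdmap_comp].
have [|T2 [k [c' [dc' hc']]]] := IHK N' sN'.
  exists (Num.max T T1) => t tT; have ft := cf t tT.
  move: tT; rewrite gt_max => /andP[tT tT1]; have [s [ss hs]] := hT t tT.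
  exists (rem (c t) s); split.
    by rewrite size_rem ?hs// -subn1 leq_subLR add1n.
  move=> x [[Nx xc] gx]; rewrite gx in xc.
  by apply: rem_mem; [exact/eqP|apply: hs].
have [T3 hT3] := eventually_rcont dc.
exists (Num.max (Num.max T T1) (Num.max T2 T3)), k.+1, (fun j => if j is j'.+1 then c' j' else c).
split=> [j|t x]; last first.
  rewrite [_ < t]gt_max => /andP[tT]; rewrite gt_max => /andP[tT2 tT3].
  have ft := cf t tT; split=> [[Nx gx]|[[_ -> //|j jk ->]]]; last first.
    have [[Nj _] gj] : fiber N' g t (c' j t) by apply/hc' => //; exists j.
    by split.
  have [xc|xc] := pselect (x = c t); first by exists 0%N.
  have fx' : fiber N' g t x by split => //; split => //; rewrite gx.
  by have [j jk ->] := (hc' t x tT2).1 fx'; exists j.+1.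
split; first by case: j => [|j]; [exact: dc|exact: (dc' j).1].
move=> t; rewrite [_ < t]gt_max => /andP[tT]; rewrite gt_max => /andP[tT2 tT3].
by case: j => [|j]; [exact: hT3|exact: (dc' j).2].
Qed.

End branches.

Lemma ultra_exists T (U : set_system T) (k : nat) (P : nat -> set T) : UltraFilter U ->
  U [set x | exists2 j, (j < k)%N & P j x] -> exists2 j, (j < k)%N & U (P j).
Proof.
move=> UU; elim: k => [|k IHk] Uk.
  by have [x [j]] := filter_ex Uk.
have [UPk|UPk] := in_ultra_setVsetC (P k) UU; first by exists k.
have [|j jk UPj] := IHk; last by exists j => //; exact: ltnW.
apply: filterS (filterI Uk UPk) => x [[j + Pjx] nPk].
by rewrite ltnS leq_eqVlt => /orP[/eqP jk|jk]; [rewrite jk in Pjx|exists j].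
Qed.

Lemma cvg_coord (R : realType) m T (F : set_system T) (f : T -> 'rV[R]_m) (l : 'rV[R]_m) :
  Filter F -> (forall i, f x 0 i @[x --> F] --> l 0 i) -> f @ F --> l.
Proof.
move=> FF fl A /nbhs_sqn[e e0 eA].
have h : sqn (f x - l) @[x --> F] --> sqn (l - l).
  apply: cvg_sqn => i; under eq_fun do rewrite !mxE; rewrite !mxE.
  by apply: cvgB; [exact: fl|exact: cvg_cst].
have Fe : F [set x | sqn (f x - l) < e].
  apply: (h [set t | t < e]); apply: open_nbhs_nbhs; split; first exact: open_lt.
  by rewrite /= subrr sqn0.
have := @filterS _ F FF _ (f @^-1` A) _ Fe; apply => x; exact: eA.
Qed.

Section separation.
Context {R : realType} {m : nat}.
Variable c : nat -> R -> 'rV[R]_m.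
Hypothesis dc : forall j, rdmap (c j).

(** The squared distance from c j t to those of the points c i t, i in s, that
    differ from it, capped by 1 to cover the case where there are none. *)
Fixpoint gap_to (j : nat) (s : seq nat) (t : R) : R :=
  if s is i :: s' then
    Num.min (gap_to j s' t) (if `[< c i t = c j t >] then 1 else sqn (c i t - c j t))
  else 1.

Lemma gap_to_gt0 j s t : 0 < gap_to j s t.
Proof.
elim: s => [|i s IHs] //=; rewrite lt_min IHs /=; case: asboolP => // h.
exact: (sqn_gt0 h).
Qed.

Lemma gap_to_le j s t i : i \in s -> c i t <> c j t -> gap_to j s t <= sqn (c i t - c j t).
Proof.
elim: s => [//|i' s IHs] /=; rewrite inE => /orP[/eqP <-|/IHs h /h {}h].
  by move=> h; case: asboolP => // _; rewrite ge_min lexx orbT.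
by rewrite ge_min h.
Qed.

Lemma rdfun_gap_to j s : rdfun (gap_to j s).
Proof.
have dt : dfun (fun x : 'rV[R]_1 => x 0 0) by exact: (dfun_coord 0 (@dmap_id _ 1)).
elim: s => [|i s IHs] /=; first exact: dfun_cst.
apply: dfun_min => //; apply: dfun_if; last 2 first.
- exact: dfun_cst.
- by apply/dfun_sqn/dmapB; apply: rdmap_comp.
- by apply: sa_eqv; apply: rdmap_comp.
Qed.

End separation.

Section end_point.
Context {R : realType} {m : nat} (M : semialgebraic_set R m).
Variable g : 'rV[R]_m -> R.
Hypotheses (dg : dfun g) (cg : forall x, carrier M x -> cont_on M g x).

Let H x := (1 + Num.max 0 (g x))^-1.

Let den x : 1 <= 1 + Num.max 0 (g x).
Proof. by rewrite lerDl le_max lexx. Qed.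

Let Hpos x : 0 < H x.
Proof. by rewrite invr_gt0 (lt_le_trans ltr01). Qed.

Let bH : bsaf M H.
Proof.
split.
- apply: dfunV; apply: dfunD; first exact: dfun_cst.
  by apply: dfun_max => //; exact: dfun_cst.
- move=> x Mx; apply: cvgV; first by rewrite gt_eqF// (lt_le_trans ltr01).
  apply: cvgD; first exact: cvg_cst.
  have cm : continuous (fun y : R => Num.max 0 y).
    move=> y; apply: (@continuous_max _ _ (fun _ => 0) (fun y => y)).
      exact: cst_continuous.
    exact: cvg_id.
  exact: (cvg_comp _ _ (cg Mx) (cm _)).
- exists 1 => x _; rewrite ger0_norm ?(ltW (Hpos x))//.
  by rewrite invf_le1// (lt_le_trans ltr01).
Qed.

(** The continuous extension of 1 / (1 + max(0, g)) to the compactification; it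
    vanishes where g is infinite and serves as a coordinate near an end point. *)
Let height (r : beta_sa M) : R := ev r (mkbsa bH).

Let HV V r : converges V r -> H @ V --> height r.
Proof.
move=> cV; have [UV VM _] := cV.
exact: (cvg_on _ VM (fun x Mx => mkbsaE bH Mx) (ev_cvg (mkbsa bH) cV)).
Qed.

Let height_ge0 r : 0 <= height r.
Proof.
have [V cV] := converges_ex r; have [UV VM _] := cV.
have h1 := HV cV.
have h2 : H @ V --> `|height r|.
  have <- : (fun x => `|H x|) = H by apply/funext => x; rewrite gtr0_norm.
  by apply: cvg_norm.
by rewrite (lim_unique _ h1 h2) normr_ge0.
Qed.

Let height0 V r : converges V r -> height r = 0 -> forall T, V [set x | T < g x].
Proof.
move=> cV r0 T; have [UV VM _] := cV; have := HV cV; rewrite r0.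
pose e : R := (1 + Num.max 0 T)^-1.
have e0 : 0 < e by rewrite invr_gt0 ltr_pwDl// le_max lexx.
move=> /cvgrPdist_lt/(_ e e0); apply: filterS => x /=.
rewrite sub0r normrN gtr0_norm// /H /e ltf_pV2 ?posrE ?(lt_le_trans ltr01)//; last first.
  by rewrite lerDl le_max lexx.
by rewrite ltrD2l lt_max !gt_max ltxx/= => /andP[].
Qed.

Let height_infty V r : converges V r -> (forall T, V [set x | T < g x]) -> height r = 0.
Proof.
move=> cV Vg; have [UV VM _] := cV.
suff h : H @ V --> (0 : R) by exact: (lim_unique _ (HV cV) h).
apply/cvgrPdist_lt => e e0; apply: filterS (Vg e^-1) => x /= h.
have dp := lt_le_trans ltr01 (den x).
rewrite sub0r normrN gtr0_norm// /H -[ltRHS]invrK ltf_pV2 ?posrE ?invr_gt0//.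
by apply: (lt_le_trans h); rewrite ler_wpDl// le_max lexx orbT.
Qed.

(** M is dense. *)
Lemma not_isolated (q : beta_sa M) : (forall p, q <> beta_pt p) -> ~ open [set q].
Proof.
move=> qM oq; have /nbhs_beta[f qf fq] : nbhs q [set q] by exact: open_nbhs_nbhs.
have [V cV] := converges_ex q; have [UV VM _] := cV.
have [x [Mx /= fx]] := filter_ex (filterI VM (ev_neq0 cV qf)).
apply: (qM (exist _ x (mem_set Mx))); apply/esym/fq.
by rewrite ev_pt -extE.
Qed.

Variable B : R.
Hypothesis gB : forall x, carrier M x -> 1 < g x -> forall i, `|x 0 i| <= B + g x.

(** An ultrafilter defining q contains one of the branches, say c j. A bump function
    psi around c j, as wide as the distance to the other branches, is 1 at q and,
    on N, vanishes off c j. On the neighbourhood of q where psi does not vanish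
    every point is a limit along c j. It is determined by its height:
    a positive height gives the level of a point of M on the branch, and at
    height 0 every bounded semialgebraic function has a single limit along c j. *)
Lemma end_point (q : beta_sa M) (W : set_system 'rV[R]_m) : converges W q ->
  (forall T, W [set x | T < g x]) -> tame R q -> end_like R q.
Proof.
move=> cW Wg /tame_above[f [e [A [e0 fe NA nA]]]]; have [UW WM _] := cW.
have hq := height_infty cW Wg.
split.
  apply: not_isolated => p qp; move: hq; rewrite /height qp ev_pt => /eqP.
  by apply/negP; rewrite gt_eqF//; exact: Hpos.
pose N := above f e.
have sN : semialgebraic N by exact: sa_above.
have NM x : N x -> carrier M x by case.
have evN V r : converges V r -> e < `|ev r f| -> V N.
  by move=> cV h; have [UV VM _] := cV; exact: filterI VM (ev_gt cV h).
have [K [T0 hT0]] := finite_fibers sN NM dg cg gB NA nA.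
have [T [k [c [dc hc]]]] := branches dg sN (ex_intro _ T0 hT0).
have cN (t : R) (j : nat) : T < t -> (j < k)%N -> N (c j t).
  by move=> Tt jk; have [] := (hc t (c j t) Tt).2 (ex_intro2 _ _ j jk erefl).
have WN : W N by apply: (evN W q) => //; rewrite fe; lra.
have [j jk Wj] : exists2 j, (j < k)%N & W [set x | x = c j (g x)].
  apply: ultra_exists; apply: filterS (filterI WN (Wg T)) => x [Nx Tx].
  exact: ((hc _ x Tx).1 (conj Nx erefl)).
pose d := gap_to c j (iota 0 k).
have dd : rdfun d by apply: rdfun_gap_to => i; exact: (dc i).1.
have [Td cd] := eventually_continuous dd.
(* beyond T2 the branches cover N, levels are positive and d is continuous *)
pose T2 : R := Num.max (Num.max T 0 + 1) Td.
have T2E (t : R) : T2 <= t -> [/\ T < t, 0 < t & Td <= t].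
  rewrite ge_max => /andP[h1 h2]; split => //; apply: lt_le_trans h1.
    by rewrite ltr_pwDr// le_max lexx.
  by rewrite ltr_pwDr// le_max lexx orbT.
pose v (x : 'rV[R]_m) : R := Num.max 0 (1 - sqn (x - c j (g x)) / d (g x)).
have d0 (t : R) : 0 < d t by exact: gap_to_gt0.
have bv : bsaf M (fun x => ramp g T2 x * v x).
  apply: bsaf_cutoff.
  - exact: dfun_ramp.
  - apply: dfun_max; first exact: dfun_cst.
    apply: dfunB; first exact: dfun_cst.
    apply: dfunM; last by apply: dfunV; exact: rdfun_comp.
    by apply/dfun_sqn/dmapB; [exact: dmap_id|exact: rdmap_comp (dc j).1 dg].
  - by move=> x Mx; exact: cont_ramp.
  - move=> x Mx /ramp_neq0 gx; have [Tx _ Tdx] := T2E _ (ltW gx).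
    have Tdx' : Td < g x by apply: le_lt_trans gx; rewrite /T2 le_max lexx orbT.
    suff h : cont_on M (fun x => sqn (x - c j (g x)) / d (g x)) x.
      exact: (cvg_comp _ _ h (@continuous_pos_sub R 1 _)).
    apply: cvgM; last first.
      apply: cvgV; first by rewrite gt_eqF.
      exact: (cont_on_comp cg Mx (cd _ Tdx')).
    apply: (@cvg_sqn _ _ _ (within (carrier M) (nbhs x)) _ _ _) => i.
    under eq_fun do rewrite !mxE; rewrite !mxE; apply: cvgB.
      by apply: cvg_within_filter; exact: coord_continuous.
    exact: (cont_on_comp (u := fun t => c j t 0 i) cg Mx ((dc j).2 _ Tx i)).
  - by move=> x _; exact: ramp_bounded.
  - move=> x _ _; rewrite ger0_norm ?le_max ?lexx// ge_max ler01/= gerBl.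
    by rewrite divr_ge0 ?sqn_ge0// ltW.
pose psi := mkbsa bv.
have psiN x : N x -> ext psi x <> 0 -> T2 < g x /\ x = c j (g x).
  move=> Nx; rewrite /psi mkbsaE; last exact: NM.
  have [/eqP ->|/eqP/ramp_neq0 gx] := boolP (ramp g T2 x == 0); first by rewrite mul0r.
  move=> h; split => //; apply: contrapT => xc; apply: h.
  have [Tx _ _] := T2E _ (ltW gx).
  have [i ik xi] := (hc _ x Tx).1 (conj Nx erefl).
  have h : d (g x) <= sqn (x - c j (g x)).
    rewrite xi in xc *; rewrite -xi in xc *.
    by rewrite {2}xi; apply: gap_to_le; [rewrite mem_iota|rewrite -xi].
  rewrite /v (max_idPl _) ?mulr0//.
  by rewrite subr_le0 ler_pdivlMr// mul1r.
have psiq : ev q psi = 1.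
  apply: (ev_mk bv cW).
  apply: (@cvg_trans _ ((fun _ : 'rV[R]_m => 1 : R) @ W)); last exact: cvg_cst.
  apply: near_eq_cvg; apply: filterS (filterI Wj (Wg (T2 + 1))) => x [/= xc gx].
  by rewrite ramp_eq1 ?ltW// /v -xc subrr sqn0 mul0r subr0 (max_idPr _) ?ler01// mulr1.
pose O1 := [set r : beta_sa M | `|ev r f - ev q f| < e].
pose O2 := [set r : beta_sa M | ev r psi <> 0].
have onB V r : converges V r -> (O1 `&` O2) r -> V [set x | [/\ N x, T2 < g x & x = c j (g x)]].
  move=> cV [ro1 ro2]; have [UV VM _] := cV.
  have VN : V N.
    apply: (evN _ r) => //.
    have h1 : `|ev q f| <= `|ev q f - ev r f| + `|ev r f|.
      by rewrite -[X in `|X| <= _](subrK (ev r f)) ler_normD.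
    by move: ro1; rewrite /O1/= distrC; move: h1; rewrite fe; lra.
  by apply: filterS (filterI VN (ev_neq0 cV ro2)) => x [Nx /(psiN _ Nx)[]].
have along_branch f' : exists L : R, forall V r, converges V r -> (O1 `&` O2) r ->
    height r = 0 -> ev r f' = L.
  have [df' _ [C f'C]] := bsaf_ext f'.
  pose u (t : R) : R := ext f' (c j t).
  have du : rdfun u by apply: dfun_comp df'; apply: rdmap_comp (dc j).1 _; exact: (dfun_coord 0 (@dmap_id _ 1)).
  have uC t : `|u t| <= `|C|.
    have [Mt|nMt] := pselect (carrier M (c j t)).
      by apply: le_trans (f'C _ Mt) _; exact: ler_norm.
    by rewrite /u /ext; case: pselect => // _; rewrite normr0.
  have [L uL] := bounded_eventually_cvg du uC; exists L => V r cV ro r0.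
  have [UV VM _] := cV; apply: (ev_unique cV).
  have gV : g @ V --> +oo by apply/cvgryPgt => T'; exact: height0 cV r0 T'.
  apply: cvg_trans (cvg_comp _ _ gV uL); apply: near_eq_cvg.
  by apply: filterS (onB _ _ cV ro) => x [_ _ xc]; rewrite /= /u -xc.
have on_branch (s : R) : 0 < s -> (exists V r, [/\ converges V r, (O1 `&` O2) r & height r = s]) ->
    exists p : M, forall V r, converges V r -> (O1 `&` O2) r -> height r = s -> r = beta_pt p.
  move=> s0 ex.
  have gV V r : converges V r -> (O1 `&` O2) r -> height r = s -> g @ V --> s^-1 - 1 /\ T < s^-1 - 1.
    move=> cV ro rs; have [UV VM _] := cV.
    have gs : g @ V --> s^-1 - 1.
      have h : (fun x => (H x)^-1 - 1) @ V --> s^-1 - 1.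
        apply: cvgB; last exact: cvg_cst.
        by apply: cvgV; [rewrite gt_eqF|rewrite -rs; exact: HV].
      apply: cvg_trans h; apply: near_eq_cvg; apply: filterS (onB _ _ cV ro) => x [_ gx _].
      have [_ g0 _] := T2E _ (ltW gx).
      by rewrite /H invrK addrAC subrr add0r (max_idPr (ltW g0)).
    split => //; suff : T2 <= s^-1 - 1 by move=> /T2E[].
    rewrite leNgt; apply/negP => h.
    have Vl : V [set x | g x < T2].
      by apply: (gs [set t | t < T2]); apply: open_nbhs_nbhs; split => //; exact: open_lt.
    have [x [/= h1 [_ h2 _]]] := filter_ex (filterI Vl (onB _ _ cV ro)).
    by have := lt_trans h1 h2; rewrite ltxx.
  have [V0 [r0 [cV0 ro0 rs0]]] := ex; have [_ Ts] := gV _ _ cV0 ro0 rs0.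
  pose p : M := exist _ (c j (s^-1 - 1)) (mem_set (NM _ (cN _ _ Ts jk))).
  exists p => V r cV ro rs; have [UV VM _] := cV; have [gs _] := gV _ _ cV ro rs.
  apply: (converges_unique cV); apply: converges_pt => //.
  apply: (@cvg_trans _ ((fun x => c j (g x)) @ V)).
    move=> A' /= VA'; apply: filterS (filterI VA' (onB _ _ cV ro)) => x [/= A'x [_ _ xc]].
    by rewrite xc.
  by apply: cvg_coord => i; exact: (cvg_comp _ _ gs ((dc j).2 _ Ts i)).
apply: (@spike_paths_meet R _ q (O1 `&` O2) height).
- by apply: openI; [apply: open_ev; exact: ltW|exact: open_beta].
- split; first by rewrite /O1/= subrr normr0.
  by rewrite /O2/= psiq; apply/eqP; exact: oner_neq0.
- by move=> y _; exact: continuous_ev.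
- move=> r r' ro ro' hrr'.
  have [V cV] := converges_ex r; have [V' cV'] := converges_ex r'.
  have [r0|] := eqVneq (height r) 0.
    apply: beta_eq => f'; have [L hL] := along_branch f'.
    by rewrite (hL _ _ cV ro r0) (hL _ _ cV' ro' _)// -hrr'.
  move=> r0; have rp : 0 < height r by rewrite lt_neqAle eq_sym r0 height_ge0.
  have [|p hp] := on_branch _ rp; first by exists V, r.
  by rewrite (hp _ _ cV ro erefl) (hp _ _ cV' ro' (esym hrr')).
- exact: hq.
- by move=> y _; exact: height_ge0.
Qed.

End end_point.

(** * Tame points that are not locally compact *)

Section remainder.
Context {R : realType} {m : nat} (M : semialgebraic_set R m).

Lemma compact_sqn_ball (x : 'rV[R]_m) (e : R) : compact [set y | sqn (y - x) <= e].
Proof.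
apply: bounded_closed_compact; last exact: closed_sqn_ball.
have hb y : sqn (y - x) <= e -> `|y| <= `|e| + 1 + `|x|.
  move=> ye; rewrite -[y](subrK x) (le_trans (ler_normD _ _))// lerD2r.
  apply/ltW/norm_sqn; first by rewrite ltr_wpDl.
  have := ler_norm e; have := normr_ge0 e; move: (`|e|) => a a0 ea.
  by rewrite sqrrD1 mulr2n; have := sqr_ge0 a; lra.
exists (`|e| + 1 + `|x|); split; first exact: num_real.
by move=> d hd y /hb/le_trans; apply; exact: ltW.
Qed.

Lemma dfun_sqnB (x0 : 'rV[R]_m) : dfun (fun x => sqn (x - x0)).
Proof. by apply/dfun_sqn/dmapB; [exact: dmap_id|exact: dmap_cstv]. Qed.

Lemma coord_le_sqn (x y : 'rV[R]_m) i : `|x 0 i| <= 1 + `|y 0 i| + sqn (x - y).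
Proof.
have h := coord_sqn (x - y) i; rewrite !mxE in h.
have h1 : `|x 0 i - y 0 i| <= 1 + (x 0 i - y 0 i) ^+ 2.
  rewrite -real_normK ?num_real//; move: (`|_|) => a.
  by have := sqr_ge0 (a - 1); rewrite sqrrB1 mulr2n; have := sqr_ge0 a; lra.
have h2 : `|x 0 i| <= `|x 0 i - y 0 i| + `|y 0 i|.
  by rewrite -[X in `|X| <= _](subrK (y 0 i)) ler_normD.
lra.
Qed.

Lemma cont_inv_sqn (x0 x : 'rV[R]_m) : x <> x0 ->
  (fun x => (sqn (x - x0))^-1) @ x --> (sqn (x - x0))^-1.
Proof.
move=> xx0; have s0 : sqn (x - x0) != 0 by rewrite gt_eqF// sqn_gt0.
exact: (cvgV s0 (@continuous_sqn R m x0 x)).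
Qed.

(** Points at a large level are close to x0, hence bounded. *)
Lemma inv_sqn_bound (x0 : 'rV[R]_m) : exists B, forall x, 1 < (sqn (x - x0))^-1 ->
  forall i, `|x 0 i| <= B + (sqn (x - x0))^-1.
Proof.
have [B hB] := ord_bound (fun i => 1 + `|x0 0 i|); exists B => x h i.
have s0 : 0 < sqn (x - x0) by rewrite -invr_gt0 (lt_trans ltr01).
have s1 : sqn (x - x0) <= 1 by rewrite -invf_ge1// ltW.
have := coord_le_sqn x x0 i; have := hB i; lra.
Qed.

Lemma inv_sqn_infty (x0 : 'rV[R]_m) (U : set_system 'rV[R]_m) : Filter U -> U --> x0 ->
  U [set x | x <> x0] -> forall T, U [set x | T < (sqn (x - x0))^-1].
Proof.
move=> FU Ux0 Un T; pose e : R := (`|T| + 1)^-1.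
have e0 : 0 < e by rewrite invr_gt0 ltr_wpDl.
have Ue : U [set x | sqn (x - x0) < e] by apply: Ux0; apply/nbhs_sqn; exists e.
apply: filterS (filterI Ue Un) => x [/= xe xn].
have s0 := sqn_gt0 xn; have TT := ler_norm T.
have : `|T| + 1 < (sqn (x - x0))^-1 by rewrite -[ltLHS]invrK ltf_pV2 ?posrE.
lra.
Qed.

(** The function g tending to infinity at q is the squared norm if an ultrafilter
    defining q is unbounded, and otherwise the inverse squared distance to its
    Euclidean limit, which is not in M. *)
Lemma tame_outside (q : beta_sa M) : (forall p, q <> beta_pt p) -> tame R q -> end_like R q.
Proof.
move=> qM tq; have [U cU] := converges_ex q; have [UU UM _] := cU.
have [big|] := pselect (forall T, U [set x | T < sqn (x - 0)]).
  apply: (end_point (g := fun x => sqn (x - 0)) _ _ (B := 1) _ cU big tq).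
  - exact: dfun_sqnB.
  - by move=> x Mx; apply: cvg_within_filter; exact: continuous_sqn.
  - by move=> x _ _ i; have := coord_le_sqn x 0 i; rewrite mxE normr0 addr0.
move=> /existsNP[T nT].
have UT : U [set x | sqn (x - 0) <= T].
  have [//|] := in_ultra_setVsetC [set x | T < sqn (x - 0)] UU.
  by apply: filterS => x /= /negP; rewrite -leNgt.
have [x0 [_ Ux0]] : [set x | sqn (x - 0) <= T] `&` [set p | U --> p] !=set0.
  by have := @compact_sqn_ball 0 T; rewrite compact_ultra; exact.
have nMx0 : ~ carrier M x0.
  move=> Mx0; apply: (qM (exist _ x0 (mem_set Mx0))).
  by apply: (converges_unique cU); exact: converges_pt.
have neq x : carrier M x -> x <> x0 by move=> Mx xx0; apply: nMx0; rewrite -xx0.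
have [B hB] := inv_sqn_bound x0.
apply: (end_point (g := fun x => (sqn (x - x0))^-1) _ _ (B := B) _ cU _ tq).
- exact/dfunV/dfun_sqnB.
- by move=> x Mx; apply: cvg_within_filter; apply: cont_inv_sqn; exact: neq.
- by move=> x _; exact: hB.
- by apply: inv_sqn_infty => //; apply: filterS UM => x; exact: neq.
Qed.

Let limit_outside (N : 'rV[R]_m -> Prop) (y : 'rV[R]_m) :=
  ~ carrier M y /\ forall e : R, 0 < e -> exists x, N x /\ sqn (x - y) < e.

Let limit_outside_ultra N y : limit_outside N y ->
  exists U, [/\ UltraFilter U, U N & U --> y].
Proof.
move=> [nMy hN].
have PF : ProperFilter (filter_from [set e : R | 0 < e] (fun e => [set x | N x /\ sqn (x - y) < e])).
  apply: filter_from_proper; first apply: filter_from_filter.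
  - by exists 1 => /=.
  - move=> e d /= e0 d0; exists (Num.min e d); first by rewrite /= lt_min e0.
    by move=> x [Nx]; rewrite lt_min => /andP[].
  by move=> e /hN[x xe]; exists x.
have [U [UU hU]] := ultraFilterLemma PF; exists U; split => //.
  by apply: hU; exists 1 => //= x [].
by move=> A /nbhs_sqn[e e0 eA]; apply: hU; exists e => //= x [_]; exact: eA.
Qed.

(** With g the inverse squared distance to y, the set N is near y a finite union of
    branches, each a graph over a half-line of levels and closed there. So every
    point z <> y of cl(N) close to y lies on a branch, that is, in M. *)
Lemma limit_outside_isolated (N : 'rV[R]_m -> Prop) (A : set (beta_sa M)) y :
  semialgebraic N -> (forall x, N x -> carrier M x) ->
  (forall U r, converges U r -> U N -> A r) -> ~ discrete_family R A ->
  limit_outside N y ->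
  exists2 e, 0 < e & forall z, limit_outside N z -> sqn (z - y) < e -> z = y.
Proof.
move=> sN NM NA nA [nMy hNy].
pose g x : R := (sqn (x - y))^-1.
have dg : dfun g by exact/dfunV/dfun_sqnB.
have neq x : carrier M x -> x <> y by move=> Mx xx0; apply: nMy; rewrite -xx0.
have cg x : carrier M x -> cont_on M g x.
  by move=> Mx; apply: cvg_within_filter; apply: cont_inv_sqn; exact: neq.
have [B hB] := inv_sqn_bound y.
have [K [T0 hT0]] := finite_fibers sN NM dg cg (fun x _ => hB x) NA nA.
have [T [k [c [dc hc]]]] := branches dg sN (ex_intro _ T0 hT0).
exists (`|T| + 1)^-1; first by rewrite invr_gt0 ltr_wpDl.
move=> z bz zy; apply: contrapT => nzy.
have [U [UU UN Uz]] := limit_outside_ultra bz.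
have s0 := sqn_gt0 nzy.
have gz : g @ U --> g z by exact: cvg_trans (cvg_app _ Uz) (cont_inv_sqn nzy).
have Tz : T < g z.
  have : `|T| + 1 < g z by rewrite -[ltLHS]invrK ltf_pV2 ?posrE ?invr_gt0 ?ltr_wpDl.
  by have := ler_norm T; lra.
have UT : U [set x | T < g x].
  by apply: (gz [set t | T < t]); apply: open_nbhs_nbhs; split => //; exact: open_gt.
have [j jk Uj] : exists2 j, (j < k)%N & U [set x | x = c j (g x)].
  apply: ultra_exists; apply: filterS (filterI UN UT) => x [Nx Tx].
  exact: ((hc _ x Tx).1 (conj Nx erefl)).
have zc : z = c j (g z).
  apply/rowP => i.
  have h1 : (fun x : 'rV[R]_m => x 0 i) @ U --> z 0 i.
    by apply: cvg_trans (cvg_app _ Uz) _; exact: coord_continuous.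
  have h2 : (fun x : 'rV[R]_m => x 0 i) @ U --> c j (g z) 0 i.
    apply: cvg_trans (cvg_comp _ _ gz ((dc j).2 _ Tz i)); apply: near_eq_cvg.
    by apply: filterS Uj => x /= <-.
  exact: (lim_unique _ h1 h2).
have [Nz _] : fiber N g (g z) z by apply/(hc _ z Tz); exists j.
by case: bz => nMz _; apply/nMz/NM.
Qed.

(** Without compact neighbourhood, p is an accumulation point of cl(N) \ M. The
    squared distances from p to this set form a semialgebraic subset of R
    accumulating at 0 from the right, hence contain some ]0, b[. Picking y s at
    squared distance s b and the limit of an ultrafilter on N tending to y s
    yields a discrete family, isolated by balls around the y s. *)
Lemma tame_pt_lc (p : M) : tame R (beta_pt p : beta_sa M) -> lc_at M (set_val p).
Proof.
move=> /tame_above[f [e [A [e0 fe NA nA]]]]; rewrite ev_pt in fe.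
split; first exact: in_carrier.
pose N := above f e.
have [_ cf _] := bsaf_ext f.
have sN : semialgebraic N by exact: sa_above.
have NM x : N x -> carrier M x by case.
have [d d0 hd] : exists2 d, 0 < d & forall x, carrier M x -> sqn (x - set_val p) < d -> N x.
  have h : `|ext f x| @[x --> within (carrier M) (nbhs (set_val p))] --> `|f p|.
    by rewrite -(ext_val f p); apply: cvg_norm; exact: cf (in_carrier p).
  have /h/within_withinP[V /nbhs_sqn[d d0 dV] VE] : nbhs `|f p| [set t | e < t].
    apply: open_nbhs_nbhs; split; first exact: open_gt.
    by rewrite /= fe; lra.
  by exists d => // x Mx xd; split => //; apply: VE => //; exact: dV.
apply: contrapT => nlc.
have acc (r : R) : 0 < r -> exists2 y, limit_outside N y & 0 < sqn (y - set_val p) < r.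
  move=> r0; pose r' := Num.min r d / 2.
  have r'0 : 0 < r' by rewrite divr_gt0// lt_min r0.
  have [r'r r'd] : r' < r /\ r' < d.
    have : Num.min r d <= r by rewrite ge_min lexx.
    have : Num.min r d <= d by rewrite ge_min lexx orbT.
    by move: r'0; rewrite /r'; split; lra.
  have /existsNP[y /not_implyP[cy nCy]] : ~ closed (carrier M `&` [set y | sqn (y - set_val p) <= r']).
    move=> cl; apply: nlc; exists r' => //.
    rewrite setIC in cl *; apply: subclosed_compact cl (@compact_sqn_ball (set_val p) r') _.
    by move=> y [].
  have yr : sqn (y - set_val p) <= r'.
    have := @closed_sqn_ball R m (set_val p) r'; apply.
    by move=> V /cy[z [[_ zr] Vz]]; exists z.
  have nMy : ~ carrier M y by move=> My; apply: nCy.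
  exists y.
    split => // t t0.
    have yt : nbhs (y : 'rV[R]_m) [set z | sqn (z - y) < t] by apply/nbhs_sqn; exists t.
    have [z [[Mz zr] zt]] := cy _ yt.
    by exists z; split => //; apply: hd => //; exact: le_lt_trans zr r'd.
  rewrite (le_lt_trans yr r'r) andbT; apply: sqn_gt0 => yp.
  by apply: nMy; rewrite yp; exact: in_carrier.
have sB : semialgebraic (limit_outside N).
  apply: sa_and; first exact/sa_not/carrierP.
  apply: sa_all; apply: sa_imp; first by apply: sa_lt; [exact: dfun_cst|exact/dfun_coord/dmap_r].
  apply: sa_exv; apply: sa_and; first by apply: sa_comp sN; exact: dmap_r.
  apply: sa_lt.
    apply/dfun_sqn/dmapB; first exact: dmap_r.
    by apply: dmap_lsubmx; exact: dmap_l.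
  by apply: (dfun_coord 0 (F := fun z => rsubmx (lsubmx z))); apply: dmap_rsubmx; exact: dmap_l.
pose D t := exists y, limit_outside N y /\ sqn (y - set_val p) = t.
have sD : rsa D.
  apply: sa_exv; apply: sa_and; first by apply: sa_comp sB; exact: dmap_r.
  apply: sa_eq; last by apply: dfun_coord; exact: dmap_l.
  by apply/dfun_sqn/dmapB; [exact: dmap_r|exact: dmap_cstv].
have [|b b0 hb] := @interval_right _ D 0 sD.
  by move=> r /acc[y yN yr]; exists (sqn (y - set_val p)); [rewrite add0r|exists y].
have hs s : exists y, 0 < s < 1 -> limit_outside N y /\ sqn (y - set_val p) = s * b.
  have [/andP[s0 s1]|ns] := pselect (0 < s < 1); last by exists 0.
  (* s * b lies in ]0, b[ *)
  have [|y hy] := hb (s * b); last by exists y.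
  by rewrite add0r mulr_gt0// gtr_pMl.
have [y hy] := choice hs.
have hW s : exists qr : beta_sa M * R, 0 < s < 1 -> [/\ A qr.1, 0 < qr.2,
    (exists2 U, converges U qr.1 & U --> y s) &
    forall z, limit_outside N z -> sqn (z - y s) < qr.2 -> z = y s].
  have [s01|ns] := pselect (0 < s < 1); last by exists (beta_pt p, 0).
  have [bs _] := hy s s01; have [U [UU UN Us]] := limit_outside_ultra bs.
  have UM : U (carrier M) by apply: filterS UN.
  have [q cU] := ultra_converges UU UM.
  have [r r0 hr] := limit_outside_isolated sN NM NA nA bs.
  by exists (q, r) => _; split => //=; [exact: NA UN|exists U].
have [qr hqr] := choice hW.
have pos s : 0 < (if 0 < (qr s).2 then (qr s).2 else 1) by case: ifP.
pose ball s := mkbsa (bsaf_ball M (y s) (pos s)).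
apply: nA; exists (fun s => (qr s).1), (fun s => [set r | ev r (ball s) <> 0]) => s s01.
have [As r0 [U cU Us] hr] := hqr s s01.
have evb s' : 0 < s' < 1 -> ev (qr s').1 (ball s) = Num.max 0 ((qr s).2 - sqn (y s' - y s)).
  move=> s'01; have [_ _ [U' cU' Us'] _] := hqr s' s'01.
  apply: (ev_mk _ cU'); rewrite r0; apply: (cvg_trans (cvg_app _ Us')).
  exact: (cvg_comp _ _ (@continuous_sqn R m (y s) (y s')) (@continuous_pos_sub R _ _)).
split => //; first exact: open_beta.
  by rewrite /= evb//; apply/ball_neq0; rewrite subrr sqn0.
move=> s' s'01 /=; rewrite evb// => /ball_neq0 h.
have [bs' ds'] := hy s' s'01; have [_ ds] := hy s s01.
have ys := hr _ bs' h; move: ds'; rewrite ys ds => /(mulIf (lt0r_neq0 b0)) //.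
Qed.

End remainder.

(** * Locally compact points *)

Lemma mincoords_last (R : realType) m (Q : R -> 'rV[R]_m -> Prop) (s : seq 'I_m) i t x :
  mincoords Q (s ++ [:: i]) t x -> Q t x /\ forall y, Q t y -> x 0 i <= y 0 i.
Proof. by elim: s => [//|j s IHs] [/IHs]. Qed.

Lemma extremal_selection (R : realType) m (Q : R -> 'rV[R]_m -> Prop) (i : 'I_m) : sarel Q ->
  exists2 c, rdmap c & forall t, compact (Q t) -> (exists x, Q t x) ->
    Q t (c t) /\ forall y, Q t y -> c t 0 i <= y 0 i.
Proof.
move=> sQ; have [|c dc hc] := compact_selection (s := enum 'I_m ++ [:: i]) sQ.
  by move=> j; rewrite mem_cat mem_enum.
by exists c => // t cQ nQ; exact: mincoords_last (hc t cQ nQ).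
Qed.

Section interior_points.
Context {R : realType} {m : nat} (M : semialgebraic_set R m).

Lemma near_pt (p : M) (W : set 'rV[R]_m) : nbhs (set_val p) W ->
  nbhs (beta_pt p : beta_sa M) [set r | forall y : M, r = beta_pt y -> W (set_val y)].
Proof.
move=> /nbhs_sqn[e e0 eW]; apply/nbhs_beta; exists (mkbsa (bsaf_ball M (set_val p) e0)).
  by rewrite ev_pt; apply/ball_neq0; rewrite subrr sqn0.
by move=> r + y ry; rewrite ry ev_pt => /ball_neq0/eW.
Qed.

(** A compact trace of a ball contains the traces of small balls around its inner
    points. *)
Lemma lc_at_open (p : 'rV[R]_m) (e : R) : compact (carrier M `&` [set y | sqn (y - p) <= e]) ->
  forall y, carrier M y -> sqn (y - p) < e -> lc_at M y.
Proof.
move=> cC y My ye; split => //.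
have : nbhs y [set z | sqn (z - p) < e].
  by apply: (@continuous_sqn R m p y [set t | t < e]); apply: open_nbhs_nbhs; split; [exact: open_lt|].
move=> /nbhs_sqn[d d0 dV]; exists (d / 2); first lra.
have -> : carrier M `&` [set z | sqn (z - y) <= d / 2] =
    (carrier M `&` [set z | sqn (z - p) <= e]) `&` [set z | sqn (z - y) <= d / 2].
  apply/seteqP; split => z; last by move=> [[Mz _] zd].
  by move=> [Mz /= zd]; split => //; split => //=; apply/ltW/dV; lra.
by apply: compact_closedI => //; exact: closed_sqn_ball.
Qed.

(** Time s corresponds to squared distance s from p, that is, to the parameter
    t = 1/s; for large s the path stands still. *)
Lemma branch_path (p : M) (c : R -> 'rV[R]_m) (T : R) : 0 < T ->
  (forall t, T <= t -> [/\ carrier M (c t), sqn (c t - set_val p) = t^-1 & rcont c t]) ->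
  exists2 a : R -> beta_sa M, path_from (beta_pt p) a &
    forall s, 0 < s -> exists t (Mt : carrier M (c t)), T <= t /\
      a s = beta_pt (exist _ (c t) (mem_set Mt)).
Proof.
move=> T0 hc.
have iT0 : 0 < T^-1 by rewrite invr_gt0.
pose u (s : R) : R := (Num.min s T^-1)^-1.
have uT s : 0 < s -> T <= u s.
  move=> s0; rewrite /u -[leLHS]invrK lef_pV2 ?posrE ?lt_min ?s0//.
  by rewrite ge_min lexx orbT.
pose k s := if 0 < s then c (u s) else set_val p.
have kM s : carrier M (k s).
  by rewrite /k; case: ifP => [/uT/hc[]//|_]; exact: in_carrier.
have ksqn s : sqn (k s - set_val p) <= Num.max 0 s.
  rewrite /k; case: ifPn => [s0|_]; last by rewrite subrr sqn0 le_max lexx.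
  have [_ -> _] := hc _ (uT s s0); rewrite /u invrK (max_idPr (ltW s0)) ge_min lexx.
  by [].
have kc : continuous k.
  move=> s; rewrite /continuous_at; have [s0|s0] := ltP 0 s; last first.
    have ks : k s = set_val p by rewrite /k ltNge s0.
    rewrite ks => A /nbhs_sqn[e e0 eA].
    have sn : nbhs s [set t | t < e].
      by apply: open_nbhs_nbhs; split; [exact: open_lt|exact: le_lt_trans e0].
    apply: filterS sn => t /= te; apply: eA; apply: (le_lt_trans (ksqn t)).
    by rewrite gt_max e0.
  have [_ _ rc] := hc _ (uT s s0).
  have ucs : u @ s --> u s.
    apply: cvgV; first by rewrite gt_eqF// lt_min s0.
    apply: (@continuous_min _ _ (fun t => t) (fun _ => T^-1)); first exact: cvg_id.
    exact: cst_continuous.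
  have -> : k s = c (u s) by rewrite /k s0.
  apply: (@cvg_trans _ ((fun t => c (u t)) @ s)).
    have sn : nbhs s [set t | 0 < t].
      by apply: open_nbhs_nbhs; split; [exact: open_gt|].
    by apply: near_eq_cvg; apply: filterS sn => t /= t0; rewrite /k t0.
  by apply: (@cvg_coord R m _ (nbhs s) (fun t => c (u t)) _ (nbhs_filter s)) => i; exact: (cvg_comp _ _ ucs (rc i)).
pose K s : M := exist _ (k s) (mem_set (kM s)).
exists (fun s => beta_pt (K s)) => [|s s0].
  split=> [s||s s0].
  - have cK : K @ s --> K s.
      by move=> A /nbhs_subtype[V sV VA]; apply: (@filterS _ (nbhs s) _ _ (K @^-1` A) _ (kc s V sV)) => t Vt; exact: VA.
    exact: (cvg_comp _ _ cK (@continuous_beta_pt R m M (K s))).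
  - by congr beta_pt; apply: val_inj; rewrite /= /k ltxx.
  - move=> /beta_pt_inj /(congr1 set_val) h.
    have h' : k s = set_val p := h.
    have cus : c (u s) = set_val p by rewrite -h' /k s0.
    have := hc _ (uT s s0); rewrite cus => {h h'}.
    move=> [_ + _]; rewrite subrr sqn0 => /esym/eqP; apply/negP.
    by rewrite gt_eqF// invr_gt0 (lt_le_trans T0)// uT.
have [Mu _ _] := hc _ (uT s s0); exists (u s), Mu; split; first exact: uT.
by congr beta_pt; apply: val_inj; rewrite /= /k s0.
Qed.

Lemma nbhs_open1 (X : topologicalType) (x : X) : nbhs x [set x] -> open [set x].
Proof. by move=> xx; rewrite openE => y ->. Qed.

Lemma isolated_pt (p : M) (e : R) : 0 < e ->
  (forall y, carrier M y -> sqn (y - set_val p) < e -> y = set_val p) ->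
  open [set (beta_pt p : beta_sa M)].
Proof.
move=> e0 he; apply: nbhs_open1; apply/nbhs_pt.
exists [set y | sqn (y - set_val p) < e]; first by apply/nbhs_sqn; exists e.
move=> U r cU Ue; have [UU UM _] := cU; apply: (converges_unique cU).
apply: converges_pt => // A pA; apply: filterS (filterI UM Ue) => y [My ye].
by rewrite (he y My ye); exact: nbhs_singleton.
Qed.

(** The squared distance to p, divided by e, is a continuous bijection onto
    [0, 1). Its inverse is continuous because M is compact around p: off a
    neighbourhood of the point with value s the values stay away from s. *)
Lemma eta_of_single (p : M) (e : R) : 0 < e ->
  compact (carrier M `&` [set y | sqn (y - set_val p) <= e]) ->
  (forall s, 0 < s < e -> exists2 y, carrier M y /\ sqn (y - set_val p) = s &
     forall z, carrier M z -> sqn (z - set_val p) = s -> z = y) ->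
  eta_points (lc_points (carrier M)) (set_val p).
Proof.
move=> e0 cC single; set p0 := set_val p.
pose V := [set y : 'rV[R]_m | sqn (y - p0) < e].
have VA y : (V `&` lc_points (carrier M)) y <-> carrier M y /\ sqn (y - p0) < e.
  split=> [[Vy /lc_pointsP[]]//|[My ye]]; split => //; apply/lc_pointsP.
  exact: lc_at_open cC _ My ye.
have fI (w : V `&` lc_points (carrier M)) : sqn (set_val w - p0) / e \in `[0 : R, 1[%classic.
  have [_ we] := (VA _).1 (set_valP w); apply: mem_set.
  by rewrite /= in_itv/= divr_ge0 ?sqn_ge0 ?(ltW e0)//= ltr_pdivrMr// mul1r.
pose f w : `[0 : R, 1[%classic := exist (fun t : R => t \in `[0 : R, 1[%classic) _ (fI w).
have p0e : carrier M p0 /\ sqn (p0 - p0) < e.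
  by rewrite subrr sqn0; split => //; exact: in_carrier.
have single' s : 0 <= s < e -> exists2 y, carrier M y /\ sqn (y - p0) = s &
     forall z, carrier M z -> sqn (z - p0) = s -> z = y.
  move=> /andP[+ se]; rewrite le_eqVlt => /orP[/eqP <-|s0]; last by apply: single; rewrite s0.
  by exists p0; [rewrite subrr sqn0; split => //; exact: in_carrier|move=> z _ /sqn_eq0].
have inv (s : `[0 : R, 1[%classic) : exists w : V `&` lc_points (carrier M), sqn (set_val w - p0) = set_val s * e.
  have := set_valP s; rewrite /= in_itv/= => /andP[s0 s1].
  have [|y [My ys] _] := single' (set_val s * e).
    by rewrite mulr_ge0// ?(ltW e0)//= gtr_pMl.
  have yV : (V `&` lc_points (carrier M)) y by apply/VA; rewrite ys gtr_pMl.
  by exists (exist _ y (mem_set yV)).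
have [gi hg] := choice inv.
have fg : cancel gi f by move=> s; apply: val_inj; rewrite /= hg mulfK ?gt_eqF.
have inj (w w' : V `&` lc_points (carrier M)) : sqn (set_val w - p0) = sqn (set_val w' - p0) -> w = w'.
  move=> ww'; have [Mw we] := (VA _).1 (set_valP w); have [Mw' we'] := (VA _).1 (set_valP w').
  have [|y _ yu] := single' (sqn (set_val w - p0)); first by rewrite sqn_ge0.
  by apply: val_inj; transitivity y; [exact: yu|apply/esym/yu].
have gf : cancel f gi by move=> w; apply: inj; rewrite hg /= divfK ?gt_eqF.
have cfR : continuous (set_val \o f).
  move=> w A /= hA.
  have h : (fun y : 'rV[R]_m => sqn (y - p0) / e) @ set_val w --> sqn (set_val w - p0) / e.
    have h0 := @continuous_sqn R m p0 (set_val w).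
    exact: (cvgM h0 (cvg_cst _)).
  apply/nbhs_subtype; exists [set y : 'rV[R]_m | A (sqn (y - p0) / e)] => //.
  exact: h.
have p0V : (V `&` lc_points (carrier M)) p0 by apply/VA.
exists V, f, (exist _ p0 (mem_set p0V)); split => //.
- apply: (@open_comp _ _ (fun y : 'rV[R]_m => sqn (y - p0)) [set t | t < e]) => [y _|].
    exact: continuous_sqn.
  exact: open_lt.
- exists gi; split => //.
    move=> w A /nbhs_subtype[W wW WA]; apply: (@filterS _ (nbhs w) _ _ (f @^-1` A) _ (cfR w W wW)) => w' Ww'; exact: WA.
  move=> s A /nbhs_subtype[W /nbhs_sqn[d d0 dW] WA].
  have [Mg ge] := (VA _).1 (set_valP (gi s)).
  pose D := (carrier M `&` [set y | sqn (y - p0) <= e]) `&` [set y | d <= sqn (y - set_val (gi s))].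
  have cD : compact D.
    apply: compact_closedI => //.
    apply: (@closed_comp _ _ (fun y : 'rV[R]_m => sqn (y - set_val (gi s))) [set t | d <= t]) => [y _|].
      exact: continuous_sqn.
    exact: closed_ge.
  have [mu mu0 hmu] : exists2 mu : R, 0 < mu & forall y, D y -> mu <= `|sqn (y - p0) - set_val s * e|.
    have [D0|/set0P nD] := eqVneq D set0; first by exists 1 => // y; rewrite D0.
    have cdist : continuous (fun y : 'rV[R]_m => `|sqn (y - p0) - set_val s * e|).
      by move=> y; exact: (cvg_norm (cvgB (@continuous_sqn R m p0 y) (cvg_cst _))).
    have [y yD ymin] := EVT_min_rV nD cD (continuous_subspaceT cdist).
    exists (`|sqn (y - p0) - set_val s * e|).
      have [[My _] yd] := set_mem yD.
      rewrite normr_gt0 subr_eq0; apply/eqP => ys.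
      have [|z _ zu] := single' (sqn (y - p0)); first by rewrite sqn_ge0 ys -hg.
      have yg : y = set_val (gi s).
        by rewrite (zu y My erefl); apply/esym/zu => //; rewrite ys; exact: hg.
      by move: yd; rewrite /= yg subrr sqn0 leNgt d0.
    by move=> z zD; apply: ymin; exact: mem_set.
  apply/nbhs_subtype; exists (ball (set_val s) (mu / e)).
    by apply: nbhsx_ballx; rewrite divr_gt0.
  move=> s' s's; apply: WA; apply: dW; rewrite ltNge; apply/negP => h.
  have [Mg' ge'] := (VA _).1 (set_valP (gi s')).
  have : D (set_val (gi s')) by split => //; split => //; exact: ltW.
  move=> /hmu; rewrite hg -mulrBl normrM (gtr0_norm e0) leNgt -ltr_pdivlMr//.
  by rewrite distrC; move: s's; rewrite -ball_normE /ball_/= => ->.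
- split => //.
  have sV : semialgebraic (fun z : 'rV[R]_(m + 1) => (carrier M (lsubmx z) /\ sqn (lsubmx z - p0) < e) /\
      rsubmx z 0 0 = sqn (lsubmx z - p0) / e).
    have ds : dfun (fun z : 'rV[R]_(m + 1) => sqn (lsubmx z - p0)).
      by apply/dfun_sqn/dmapB; [exact: dmap_l|exact: dmap_cstv].
    apply: sa_and; first apply: sa_and.
    - by apply: sa_comp (carrierP M); exact: dmap_l.
    - by apply: sa_lt => //; exact: dfun_cst.
    - by apply: sa_eq; [exact/dfun_coord/dmap_r|apply: dfunM => //; exact: dfun_cst].
  apply: sa_ext sV => z; split.
    move=> [/VA Vz ze]; exists (exist _ (lsubmx z) (mem_set Vz)) => //.
    by rewrite -[RHS]hsubmxK; congr row_mx; apply/rowP => i; rewrite ord1 mxE ze.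
  move=> [w _ <-]; rewrite row_mxKl row_mxKr mxE; split => //.
  exact: ((VA _).1 (set_valP w)).
- by rewrite -[LHS]/(sqn (p0 - p0) / e) subrr sqn0 mul0r.
Qed.

End interior_points.

Section characterization.
Context {R : realType} {m : nat} (M : semialgebraic_set R m).

(** Let Q t be the part of M at squared distance 1/t from p. If for large t it
    is a single point, p belongs to eta. Otherwise some coordinate i is not
    constant on Q t, and the points of Q t of least and of greatest i-th
    coordinate describe two paths. Common points would have equal distances to p,
    hence equal parameters, contrary to the strict inequality between the i-th
    coordinates. *)
Lemma lc_not_end_like (p : M) : lc_at M (set_val p) ->
  ~ eta_points (lc_points (carrier M)) (set_val p) -> ~ end_like R (beta_pt p : beta_sa M).
Proof.
move=> [Mp [e e0 cC]] neta [nisol meet].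
set p0 := set_val p in cC neta *.
pose Q t y := carrier M y /\ sqn (y - p0) * t = 1.
have sQ : sarel Q.
  apply: sa_and; first by apply: sa_comp (carrierP M); exact: dmap_r.
  apply: sa_eq; last exact: dfun_cst.
  apply: dfunM; last by apply: dfun_coord; exact: dmap_l.
  by apply/dfun_sqn/dmapB; [exact: dmap_r|exact: dmap_cstv].
have QE t y : 0 < t -> Q t y <-> carrier M y /\ sqn (y - p0) = t^-1.
  move=> t0; have tn : t != 0 by rewrite gt_eqF.
  split=> -[My h]; split => //; last by rewrite h mulVf.
  by apply: (mulIf tn); rewrite h mulVf.
have sQ' k (h : 'rV[R]_k -> R) (F : 'rV[R]_k -> 'rV[R]_m) : dfun h -> dmap F ->
    semialgebraic (fun z => Q (h z) (F z)) by exact: sarel_comp.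
have dT : exists T, (forall t, T < t -> exists y, Q t y) \/
    (forall t, T < t -> ~ exists y, Q t y).
  apply: eventually_dichotomy; apply: sa_exv; apply: sQ'; last exact: dmap_r.
  by apply: (dfun_coord 0); exact: dmap_l.
have [T1 [ne|none]] := dT; last first.
  apply: nisol; pose d : R := (`|T1| + 1)^-1.
  have d0 : 0 < d by rewrite invr_gt0 ltr_wpDl.
  apply: (@isolated_pt R m M p d d0) => y My yd; apply: contrapT => /sqn_gt0 s0.
  have h : `|T1| + 1 < (sqn (y - p0))^-1 by rewrite -[ltLHS]invrK ltf_pV2 ?posrE.
  apply: (none (sqn (y - p0))^-1).
    by have := ler_norm T1; lra.
  by exists y; split => //; rewrite divff// gt_eqF.
pose big (t : R) := e^-1 < t.
have cQ t : big t -> compact (Q t).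
  move=> et; have t0 : 0 < t by apply: lt_trans et; rewrite invr_gt0.
  have -> : Q t = (carrier M `&` [set y | sqn (y - p0) <= e]) `&`
      [set y | sqn (y - p0) <= t^-1] `&` [set y | t^-1 <= sqn (y - p0)].
    apply/seteqP; split => y.
      move=> /(QE _ _ t0)[My h]; split; last by rewrite /= h.
      split; last by rewrite /= h.
      split => //=; rewrite h -[leRHS]invrK lef_pV2 ?posrE ?invr_gt0//; exact: ltW.
    move=> [[[My _] h1] h2]; apply/(QE _ _ t0); split => //.
    by apply/eqP; rewrite eq_le h1.
  apply: compact_closedI; last first.
    apply: (@closed_comp _ _ (fun y : 'rV[R]_m => sqn (y - p0)) [set r | t^-1 <= r]) => [y _|].
      exact: continuous_sqn.
    exact: closed_ge.
  by apply: compact_closedI => //; exact: closed_sqn_ball.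
pose wide i t := exists y z, (Q t y /\ Q t z) /\ y 0 i < z 0 i.
have dicho i : exists T, (forall t, T < t -> wide i t) \/ (forall t, T < t -> ~ wide i t).
  apply: eventually_dichotomy; apply: sa_exv; apply: sa_exv.
  have d1 : dmap (fun z : 'rV[R]_(1 + m + m) => rsubmx (lsubmx z)).
    by apply: dmap_rsubmx; exact: dmap_l.
  have d2 : dfun (fun z : 'rV[R]_(1 + m + m) => lsubmx (lsubmx z) 0 0).
    by apply: (dfun_coord 0 (F := fun z => lsubmx (lsubmx z))); apply: dmap_lsubmx; exact: dmap_l.
  apply: sa_and; last by apply: sa_lt; apply: dfun_coord => //; exact: dmap_r.
  by apply: sa_and; apply: sQ' => //; exact: dmap_r.
have [[i [Ti hTi]]|nwide] := pselect (exists i T, forall t, T < t -> wide i t); last first.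
  apply: neta.
  (* no coordinate varies on Q t for large t, so Q t is a single point *)
  have nw i : exists T, forall t, T < t -> ~ wide i t.
    have [T [h|h]] := dicho i; last by exists T.
    by case: nwide; exists i, T.
  have [T hT] := choice nw; have [B hB] := ord_bound T.
  pose b : R := `|B| + `|T1| + e^-1 + 1.
  have b0 : 0 < b.
    by rewrite /b ltr_wpDl// addr_ge0 ?invr_ge0 ?(ltW e0)// addr_ge0.
  have be : b^-1 <= e.
    rewrite -[leRHS]invrK lef_pV2 ?posrE ?invr_gt0// /b.
    by have := normr_ge0 B; have := normr_ge0 T1; lra.
  have cCb := compact_sqn_shrink be cC.
  have ib0 : 0 < b^-1 by rewrite invr_gt0.
  apply: (eta_of_single ib0 cCb) => s /andP[s0 sb].
  have bs : b < s^-1 by rewrite -[ltLHS]invrK ltf_pV2 ?posrE.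
  have is0 : 0 < s^-1 by rewrite invr_gt0.
  have e1 : 0 < e^-1 by rewrite invr_gt0.
  have sT1 : T1 < s^-1.
    apply: lt_trans bs; rewrite /b; have := ler_norm T1; have := normr_ge0 B; lra.
  have sB : B < s^-1.
    apply: lt_trans bs; rewrite /b; have := ler_norm B; have := normr_ge0 T1; lra.
  have [y Qy] := ne _ sT1; exists y; first by move/(QE _ _ is0) : Qy; rewrite invrK.
  move=> z Mz zs; have Qz : Q s^-1 z by apply/(QE _ _ is0); rewrite invrK.
  apply/rowP => i; have sTi := le_lt_trans (hB i) sB; apply/eqP; rewrite eq_le.
  apply/andP; split; rewrite leNgt; apply/negP => h; apply: (hT i _ sTi).
    by exists y, z.
  by exists z, y.
have [c1 dc1 hc1] := extremal_selection i sQ.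
have sQN : sarel (fun t z => Q t (- z)).
  apply: sQ'; first by apply: dfun_coord; exact: dmap_l.
  move=> j; apply: dfun_ext (dfunN (@dmap_r R 1 m j)) => z; by rewrite !mxE.
have [c2 dc2 hc2] := extremal_selection i sQN.
(* least coordinate on - Q t, that is, greatest on Q t *)
pose c3 t := - c2 t.
have dc3 : rdmap c3 by move=> j; apply: dfun_ext (dfunN (dc2 j)) => z; rewrite /c3 mxE.
have [Tc1 hTc1] := eventually_rcont dc1; have [Tc3 hTc3] := eventually_rcont dc3.
pose T : R := `|Ti| + `|T1| + `|Tc1| + `|Tc3| + e^-1 + 1.
have e1 : 0 < e^-1 by rewrite invr_gt0.
have TE t : T <= t -> [/\ 0 < t, T1 < t & e^-1 < t] /\ [/\ Ti < t, Tc1 < t & Tc3 < t].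
  rewrite /T => h; have := ler_norm Ti; have := ler_norm T1; have := ler_norm Tc1.
  have := ler_norm Tc3; have := normr_ge0 Ti; have := normr_ge0 T1.
  have := normr_ge0 Tc1; have := normr_ge0 Tc3 => *; do 2!split; lra.
have T0 : 0 < T by have [[]] := TE T (lexx T).
have ar1 t : T <= t -> [/\ carrier M (c1 t), sqn (c1 t - p0) = t^-1 & rcont c1 t].
  move=> /TE[[t0 tT1 te] [_ tc _]]; have [Qc _] := hc1 t (cQ t te) (ne t tT1).
  by have [h1 h2] := (QE _ _ t0).1 Qc; split => //; exact: hTc1.
have hc3 t : T <= t -> Q t (c3 t) /\ forall y, Q t y -> y 0 i <= c3 t 0 i.
  move=> /TE[[t0 tT1 te] _].
  have cQN : compact (fun z : 'rV[R]_m => Q t (- z)).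
    have -> : (fun z : 'rV[R]_m => Q t (- z)) = (fun y : 'rV[R]_m => - y) @` Q t.
      apply/seteqP; split => y; first by move=> h; exists (- y); rewrite ?opprK.
      by move=> [z Qz <-]; rewrite opprK.
    apply: continuous_compact (cQ t te); apply: continuous_subspaceT => y.
    exact: opp_continuous.
  have [|h1 h2] := hc2 t cQN.
    by have [y Qy] := ne t tT1; exists (- y); rewrite opprK.
  split=> [//|y Qy]; have := h2 (- y); rewrite opprK => /(_ Qy).
  by rewrite /c3 !mxE lerNr.
have ar3 t : T <= t -> [/\ carrier M (c3 t), sqn (c3 t - p0) = t^-1 & rcont c3 t].
  move=> tT; have [Qc _] := hc3 t tT; have [[t0 _ _] [_ _ tc]] := TE t tT.
  by have [h1 h2] := (QE _ _ t0).1 Qc; split => //; exact: hTc3.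
have [a1 pa1 ha1] := branch_path T0 ar1; have [a3 pa3 ha3] := branch_path T0 ar3.
have [s [s' [s0 s'0 ss']]] := meet a1 a3 pa1 pa3.
have [t [Mt [tT at_]]] := ha1 s s0; have [t' [Mt' [tT' at'_]]] := ha3 s' s'0.
move: ss'; rewrite at_ at'_ => /beta_pt_inj /(congr1 set_val) h.
have {}h : c1 t = c3 t' := h.
have tt' : t = t'.
  apply: invr_inj; have [_ <- _] := ar1 t tT; have [_ <- _] := ar3 t' tT'.
  by rewrite h.
have [[t0 tT1 te] [tTi _ _]] := TE t tT; rewrite -tt' in h tT'.
have [y [z [[Qy Qz] yz]]] := hTi t tTi.
have [_ h1] := hc1 t (cQ t te) (ne t tT1); have [_ h3] := hc3 t tT.
have := le_lt_trans (h1 y Qy) (lt_le_trans yz (h3 z Qz)).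
by rewrite h ltxx.
Qed.

Lemma nbhs_lc (p : M) (W : set 'rV[R]_m) : lc_at M (set_val p) -> nbhs (set_val p) W ->
  nbhs (beta_pt p : beta_sa M) [set r | exists2 y : M, r = beta_pt y & W (set_val y)].
Proof.
move=> [Mp [e e0 cC]] /nbhs_sqn[d d0 dW]; apply/nbhs_pt.
exists [set y | sqn (y - set_val p) <= Num.min e (d / 2)].
  apply/nbhs_sqn; exists (Num.min e (d / 2)); first by rewrite lt_min e0; lra.
  by move=> y /ltW.
move=> U r cU Ue; have [UU UM _] := cU.
have cC' : compact (carrier M `&` [set y | sqn (y - set_val p) <= Num.min e (d / 2)]).
  by apply: compact_sqn_shrink cC; rewrite ge_min lexx.
have [|y [My /= yd] ->] := compact_converges cU _ cC' (filterI UM Ue); first by move=> y [].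
by exists y => //; apply: dW; move: yd; rewrite le_min => /andP[_]; lra.
Qed.

(** M_lc is open in the compactification, so a chart of M_lc around p is a chart of
    the compactification. *)
Lemma eta_end_like (p : M) : lc_at M (set_val p) ->
  eta_points (lc_points (carrier M)) (set_val p) -> end_like R (beta_pt p : beta_sa M).
Proof.
move=> lcp [V [f [q [oV [fi [cf cfi fK fiK]] sf qp fq]]]].
have cfv : continuous (fun w => set_val (f w)).
  by move=> w; exact: (cvg_comp _ _ (cf w) (@initial_continuous _ _ set_val (f w))).
pose A := V `&` lc_points (carrier M).
have AM y : A y -> carrier M y by move=> [_ /lc_pointsP[]].
pose j (w : A) : M := exist _ (set_val w) (mem_set (AM _ (set_valP w))).
have jinj : injective j by move=> w w' /(congr1 set_val) h; exact: val_inj.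
have jq : j q = p by apply: val_inj; exact: qp.
pose h (r : beta_sa M) : R :=
  if pselect (exists w, r = beta_pt (j w)) is left ex then set_val (f (projT1 (cid ex))) else 0.
have hj w : h (beta_pt (j w)) = set_val (f w).
  rewrite /h; case: pselect => [ex|[]]; last by exists w.
  by case: cid => w' /= /beta_pt_inj/jinj <-.
pose U := [set r : beta_sa M | exists w, r = beta_pt (j w)].
have nbhsU w W : nbhs (set_val w) W ->
    nbhs (beta_pt (j w) : beta_sa M) [set r | exists w', r = beta_pt (j w') /\ W (set_val w')].
  move=> wW; have [Vw lcw] := set_valP w; have lcw' := (lc_pointsP _ _).1 lcw.
  have [_ [e e0 cC]] := lcw'.
  have n1 : nbhs (set_val (j w)) (W `&` (V `&` [set y | sqn (y - set_val w) < e])).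
    apply: filterI => //; apply: filterI; first exact: open_nbhs_nbhs.
    by apply/nbhs_sqn; exists e.
  have := @nbhs_lc (j w) _ lcw' n1; apply: filterS => r [y -> [Wy [Vy ye]]].
  have Ay : A (set_val y).
    by split => //; apply/lc_pointsP; apply: (lc_at_open cC) => //; exact: in_carrier.
  exists (exist _ (set_val y) (mem_set Ay)); split => //.
  by congr beta_pt; exact: val_inj.
split.
  move=> op; have np : nbhs p (@beta_pt R m M @^-1` [set (beta_pt p : beta_sa M)]).
    by apply: continuous_beta_pt; exact: open_nbhs_nbhs.
  move/nbhs_subtype : np => [V' pV' V'p].
  have : nbhs (f q) (fi @^-1` [set w | V' (set_val w)]).
    apply: cfi; rewrite fK; apply/nbhs_subtype; exists V' => //.
    by rewrite qp.
  move=> /nbhs_subtype[W /nbhs_ballP[e /= e0 eW] Wf]; rewrite fq in eW.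
  pose s : R := Num.min (e / 2) 2^-1.
  have s0 : 0 < s by rewrite lt_min divr_gt0//= invr_gt0.
  have sI : s \in `[0 : R, 1[%classic.
    apply: mem_set; rewrite /= in_itv/= ltW//= /s gt_min; apply/orP; right.
    by rewrite invf_lt1// ltr1n.
  pose s' : `[0 : R, 1[%classic := exist (fun t : R => t \in `[0 : R, 1[%classic) _ sI.
  have se : ball 0 e (set_val s').
    rewrite -ball_normE /ball_/= sub0r normrN gtr0_norm// gt_min; apply/orP; left; lra.
  have /(V'p (j _))/beta_pt_inj jp : V' (set_val (fi s')) by exact: Wf s' (eW _ se).
  have : f (fi s') = f q by congr f; apply: jinj; rewrite jp jq.
  by rewrite fiK => /(congr1 set_val); rewrite fq => /eqP; apply/negP; rewrite gt_eqF.
apply: (@spike_paths_meet R _ _ U h).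
- rewrite openE => r [w ->]; have nT : nbhs (set_val w) setT by exact: filterT.
  have /nbhs_beta[k kw kU] := nbhsU w setT nT.
  suff : nbhs (beta_pt (j w) : beta_sa M) U by [].
  by apply/nbhs_beta; exists k => // r' /kU[w' [-> _]]; exists w'.
- by exists q; rewrite jq.
- move=> r [w ->]; rewrite hj => B /cfv /nbhs_subtype[W wW WB].
  have /nbhs_beta[k kw kW] := nbhsU w W wW.
  suff : nbhs (beta_pt (j w) : beta_sa M) (h @^-1` B) by [].
  apply/nbhs_beta; exists k => // r' /kW[w' [-> Ww']].
  by rewrite /= hj; exact: WB.
- move=> r r' [w ->] [w' ->]; rewrite !hj => /val_inj h1.
  by rewrite -(fK w) h1 fK.
- by rewrite -jq hj.
- by move=> r [w ->]; rewrite hj; have := set_valP (f w); rewrite /= in_itv/= => /andP[].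
Qed.

Lemma tame_not_end_like_iff (r : beta_sa M) : (tame R r /\ ~ end_like R r) <->
  exists p : lc_points (carrier M) `\` eta_points (lc_points (carrier M)),
    r = beta_pt (set_incl (@lcD_eta_sub _ _ (carrier M)) p).
Proof.
split=> [[tr nr]|[p ->]].
  have [[p rp]|nM] := pselect (exists p, r = beta_pt p); last first.
    by case: nr; apply: tame_outside => // p rp; apply: nM; exists p.
  rewrite rp in tr nr; have lcp := tame_pt_lc tr.
  have pA : (lc_points (carrier M) `\` eta_points (lc_points (carrier M))) (set_val p).
    by split; [exact/lc_pointsP|move=> /(eta_end_like lcp)].
  exists (exist _ (set_val p) (mem_set pA)); rewrite rp; congr beta_pt; exact: val_inj.
have [/lc_pointsP lcp np] := set_valP p.
by split; [exact: tame_lc|exact: lc_not_end_like].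
Qed.

End characterization.

(** * Restriction of a homeomorphism *)

Section restriction.
Context {R : realType} {m n : nat} (M : semialgebraic_set R m) (N : semialgebraic_set R n).

Let lcD k (A : set 'rV[R]_k) := lc_points A `\` eta_points (lc_points A).
Let pt k (A : semialgebraic_set R k) (p : lcD (carrier A)) : beta_sa A :=
  beta_pt (set_incl (@lcD_eta_sub _ _ (carrier A)) p).

Lemma pt_inj k (A : semialgebraic_set R k) : injective (@pt k A).
Proof. by move=> p p' /beta_pt_inj /(congr1 set_val) h; exact: val_inj. Qed.

(** Both M and N carry the subspace topology of their compactifications. *)
Lemma continuous_restriction (gamma : beta_sa N -> beta_sa M) (g : lcD (carrier N) -> lcD (carrier M)) :
  continuous gamma -> (forall p, gamma (pt p) = pt (g p)) -> continuous g.
Proof.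
move=> cgamma hg p A /nbhs_subtype[W gW WA].
have /cgamma : nbhs (gamma (pt p)) [set r | forall y : M, r = beta_pt y -> W (set_val y)].
  by rewrite hg; exact: near_pt.
move=> /continuous_beta_pt /nbhs_subtype[V pV VW].
apply/nbhs_subtype; exists V => // p' Vp'; apply: WA.
by apply: (VW (set_incl (@lcD_eta_sub _ _ (carrier N)) p') Vp' _ (hg p')).
Qed.

End restriction.

Theorem theorem4 (R : realType) (m n : nat)
    (M : semialgebraic_set R m) (N : semialgebraic_set R n)
    (gamma : beta_sa N -> beta_sa M) (hgamma : homeomorphism gamma) :
  exists g : lc_points N `\` eta_points (lc_points N) -> lc_points M `\` eta_points (lc_points M),
    homeomorphism g /\
    forall p : lc_points N `\` eta_points (lc_points N),
      gamma (beta_pt (set_incl (@lcD_eta_sub _ _ N) p)) =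
      beta_pt (set_incl (@lcD_eta_sub _ _ M) (g p)).
Proof.
have [delta [cg cd gK dK]] := hgamma.
have hdelta : homeomorphism delta by exists gamma.
have eg (p : lc_points N `\` eta_points (lc_points N)) :
    exists p' : lc_points M `\` eta_points (lc_points M),
    gamma (beta_pt (set_incl (@lcD_eta_sub _ _ N) p)) = beta_pt (set_incl (@lcD_eta_sub _ _ M) p').
  by apply/tame_not_end_like_iff/(tame_not_end_like_homeo _ hgamma)/tame_not_end_like_iff; exists p.
have [g hg] := choice eg.
have ed (p : lc_points M `\` eta_points (lc_points M)) :
    exists p' : lc_points N `\` eta_points (lc_points N),
    delta (beta_pt (set_incl (@lcD_eta_sub _ _ M) p)) = beta_pt (set_incl (@lcD_eta_sub _ _ N) p').
  by apply/tame_not_end_like_iff/(tame_not_end_like_homeo _ hdelta)/tame_not_end_like_iff; exists p.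
have [d hd] := choice ed.
exists g; split => //; exists d; split.
- exact: continuous_restriction cg hg.
- exact: continuous_restriction cd hd.
- by move=> p; apply: pt_inj; rewrite /= -hd -hg gK.
- by move=> p; apply: pt_inj; rewrite /= -hg -hd dK.
Qed.
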